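(* Let $n\ge1$, $d\ge0$. Then $\mathbb{C}[\binom{\langle n\rangle}{n}_d]/\langle I_{d,n}+L_{d,n}\rangle\cong\mathbb{C}[L\mathcal Q_d(n)]$, the homogeneous coordinate ring of the Drinfel'd Lagrangian Grassmannian; i.e. $I_{d,n}+L_{d,n}$ is the homogeneous ideal of $L\mathcal Q_d(n)$.
   Context: $\langle n\rangle=\{\bar n<\dots<\bar1<1<\dots<n\}$ with $\bar\imath=-i$, and $\mathbb{C}^{2n}$ has basis $e_{\bar n},\dots,e_n$ with symplectic form $\Omega$ given by $\Omega(e_{\bar\imath},e_i)=1$ and all other pairs of basis vectors pairing to $0$; $\mathrm{LG}(n)$ is the variety of maximal isotropic subspaces. $\mathbb{C}[\binom{\langle n\rangle}{n}_d]$ is the polynomial ring in variables $p^{(a)}_\alpha$, $\alpha$ an $n$-element subset of $\langle n\rangle$, $0\le a\le d$; $p^{(a)}_\alpha$ is the coordinate on $(S^d\mathbb{C}^2)^*\otimes\bigwedge^n\mathbb{C}^{2n}$ taking the coefficient of $s^at^{d-a}$ in the $\alpha$-th Pl\''ucker coordinate (a tuple of degree-$d$ binary forms in $s,t$). $I_{d,n}$ is the homogeneous ideal of the Drinfel'd Grassmannian $\mathcal Q_d(n,2n)$, the closure in $\mathbb P((S^d\mathbb{C}^2)^*\otimes\bigwedge^n\mathbb{C}^{2n})$ of the set of degree-$d$ algebraic maps $\mathbb P^1\to\mathrm{Gr}(n,2n)$ (each given by its Pl\''ucker coordinates, degree-$d$ forms without common zero). $L_{d,n}$ is the ideal generated by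 the linear forms $\sum_{i\in[n]:\{i,\bar\imath\}\cap\beta=\emptyset}\epsilon_i\,p^{(a)}_{\beta\cup\{\bar\imath,i\}}$, for $0\le a\le d$ and $(n-2)$-element subsets $\beta=\{\beta_1<\dots<\beta_{n-2}\}\subseteq\langle n\rangle$, where $\epsilon_i$ is the sign of the permutation sorting $(\bar\imath,i,\beta_1,\dots,\beta_{n-2})$. $L\mathcal Q_d(n)$ is the closure in $\mathbb P((S^d\mathbb{C}^2)^*\otimes\mathrm{L}(\omega_n))\subseteq\mathbb P((S^d\mathbb{C}^2)^*\otimes\bigwedge^n\mathbb{C}^{2n})$ of the set of degree-$d$ algebraic maps $\mathbb P^1\to\mathrm{LG}(n)$ (degree measured in the Pl\''ucker embedding), where $\mathrm{L}(\omega_n)=\ker(\Omega\lrcorner\bullet:\bigwedge^n\mathbb{C}^{2n}\to\bigwedge^{n-2}\mathbb{C}^{2n})$. *)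

(* Defs.v *)
From HB Require Import structures.
From mathcomp Require Import all_boot all_order all_algebra.
From mathcomp Require Import reals.
From mathcomp Require Import complex.
From mathcomp Require Import mpoly.
Set Implicit Arguments. Unset Strict Implicit. Unset Printing Implicit Defensive.
Import Order.TTheory GRing.Theory Num.Theory.
Local Open Scope ring_scope.

(* The totally ordered index set <n> = {nbar < ... < 1bar < 1 < ... < n}
   is encoded as 'I_(n+n): position k < n is the element bar(n-k),
   position n+j is the element j+1.  The order on 'I_(n+n) is the order of <n>. *)

(* barI i = bar(i+1), posI i = i+1, for i : 'I_n *)
Definition barI (n : nat) (i : 'I_n) : 'I_(n + n) := lshift n (rev_ord i).
Definition posI (n : nat) (i : 'I_n) : 'I_(n + n) := rshift n i.

Definition nsubset (n : nat) := {A : {set 'I_(n + n)} | #|A| == n}.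

Definition pidx (n d : nat) := (nsubset n * 'I_d.+1)%type.

Definition nvar (n d : nat) := #|{: pidx n d}|.

Notation Cplx R := (complex R).

Notation polyring R n d := {mpoly (Cplx R)[nvar n d]}.

Definition pvar (R : realType) (n d : nat) (x : pidx n d) : polyring R n d :=
  'X_(enum_rank x).

(* p^(a)_gamma for an arbitrary subset gamma (0 if #|gamma| <> n; only used
   when #|gamma| = n) *)
Definition pvarS (R : realType) (n d : nat) (g : {set 'I_(n + n)}) (a : 'I_d.+1)
  : polyring R n d :=
  if insub g is Some al then pvar R (al, a) else 0.

(* evaluation of a polynomial at a point c of (S^d C^2)^* (x) wedge^n C^{2n},
   given by its coordinates c (alpha, a) *)
Definition evalp (R : realType) (n d : nat) (f : polyring R n d)
  (c : pidx n d -> Cplx R) : Cplx R :=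
  f.@[fun k => c (enum_val k)].

Definition form (R : realType) (n d : nat) (c : pidx n d -> Cplx R)
  (al : nsubset n) (s t : Cplx R) : Cplx R :=
  \sum_(a < d.+1) c (al, a) * s ^+ a * t ^+ (d - a).

Definition minor (F : nzRingType) (n : nat) (A : 'M[F]_(n, n + n))
  (al : nsubset n) : F :=
  \det (colsub (fun j : 'I_n => nth (lshift n j) (enum (val al)) j) A).

(* the Gram matrix of the symplectic form Omega:
   Omega(e_{bar i}, e_i) = 1, Omega(e_i, e_{bar i}) = -1, all others 0 *)
Definition Omega (F : nzRingType) (n : nat) : 'M[F]_(n + n) :=
  \matrix_(k, l) (if (k + l == (n + n).-1)%N
                  then (if (k < n)%N then 1 else -1) else 0).

(* c is (the coefficient vector of) a degree-d map P^1 -> Gr(n,2n):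
   its Pluecker forms have no common zero, and at each point of P^1
   their values are the Pluecker coordinates of an n-dim subspace. *)
Definition GrMap (R : realType) (n d : nat) (c : pidx n d -> Cplx R) : Prop :=
  (forall s t : Cplx R, (s, t) != (0, 0) -> exists al, form c al s t != 0) /\
  (forall s t : Cplx R, (s, t) != (0, 0) ->
     exists A : 'M[Cplx R]_(n, n + n), forall al, form c al s t = minor A al).

(* c is a degree-d map P^1 -> LG(n): as above, with the subspace (row space of A)
   isotropic for Omega (hence Lagrangian, being n-dimensional). *)
Definition LGMap (R : realType) (n d : nat) (c : pidx n d -> Cplx R) : Prop :=
  (forall s t : Cplx R, (s, t) != (0, 0) -> exists al, form c al s t != 0) /\
  (forall s t : Cplx R, (s, t) != (0, 0) ->
     exists A : 'M[Cplx R]_(n, n + n),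
       (forall al, form c al s t = minor A al) /\ A *m Omega _ n *m A^T = 0).

(* homogeneous ideal of the closure of (the projectivization of) a set S of
   points: polynomials vanishing on the affine cone over S *)
Definition hom_ideal (R : realType) (n d : nat) (S : (pidx n d -> Cplx R) -> Prop)
  (f : polyring R n d) : Prop :=
  forall c, S c -> forall l : Cplx R, evalp f (fun x => l * c x) = 0.

Definition Idn (R : realType) (n d : nat) : polyring R n d -> Prop :=
  hom_ideal (@GrMap R n d).

(* number of inversions of a sequence; the sign of the permutation sorting a
   sequence of distinct elements is (-1)^(number of inversions) *)
Fixpoint inversions (m : nat) (s : seq 'I_m) : nat :=
  match s with
  | [::] => 0
  | x :: s' => (count (fun y : 'I_m => (y < x)%N) s' + inversions s')%N
  end.

Definition Lgen (R : realType) (n d : nat) (a : 'I_d.+1) (be : {set 'I_(n + n)})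
  : polyring R n d :=
  \sum_(i < n | (barI i \notin be) && (posI i \notin be))
     (-1) ^+ (inversions [:: barI i, posI i & enum be])
       *: pvarS R (be :|: [set barI i; posI i]) a.

Definition in_I_plus_L (R : realType) (n d : nat) (f : polyring R n d) : Prop :=
  exists g : polyring R n d, Idn g /\
  exists q : 'I_d.+1 * {set 'I_(n + n)} -> polyring R n d,
    f = g + \sum_(x : 'I_d.+1 * {set 'I_(n + n)} | (#|x.2| + 2 == n)%N) q x * Lgen R x.1 x.2.

Definition ILQ (R : realType) (n d : nat) : polyring R n d -> Prop :=
  hom_ideal (@LGMap R n d).

(* Main.v *)
Require Import Defs.
From HB Require Import structures.
From mathcomp Require Import all_boot all_order all_fingroup all_algebra.
From mathcomp Require Import reals complex mpoly.
From mathcomp Require Import zify ring.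
Set Implicit Arguments. Unset Strict Implicit. Unset Printing Implicit Defensive.
Import Order.TTheory GRing.Theory Num.Theory.
Local Open Scope ring_scope.

(** Order the variables p^(a)_al by the depth vectors of the periodic sequences
    they describe.  On maps into Gr(n,2n), exchanging k+n indices between p(z) and p(w)
    gives a form divisible by (z - w)^k, because frames at z and w agree modulo
    z - w; extracting coefficients straightens every product of two variables
    violating the order, at the cost of terms with more spread out levels.
    Modulo L, the coordinates of one weight satisfy the relations of a two-row
    Specht module: they are spanned by the Dyck ones, and p_al agrees up to sign
    with p_(tau al), tau al being the complement of the barred al (so that
    orthogonality acts on coordinates by tau).  Hence modulo I + L everything is a
    combination of monomials p_(al_1) p_(al_2) ... with al_i Dyck and both al_i
    and tau al_i below al_(i+1).
    Conversely these monomials are independent on maps to LG(n): multiplying the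
    frame (1 | 0) by root elements x(t_1), x(t_2), ... of the loop group of Sp(2n)
    moves it from the smallest to the largest coordinate, and if t_k = T^(w_k) with
    w_k rapidly decreasing, each coordinate is a polynomial in T whose degree is
    read off its depth vector, so that distinct standard monomials have distinct
    degrees. *)

(** * Signs and Pluecker coordinates *)

(** The two ideals are compared by a sandwich: standard monomials span modulo the smaller ideal I +
    L and are independent modulo the larger ideal of Lagrangian maps, so the ideals agree. The shape
    of [std] is dictated by independence. A short root element of Sp(2n) acts at the positions k and
    2n - k at once, with the same parameter up to sign, so degrees in T only record the multiset of
    all depths at k and at 2n - k together. The Dyck condition orders the two depths of one
    variable, and comparing both al and tau al with the next variable makes the concatenated list of
    depths increasing. A sorted list is determined by its multiset, so the monomial can be
    recovered. To read off these multisets, the exponents w_k are powers of a base W exceeding every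
    digit that occurs, so that no carries arise. One further power of T, multiplying all
    coordinates, counts the factors; this scaling is available because vanishing is tested on the
    whole affine cone. *)

Section SortSign.
Variables (m : nat) (R : pzRingType).

Variables (k : nat) (D : seq 'I_m -> R).
Hypothesis swapD : forall s1 x y s2, size (s1 ++ x :: y :: s2) = k ->
  D (s1 ++ x :: y :: s2) = - D (s1 ++ y :: x :: s2).

Lemma alternating_insert p u v x : size (p ++ x :: u ++ v) = k ->
  D (p ++ x :: u ++ v) = (-1) ^+ size u * D (p ++ u ++ x :: v).
Proof.
elim: u p => [|y u IH] p hs; first by rewrite mul1r.
rewrite /= swapD // -cat_rcons IH; last first.
  by rewrite -hs !size_cat size_rcons /= !size_cat /=; lia.
by rewrite cat_rcons exprS -!mulrA mulN1r.
Qed.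

(** Insertion sort: once the tail is sorted, carrying x past its smaller entries costs one sign for
    each inversion headed by x. The prefix p keeps the total length at k, the only length at which D
    is assumed alternating. *)
Lemma alternating_sort_prefix p s : size (p ++ s) = k ->
  D (p ++ s) =
    (-1) ^+ inversions s * D (p ++ sort (fun x y : 'I_m => x <= y)%N s).
Proof.
have tot : total (fun x y : 'I_m => x <= y)%N by move=> x y; exact: leq_total.
have tr : transitive (fun x y : 'I_m => x <= y)%N by move=> x y z; exact: leq_trans.
have asym : antisymmetric (fun x y : 'I_m => x <= y)%N.
  by move=> x y h; apply/val_inj/anti_leq.
set le := (fun x y : 'I_m => x <= y)%N in tot tr asym *.
elim: s p => [|x s IH] p hs; first by rewrite mul1r.
rewrite -cat_rcons IH; last by rewrite cat_rcons.
rewrite cat_rcons; set t := sort le s.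
have sortt : sorted le t by exact: sort_sorted.
pose lt := (fun y : 'I_m => y < x)%N.
have tE : t = filter lt t ++ filter (predC lt) t.
  apply: (sorted_eq tr asym sortt); last first.
    by rewrite perm_sym perm_filterC.
  rewrite sorted_pairwise // pairwise_cat -!sorted_pairwise //.
  rewrite !sorted_filter // !andbT; apply/allrelP => y z.
  rewrite !mem_filter /lt /le /= -leqNgt => /andP[h1 _] /andP[h2 _].
  exact: leq_trans (ltnW h1) h2.
rewrite [in LHS]tE alternating_insert -?tE; last first.
  by rewrite -hs !size_cat /= size_sort.
rewrite mulrA /= addnC exprD; congr (_ * _ * D (_ ++ _)).
  by rewrite size_filter; congr (_ ^+ _); apply/seq.permP; rewrite perm_sort.
apply: (sorted_eq tr asym).
- rewrite sorted_pairwise // pairwise_cat /= -!sorted_pairwise //.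
  rewrite !sorted_filter // !andbT; apply/andP; split.
    apply/allrelP => y z; rewrite inE !mem_filter /lt /= => /andP[h1 _].
    move=> /orP[/eqP-> | /andP[]]; first exact: ltnW.
    by rewrite -leqNgt => h2 _; exact: leq_trans (ltnW h1) h2.
  by apply/allP => y; rewrite mem_filter /lt /= -leqNgt => /andP[].
- exact: sort_sorted.
rewrite perm_sym perm_sort perm_sym.
apply: (perm_trans (y := x :: filter lt t ++ filter (predC lt) t)).
  by rewrite perm_catC /= perm_cons perm_catC.
by rewrite perm_cons -tE perm_sort.
Qed.

Lemma alternating_sort s : size s = k ->
  D s = (-1) ^+ inversions s * D (sort (fun x y : 'I_m => x <= y)%N s).
Proof. exact: (@alternating_sort_prefix [::]). Qed.

End SortSign.

Lemma sorted_enum_ord (m : nat) (A : {set 'I_m}) :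
  sorted (fun x y : 'I_m => x <= y)%N (enum A).
Proof.
rewrite -[enum _]/(filter _ _); apply: sorted_filter.
  by move=> x y z; exact: leq_trans.
by rewrite -(sorted_map (f := val) (e' := leq)) -enumT val_enum_ord iota_sorted.
Qed.

Lemma sort_uniq_enum (m : nat) (s : seq 'I_m) : uniq s ->
  sort (fun x y : 'I_m => x <= y)%N s = enum [set y in s].
Proof.
move=> us; have tr : transitive (fun x y : 'I_m => x <= y)%N.
  by move=> x y z; exact: leq_trans.
apply: (sorted_eq tr).
- by move=> x y h; apply/val_inj/anti_leq.
- by apply: sort_sorted => x y; exact: leq_total.
- exact: sorted_enum_ord.
rewrite perm_sort; apply: uniq_perm => //; first exact: enum_uniq.
by move=> y; rewrite mem_enum inE.
Qed.

Section Cdet.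
Variables (R : comNzRingType) (n : nat).
Implicit Types (A : 'M[R]_(n, n + n)) (s : seq 'I_(n + n)).

(** The default of [nth] is copied from [minor], so that [minor_cdet] holds by conversion. *)
Definition cdet A s : R :=
  \det (colsub (fun j : 'I_n => nth (lshift n j) s j) A).

Lemma minor_cdet A (al : nsubset n) : minor A al = cdet A (enum (val al)).
Proof. by []. Qed.

Lemma cdet_dup A s : size s = n -> ~~ uniq s -> cdet A s = 0.
Proof.
move=> hs; case: (posnP n) => [n0|n_gt0].
  by have /size0nil-> : size s = 0%N by rewrite hs.
pose x0 := lshift n (Ordinal n_gt0).
move=> /(uniqPn x0)[i [j [ij js e]]]; rewrite hs in js.
rewrite /cdet -det_tr.
apply: (determinant_alternate (i1 := Ordinal (ltn_trans ij js)) (i2 := Ordinal js)).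
  by rewrite -val_eqE /= neq_ltn ij.
move=> u; rewrite !mxE; congr (A u _).
by rewrite /= !(set_nth_default x0) ?hs ?(ltn_trans ij js).
Qed.

Lemma cdet_swap A s1 x y s2 : size (s1 ++ x :: y :: s2) = n ->
  cdet A (s1 ++ x :: y :: s2) = - cdet A (s1 ++ y :: x :: s2).
Proof.
move=> hs; have h1 : (size s1 < n)%N by move: hs; rewrite size_cat /=; lia.
have h2 : ((size s1).+1 < n)%N by move: hs; rewrite size_cat /=; lia.
pose i := Ordinal h1; pose j := Ordinal h2.
have ij : i != j by rewrite -val_eqE /=; lia.
rewrite /cdet -[in RHS]det_tr -[in LHS]det_tr.
have -> : (colsub (fun j0 : 'I_n => nth (lshift n j0) (s1 ++ x :: y :: s2) j0) A)^T =
  xrow i j (colsub (fun j0 : 'I_n => nth (lshift n j0) (s1 ++ y :: x :: s2) j0) A)^T.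
  apply/matrixP => u v; rewrite !mxE; congr (A v _).
  case: tpermP => [->|->|/eqP hi /eqP hj].
  - by rewrite /= !nth_cat ltnn subnn /= ltnNge leqnSn /= subSnn.
  - by rewrite /= !nth_cat ltnn subnn /= ltnNge leqnSn /= subSnn.
  - rewrite !nth_cat; case: ltnP => // hu.
    have : (u - size s1 >= 2)%N.
      move: hi hj; rewrite -!val_eqE /=; lia.
    by case: (u - size s1)%N => [|[|q]].
by rewrite xrowE det_mulmx det_perm odd_tperm ij expr1 mulN1r.
Qed.

Lemma cdet_sort A s : size s = n ->
  cdet A s = (-1) ^+ inversions s * cdet A (sort (fun x y : 'I__ => x <= y)%N s).
Proof. exact/alternating_sort/cdet_swap. Qed.

End Cdet.

Section Altext.
Variables (n : nat).

(* The value at a list s of n column labels of the alternating function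
   determined by its values P on increasing lists. *)
Definition altext (V : pzRingType) (P : nsubset n -> V) (s : seq 'I_(n + n)) : V :=
  if uniq s then
    if insub [set y in s] is Some al then (-1) ^+ inversions s * P al else 0
  else 0.

Lemma altext_minor (R : comNzRingType) (A : 'M[R]_(n, n + n)) s : size s = n ->
  altext (minor A) s = cdet A s.
Proof.
move=> hs; rewrite /altext; case: ifPn => us; last by rewrite cdet_dup.
case: insubP => [al _ e|].
  by rewrite minor_cdet [RHS]cdet_sort // sort_uniq_enum // e.
by rewrite cardsE (card_uniqP us) hs eqxx.
Qed.

Lemma inversions_sorted (m : nat) (s : seq 'I_m) :
  sorted (fun x y : 'I_m => x <= y)%N s -> inversions s = 0%N.
Proof.
elim: s => //= x s IH h.
rewrite IH ?(path_sorted h) // addn0; apply/eqP; rewrite -leqn0 leqNgt -has_count.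
apply/hasPn => y ys; rewrite -leqNgt.
have tr : transitive (fun x y : 'I_m => x <= y)%N by move=> ???; exact: leq_trans.
by move: h; rewrite (path_sortedE tr) => /andP[/allP/(_ _ ys)].
Qed.

Lemma altext_enum (V : pzRingType) (P : nsubset n -> V) (al : nsubset n) :
  altext P (enum (val al)) = P al.
Proof.
rewrite /altext enum_uniq inversions_sorted ?sorted_enum_ord // expr0.
have -> : [set y in enum (val al)] = val al by apply/setP => y; rewrite inE mem_enum.
by rewrite valK mul1r.
Qed.

Lemma altext_morph (V W : pzRingType) (f : {rmorphism V -> W}) P s :
  f (altext P s) = altext (fun al => f (P al)) s.
Proof.
rewrite /altext; case: ifP => _; last by rewrite rmorph0.
by case: insubP => [al _ _|_]; rewrite ?rmorph0 // rmorphM rmorph_sign.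
Qed.

Lemma altextZ (V : comPzRingType) (c : V) P s :
  altext (fun al => c * P al) s = c * altext P s.
Proof.
rewrite /altext; case: ifP => _; last by rewrite mulr0.
by case: insubP => [al _ _|_]; rewrite ?mulr0 // mulrCA.
Qed.

Lemma eq_altext (V : pzRingType) (P Q : nsubset n -> V) s :
  P =1 Q -> altext P s = altext Q s.
Proof. by move=> e; rewrite /altext; case: ifP => // _; case: insubP => // al _ _; rewrite e. Qed.

End Altext.

(** * Exchange relations on families of subspaces *)

Section LaplaceDvd.
Variable K : fieldType.

Lemma dvdp_prod_card (I : finType) (f : I -> {poly K}) (z : {poly K}) (P : pred I) k :
  (k <= #|P|)%N -> (forall i, P i -> z %| f i) -> z ^+ k %| \prod_i f i.
Proof.
move=> hk hP; apply: (@dvdp_trans _ (z ^+ #|P|)).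
  by rewrite -(subnK hk) exprD dvdp_mull.
rewrite (bigID P) /=; apply: dvdp_mulr; rewrite -prodr_const.
by apply: (big_ind2 (fun u v => u %| v)) => // *; exact: dvdp_mul.
Qed.

Variables (n k : nat) (T B : 'M[{poly K}]_(n, n + n)) (z : {poly K}).
Variable G : {set 'I_(n + n)}.
Hypothesis cardG : (n + k <= #|G|)%N.
Hypothesis dvdG : forall i s, s \in G -> z %| B i s - T i s.

(** Subtracting the upper rows from the lower ones makes the lower entries in the columns of G
    divisible by z. In a Leibniz term the n upper rows use at most n columns of G, so at least k of
    them are left to the lower rows. *)
Lemma dvdp_det_col_mx : z ^+ k %| \det (col_mx T B).
Proof.
have -> : \det (col_mx T B) = \det (col_mx T (B - T)).
  have -> : col_mx T (B - T) = block_mx 1%:M 0 (- 1%:M) 1%:M *m col_mx T B.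
    by rewrite mul_block_col !mul1mx mul0mx addr0 mulNmx mul1mx addrC.
  by rewrite det_mulmx det_lblock !det1 !mul1r.
apply: (big_ind (fun u => z ^+ k %| u)) => [|x y|s _]; [exact: dvdp0|exact: dvdp_add|].
apply: dvdp_mull; rewrite big_split_ord /=; apply: dvdp_mull.
apply: (@dvdp_prod_card _ _ _ [pred i | s (rshift n i) \in G]); last first.
  by move=> i hi; rewrite col_mxEd !mxE; exact: dvdG.
have <- : #|[set i | s (rshift n i) \in G]| = #|[pred i | s (rshift n i) \in G]|.
  by rewrite cardsE.
have h : G \subset [set s (lshift n i) | i : 'I_n] :|:
    [set s (rshift n i) | i in [set i | s (rshift n i) \in G]].
  apply/subsetP => u uG; rewrite inE.
  case: (split_ordP ((s^-1)%g u)) => i hi.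
    by apply/orP; left; apply/imsetP; exists i => //; rewrite -hi permKV.
  apply/orP; right; apply/imsetP; exists i; rewrite ?inE -hi permKV //.
have {h} := leq_trans (subset_leq_card h) (leq_card_setU _ _).
have := leq_imset_card (fun i => s (lshift n i)) [set: 'I_n].
have := leq_imset_card (fun i => s (rshift n i)) [set i | s (rshift n i) \in G].
rewrite cardsT card_ord.
have -> : [set s (lshift n i) | i in [set: 'I_n]] = [set s (lshift n i) | i : 'I_n].
  by apply/setP => u; apply/imsetP/imsetP => -[i _ ->]; exists i.
move: cardG; lia.
Qed.

(* Expanding both determinants regroups the sum into multiples of det (T / B),
   whose lower rows can be reduced modulo z in the columns of G. *)
Lemma dvdp_laplace_sum : z ^+ k %|
  \sum_(p : 'S_(n + n)) (-1) ^+ p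
    * (\det (colsub (fun j => p (lshift n j)) T) * \det (colsub (fun j => p (rshift n j)) B)).
Proof.
have -> : \sum_(p : 'S_(n + n)) (-1) ^+ p
    * (\det (colsub (fun j => p (lshift n j)) T) * \det (colsub (fun j => p (rshift n j)) B))
  = \sum_(t : 'S_n) \sum_(u : 'S_n) (-1) ^+ t * (-1) ^+ u *
     \det (col_mx (row_perm t T) (row_perm u B)).
  under eq_bigr => p _.
    rewrite -[\det (colsub _ T)]det_tr -[\det (colsub _ B)]det_tr big_distrlr /=.
    rewrite big_distrr /=.
    under eq_bigr => t _ do rewrite big_distrr /=.
    over.
  rewrite exchange_big /=; apply: eq_bigr => t _.
  rewrite exchange_big /=; apply: eq_bigr => u _.
  rewrite /determinant big_distrr /=; apply: eq_bigr => p _.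
  rewrite big_split_ord /=.
  have -> : \prod_(i < n) (col_mx (row_perm t T) (row_perm u B)) (lshift n i) (p (lshift n i))
     = \prod_(i < n) (colsub (fun j => p (lshift n j)) T)^T i (t i).
    by apply: eq_bigr => i _; rewrite col_mxEu !mxE.
  have -> : \prod_(i < n) (col_mx (row_perm t T) (row_perm u B)) (rshift n i) (p (rshift n i))
     = \prod_(i < n) (colsub (fun j => p (rshift n j)) B)^T i (u i).
    by apply: eq_bigr => i _; rewrite col_mxEd !mxE.
  by rewrite mulrACA [LHS]mulrCA.
apply: (big_ind (fun v => z ^+ k %| v)) => [|x y|t _]; [exact: dvdp0|exact: dvdp_add|].
apply: (big_ind (fun v => z ^+ k %| v)) => [|x y|u _]; [exact: dvdp0|exact: dvdp_add|].
apply: dvdp_mull.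
have -> : col_mx (row_perm t T) (row_perm u B)
  = block_mx (perm_mx t) 0 0 (perm_mx u) *m col_mx T B.
  by rewrite mul_block_col !mul0mx addr0 add0r !row_permE.
by rewrite det_mulmx dvdp_mull // dvdp_det_col_mx.
Qed.

End LaplaceDvd.

Section Fseq.
Variable n : nat.

Definition fseq (T : Type) (g : 'I_n -> T) : seq T := [seq g j | j <- enum 'I_n].

Lemma size_fseq T (g : 'I_n -> T) : size (fseq g) = n.
Proof. by rewrite size_map size_enum_ord. Qed.

Lemma nth_fseq T (x0 : T) (g : 'I_n -> T) (j : 'I_n) : nth x0 (fseq g) j = g j.
Proof. by rewrite (nth_map j) ?size_enum_ord // nth_ord_enum. Qed.

Definition sel (al : nsubset n) (j : 'I_n) : 'I_(n + n) :=
  nth (lshift n j) (enum (val al)) j.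

Lemma size_enum_nsubset (al : nsubset n) : size (enum (val al)) = n.
Proof. by rewrite -cardE (eqP (valP al)). Qed.

Lemma fseq_sel al : fseq (sel al) = enum (val al).
Proof.
case: (posnP n) => [n0|n_gt0].
  transitivity (@nil 'I_(n + n)); first by apply: size0nil; rewrite size_fseq.
  by apply/esym/size0nil; rewrite size_enum_nsubset.
pose x0 := lshift n (Ordinal n_gt0).
apply: (@eq_from_nth _ x0); first by rewrite size_fseq size_enum_nsubset.
move=> i; rewrite size_fseq => hi; rewrite (nth_fseq x0 _ (Ordinal hi)) /sel.
by apply: set_nth_default; rewrite size_enum_nsubset.
Qed.

Lemma cdet_fseq (R : comNzRingType) (A : 'M[R]_(n, n + n)) g :
  cdet A (fseq g) = \det (colsub g A).
Proof.
rewrite /cdet; congr (\det _); apply/matrixP => i j.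
by rewrite !mxE nth_fseq.
Qed.

Lemma minor_sel (R : comNzRingType) (A : 'M[R]_(n, n + n)) al :
  minor A al = \det (colsub (sel al) A).
Proof. by []. Qed.

Lemma sum_sel (V : nmodType) (F : 'I_(n + n) -> V) al :
  \sum_(r < n) F (sel al r) = \sum_(y in val al) F y.
Proof.
by rewrite -[RHS]big_enum -fseq_sel big_map big_enum.
Qed.

Lemma map_cdet (R S : comNzRingType) (f : {rmorphism R -> S}) (A : 'M[R]_(n, n + n)) s :
  cdet (map_mx f A) s = f (cdet A s).
Proof.
rewrite /cdet -det_map_mx; congr (\det _).
by apply/matrixP => i j; rewrite !mxE.
Qed.

Lemma map_minor (R S : comNzRingType) (f : {rmorphism R -> S}) (A : 'M[R]_(n, n + n)) al :
  minor (map_mx f A) al = f (minor A al).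
Proof. exact: map_cdet. Qed.

Lemma cdet_mull (R : comNzRingType) (C : 'M[R]_n) (A : 'M[R]_(n, n + n)) s :
  cdet (C *m A) s = \det C * cdet A s.
Proof.
rewrite /cdet -det_mulmx; congr (\det _); apply/matrixP => i j; rewrite !mxE.
by apply: eq_bigr => k _; rewrite !mxE.
Qed.

Lemma minor_mull (R : comNzRingType) (C : 'M[R]_n) (A : 'M[R]_(n, n + n)) al :
  minor (C *m A) al = \det C * minor A al.
Proof. exact: cdet_mull. Qed.

Lemma det_adj_mul (R : comNzRingType) (C : 'M[R]_n) : \det C * \det (\adj C) = \det C ^+ n.
Proof. by rewrite -det_mulmx mul_mx_adj det_scalar. Qed.

Definition repl (al : nsubset n) (i : 'I_n) (l : 'I_(n + n)) : seq 'I_(n + n) :=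
  fseq (fun j => if j == i then l else sel al j).

Lemma size_repl al i l : size (repl al i l) = n.
Proof. exact: size_fseq. Qed.

Lemma cdet_repl (R : comNzRingType) (A : 'M[R]_(n, n + n)) al i l :
  cdet A (repl al i l) = (\adj (colsub (sel al) A) *m A) i l.
Proof.
rewrite cdet_fseq (expand_det_col _ i) !mxE; apply: eq_bigr => k _.
rewrite !mxE eqxx mulrC /cofactor; congr (_ * \det _ * _).
by apply/matrixP => u v; rewrite !mxE eq_sym (negPf (neq_lift _ _)).
Qed.

(* The rows of [chartmx] span, after division by P al0, the subspace with
   Pluecker coordinates P, by Cramer's rule. *)
Definition chartmx (R : pzRingType) (P : nsubset n -> R) (al : nsubset n) : 'M[R]_(n, n + n) :=
  \matrix_(i, l) altext P (repl al i l).

Lemma chartmxE (R : comNzRingType) (P : nsubset n -> R) (al : nsubset n) (A : 'M[R]_(n, n + n)) :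
  (forall be, P be = minor A be) -> chartmx P al = \adj (colsub (sel al) A) *m A.
Proof.
move=> PA; apply/matrixP => i l; rewrite mxE -cdet_repl (eq_altext _ PA).
by rewrite altext_minor ?size_repl.
Qed.

(** The determinant of an adjugate is an (n-1)-st power; the extra factor [P al] on the left turns
    this exponent into n and avoids any division. *)
Lemma cdet_chartmx (R : comNzRingType) (P : nsubset n -> R) (al : nsubset n) (A : 'M[R]_(n, n + n)) s :
  size s = n -> (forall be, P be = minor A be) ->
  P al * cdet (chartmx P al) s = P al ^+ n * altext P s.
Proof.
move=> hs PA; rewrite (chartmxE _ PA) cdet_mull mulrA PA minor_sel det_adj_mul.
by rewrite (eq_altext _ PA) altext_minor.
Qed.

Lemma map_chartmx (R S : pzRingType) (f : {rmorphism R -> S}) (P : nsubset n -> R) al :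
  map_mx f (chartmx P al) = chartmx (fun be => f (P be)) al.
Proof. by apply/matrixP => i l; rewrite !mxE altext_morph. Qed.

End Fseq.

Lemma poly_ext (K : numDomainType) (p q : {poly K}) : (forall x, p.[x] = q.[x]) -> p = q.
Proof.
move=> e; apply/eqP; rewrite -subr_eq0; apply/negPn/negP => nz.
pose rs : seq K := [seq i%:R | i <- iota 0 (size (p - q))].
suff : (size rs < size (p - q)%R)%N by rewrite size_map size_iota ltnn.
apply: max_poly_roots nz _ _.
  by apply/allP => x _; rewrite /root hornerD hornerN e subrr.
by rewrite map_inj_uniq ?iota_uniq //; by move=> i j /eqP; rewrite eqr_nat => /eqP.
Qed.

(** The frames A may depend on z without any regularity; the identity only involves P, so it can be
    checked point by point. *)
Lemma cdet_chartmx_poly (K : numDomainType) n (P : nsubset n -> {poly K}) al s :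
  (forall z, exists A : 'M[K]_(n, n + n), forall be, (P be).[z] = minor A be) ->
  size s = n ->
  P al * cdet (chartmx P al) s = P al ^+ n * altext P s.
Proof.
move=> hP hs; apply: poly_ext => z; have [A hA] := hP z.
rewrite !hornerM -!horner_evalE -map_cdet map_chartmx rmorphXn altext_morph.
by rewrite -(cdet_chartmx al hs hA).
Qed.

Section Exchange.
Variables (n : nat) (al be : nsubset n) (x : nat).

(* Slots: the first n carry the elements of al, the last n those of be.
   The exchanged slots are those of al with label >= x and those of be
   with label < x; okT, resp. okB, are the slots whose label may appear in
   the first, resp. second, factor. *)
Definition slotcol (s : 'I_(n + n)) : 'I_(n + n) :=
  match split s with inl r => sel al r | inr r => sel be r end.
Definition okT (s : 'I_(n + n)) := (s < n)%N || (slotcol s < x)%N.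
Definition okB (s : 'I_(n + n)) := (n <= s)%N || (x <= slotcol s)%N.
Definition topseq (p : 'S_(n + n)) := fseq (fun j => slotcol (p (lshift n j))).
Definition botseq (p : 'S_(n + n)) := fseq (fun j => slotcol (p (rshift n j))).
Definition okperm (p : 'S_(n + n)) :=
  [forall j, okT (p (lshift n j))] && [forall j, okB (p (rshift n j))].

(** A shuffle sum taken over all admissible permutations instead of coset representatives. Each
    shuffle is repeated equally often, which is harmless in characteristic 0, and the sum has the
    form of a Laplace expansion. *)
Definition exch (V : pzRingType) (P Q : nsubset n -> V) : V :=
  \sum_(p : 'S_(n + n) | okperm p) (-1) ^+ p * (altext P (topseq p) * altext Q (botseq p)).

Lemma slotcol_lshift r : slotcol (lshift n r) = sel al r.
Proof. by rewrite /slotcol; case: splitP => [j /= /val_inj->//|k /= e]; have := ltn_ord r; rewrite e; lia. Qed.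

Lemma slotcol_rshift r : slotcol (rshift n r) = sel be r.
Proof.
rewrite /slotcol; case: splitP => [j /= e|k /= /addnI/val_inj->//].
by have := ltn_ord j; rewrite -e; lia.
Qed.

Definition below (A : {set 'I_(n + n)}) (y : nat) := #|[set z in A | (z < y)%N]|.

(** The exchanged slots are the labels of al from x on and those of be below x. Their excess over n
    is the order of vanishing in [dvdp_exch]. *)
Lemma card_exchanged : (#|[set s | okT s && okB s]| + below (val al) x = n + below (val be) x)%N.
Proof.
rewrite -sum1_card big_mkcond /= big_split_ord /=.
under eq_bigr => r _ do rewrite inE /okT /okB slotcol_lshift /= ltn_ord /= leqNgt ltn_ord /=.
under [X in (_ + X + _)%N]eq_bigr => r _
  do rewrite inE /okT /okB slotcol_rshift /= ltnNge leq_addr /= andbT.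
rewrite (sum_sel (fun y => if (x <= y)%N then 1 else 0)%N).
rewrite (sum_sel (fun y => if (y < x)%N then 1 else 0)%N).
have blw (A : {set 'I_(n + n)}) : (\sum_(y in A) (if (y < x)%N then 1 else 0) = below A x)%N.
  by rewrite -big_mkcondr /= sum1dep_card.
rewrite addnAC -blw -big_split /= blw; congr (_ + _)%N.
rewrite (eq_bigr (fun=> 1%N)) ?sum1_card ?(eqP (valP al)) // => y _.
by case: ltnP.
Qed.

Lemma dvdp_exch (K : fieldType) (M N : 'M[{poly K}]_(n, n + n)) (z : {poly K}) k :
  (forall i j, z %| N i j - M i j) -> (k + below (val al) x <= below (val be) x)%N ->
  z ^+ k %| exch (minor M) (minor N).
Proof.
move=> hz hk.
(* Putting zero columns at the forbidden slots kills the permutations that are not admissible, so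
   the restricted sum becomes a full Laplace sum. *)
pose T := \matrix_(i, s) (if okT s then M i (slotcol s) else 0).
pose B := \matrix_(i, s) (if okB s then N i (slotcol s) else 0).
have hc : (n + k <= #|[set s | okT s && okB s]|)%N by have := card_exchanged; lia.
have hd i s : s \in [set s | okT s && okB s] -> z %| B i s - T i s.
  by rewrite inE !mxE => /andP[-> ->].
rewrite (_ : exch _ _ = \sum_(p : 'S_(n + n)) (-1) ^+ p * (\det (colsub (fun j => p (lshift n j)) T)
   * \det (colsub (fun j => p (rshift n j)) B))); first exact: dvdp_laplace_sum hc hd.
rewrite /exch big_mkcond /=; apply: eq_bigr => p _; case: ifPn => [/andP[/forallP hT /forallP hB]|].
  rewrite !altext_minor ?size_fseq // !cdet_fseq; congr (_ * (_ * _)).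
    by congr (\det _); apply/matrixP => i j; rewrite !mxE hT.
  by congr (\det _); apply/matrixP => i j; rewrite !mxE hB.
have det0 (A : 'M[{poly K}]_n) j : (forall i, A i j = 0) -> \det A = 0.
  by move=> h; rewrite (expand_det_col _ j) big1 // => i _; rewrite h mul0r.
rewrite negb_and => /orP[] /forallPn[j /negPf hj].
  by rewrite [\det (colsub _ T)](det0 _ j) ?mul0r ?mulr0 // => i; rewrite !mxE hj.
by rewrite [\det (colsub _ B)](det0 _ j) ?mulr0 // => i; rewrite !mxE hj.
Qed.

Lemma exchZ (V : comPzRingType) (a b : V) P Q :
  exch (fun g => a * P g) (fun g => b * Q g) = a * b * exch P Q.
Proof.
rewrite /exch big_distrr /=; apply: eq_bigr => p _; rewrite !altextZ.
by rewrite mulrACA [RHS]mulrCA.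
Qed.

Lemma exch_morph (V W : pzRingType) (f : {rmorphism V -> W}) P Q :
  f (exch P Q) = exch (fun g => f (P g)) (fun g => f (Q g)).
Proof.
rewrite /exch rmorph_sum; apply: eq_bigr => p _.
by rewrite !rmorphM rmorph_sign !altext_morph.
Qed.

Lemma eq_exch (V : pzRingType) (P P' Q Q' : nsubset n -> V) :
  P =1 P' -> Q =1 Q' -> exch P Q = exch P' Q'.
Proof.
by move=> e e'; apply: eq_bigr => p _; rewrite (eq_altext _ e) (eq_altext _ e').
Qed.

(* Near z = 1, where some Pluecker coordinate is nonzero, the family has a
   polynomial frame, and frames at z and at 1 agree modulo z - 1. *)
Lemma dvdp_exch_family (K : numFieldType) (P : nsubset n -> {poly K}) k :
  (forall z, exists A : 'M[K]_(n, n + n), forall g, (P g).[z] = minor A g) ->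
  (exists g, (P g).[1] != 0) ->
  (k + below (val al) x <= below (val be) x)%N ->
  ('X - 1%:P) ^+ k %| exch P (fun g => (P g).[1]%:P).
Proof.
move=> hP [g0 hg0] hk.
pose Y := chartmx P g0; pose Y1 : 'M[{poly K}]_(n, n + n) := map_mx (fun q => q.[1]%:P) Y.
have hY s : size s = n -> P g0 * cdet Y s = P g0 ^+ n * altext P s.
  exact: cdet_chartmx_poly hP.
have hY1 s : size s = n -> (P g0).[1]%:P * cdet Y1 s =
    (P g0).[1]%:P ^+ n * altext (fun g => (P g).[1]%:P) s.
  move=> hs; pose f : {rmorphism {poly K} -> {poly K}} := polyC \o horner_eval 1.
  have -> : Y1 = map_mx f Y by [].
  rewrite map_cdet -[(P g0).[1]%:P]/(f (P g0)) -rmorphM hY // rmorphM rmorphXn.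
  by rewrite altext_morph.
have dY : ('X - 1%:P) ^+ k %| exch (minor Y) (minor Y1).
  apply: dvdp_exch => // i j; rewrite mxE -dvdpNr opprB dvdp_XsubCl.
  by rewrite rootE hornerD hornerN hornerC subrr.
have e : (P g0 ^+ n * (P g0).[1]%:P ^+ n) * exch P (fun g => (P g).[1]%:P)
   = (P g0 * (P g0).[1]%:P) * exch (minor Y) (minor Y1).
  rewrite /exch !big_distrr /=; apply: eq_bigr => p _.
  rewrite !altext_minor ?size_fseq // [RHS]mulrCA [LHS]mulrCA.
  by congr (_ * _); rewrite mulrACA [RHS]mulrACA hY ?hY1 ?size_fseq.
have : ('X - 1%:P) ^+ k %| (P g0 ^+ n * (P g0).[1]%:P ^+ n) * exch P (fun g => (P g).[1]%:P).
  by rewrite e dvdp_mull.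
(* [P g0] does not vanish at 1, so its powers are coprime to ['X - 1%:P] and cancel. *)
rewrite Gauss_dvdpr // coprimep_expl // coprimep_sym coprimep_XsubC rootE hornerM !horner_exp hornerC.
by rewrite mulf_neq0 ?expf_neq0.
Qed.

End Exchange.

(** * From divisibility to relations among coefficients *)

Section DiffVanish.
Variable K : fieldType.
Implicit Types (h : nat -> K).

(** The k-th finite difference of h is zero; in characteristic 0 these are the polynomial functions
    of degree below k. *)
Fixpoint diff_vanish k h : Prop :=
  if k is k'.+1 then diff_vanish k' (fun i => h i.+1 - h i) else forall i, h i = 0.

Lemma eq_diff_vanish k h h' : h =1 h' -> diff_vanish k h -> diff_vanish k h'.
Proof.
elim: k h h' => [|k IH] h h' e /=; first by move=> h0 i; rewrite -e.
by apply: IH => i; rewrite !e.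
Qed.

Lemma diff_vanishD k h h' : diff_vanish k h -> diff_vanish k h' ->
  diff_vanish k (fun i => h i + h' i).
Proof.
elim: k h h' => [|k IH] h h' /=; first by move=> h0 h0' i; rewrite h0 h0' addr0.
by move=> /IH{}IH /IH; apply: eq_diff_vanish => i; rewrite opprD addrACA.
Qed.

Lemma diff_vanish_shift k h : diff_vanish k h -> diff_vanish k (fun i => h i.+1).
Proof. by elim: k h => [|k IH] h /=; [move=> h0 i | exact: IH]. Qed.

(** Leibniz rule: the difference of (i - c) h(i) is (i - c) times the difference of h, plus h(i +
    1). *)
Lemma diff_vanish_mul k h c : diff_vanish k h ->
  diff_vanish k.+1 (fun i => (i%:R - c) * h i).
Proof.
elim: k h => [|k IH] h hk.
  by move=> i; rewrite !hk !mulr0 subrr.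
have := diff_vanishD (IH _ hk) (diff_vanish_shift hk).
apply: eq_diff_vanish => i; rewrite -natr1; ring.
Qed.

(** Summation by parts: pairing coefficients with h, multiplication by ['X - 1%:P] is adjoint to
    taking a difference of h. *)
Lemma diff_vanish_functional k h (F : {poly K}) N : diff_vanish k h ->
  ('X - 1%:P) ^+ k %| F -> (size F <= N)%N -> \sum_(i < N) h i * F`_i = 0.
Proof.
elim: k h F N => [|k IH] h F N hk; first by rewrite big1 // => i _; rewrite hk mul0r.
rewrite exprSr => /dvdpP[G0]; rewrite mulrA; set G := G0 * _ => -> hN.
have [->|G_nz] := eqVneq G 0.
  by rewrite mul0r big1 // => i _; rewrite coef0 mulr0.
case: N hN => [|N]; first by rewrite leqn0 size_poly_eq0 mulf_eq0 polyXsubC_eq0 (negPf G_nz).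
rewrite size_Mmonic ?monicXsubC // size_XsubC addnC /= add1n ltnS => hN.
have e := IH _ G N hk (dvdp_mull _ (dvdpp _)) hN.
have {}e : \sum_(i < N) h i.+1 * G`_i - \sum_(i < N) h i * G`_i = 0.
  by rewrite -sumrB -[RHS]e; apply: eq_bigr => i _; rewrite mulrBl.
have G0N : G`_N = 0 by rewrite nth_default.
transitivity (\sum_(i < N.+1) (h i * (if val i == 0%N then 0 else G`_i.-1) - h i * G`_i)).
  apply: eq_bigr => i _; rewrite mulrBr coefB coefMC mulr1 -mulrBr; congr (_ * (_ - _)).
  by rewrite coefMX.
rewrite sumrB big_ord_recl /= mulr0 add0r [X in _ - X]big_ord_recr /= G0N mulr0 addr0.
exact: e.
Qed.

End DiffVanish.

Lemma coef_signM (S : nzRingType) k (p : {poly S}) i : ((-1) ^+ k * p)`_i = (-1) ^+ k * p`_i.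
Proof.
rewrite -signr_odd -[in RHS]signr_odd.
by case: odd; rewrite ?expr1 ?expr0 ?mulN1r ?mul1r ?coefN.
Qed.

Section ExchangeRelation.
Variables (R : realType) (n d : nat).
Local Notation K := (Cplx R).
Implicit Types (c : pidx n d -> K) (al be : nsubset n).

Lemma altext_sum (V : pzRingType) (I : Type) (r : seq I) (P : I -> nsubset n -> V) s :
  altext (fun g => \sum_(i <- r) P i g) s = \sum_(i <- r) altext (P i) s.
Proof.
rewrite /altext; case: ifP => _; last by rewrite big1.
by case: insubP => [al _ _|_]; [rewrite mulr_sumr | rewrite big1].
Qed.

Lemma coef_altext (P : nsubset n -> {poly K}) s i :
  (altext P s)`_i = altext (fun g => (P g)`_i) s.
Proof.
rewrite /altext; case: ifP => _; last by rewrite coef0.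
by case: insubP => [al _ _|_]; rewrite ?coef0 // coef_signM.
Qed.

Lemma exch_sumr (V : pzRingType) al be x (I : Type) (r : seq I) P (Q : I -> nsubset n -> V) :
  exch al be x P (fun g => \sum_(i <- r) Q i g) = \sum_(i <- r) exch al be x P (Q i).
Proof.
rewrite /exch exchange_big /=; apply: eq_bigr => p _.
by rewrite altext_sum !big_distrr.
Qed.

Lemma coef_exch_polyC al be x (P : nsubset n -> {poly K}) (Q : nsubset n -> K) i :
  (exch al be x P (fun g => (Q g)%:P))`_i = exch al be x (fun g => (P g)`_i) Q.
Proof.
rewrite /exch coef_sum; apply: eq_bigr => p _.
by rewrite -(altext_morph polyC) coef_signM coefMC coef_altext.
Qed.

Definition exch_rel (al be : nsubset n) (x e : nat) (h : nat -> K) : polyring R n d :=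
  \sum_(a < d.+1) \sum_(b < d.+1 | (a + b == e)%N)
    h a *: exch al be x (fun g => pvar R (g, a)) (fun g => pvar R (g, b)).

(** The first factor is taken at the point z u, the second at u. Vanishing to order k at z = 1 gives
    a relation weighted by h among the coefficients in z, valid for every u; the coefficients in u
    then separate the total levels e. *)
Lemma sum_exch_GrMap c al be x e k h : GrMap c ->
  (k + below (val al) x <= below (val be) x)%N -> diff_vanish k h ->
  \sum_(a < d.+1) \sum_(b < d.+1 | (a + b == e)%N)
    h a * exch al be x (fun g => c (g, a)) (fun g => c (g, b)) = 0.
Proof.
move=> [nzc hc] hk hh.
pose E (a b : 'I_d.+1) := exch al be x (fun g => c (g, a)) (fun g => c (g, b)).
suff hu u : \sum_(a < d.+1) \sum_(b < d.+1) h a * E a b * u ^+ (a + b) = 0.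
  have : \sum_(a < d.+1) \sum_(b < d.+1) (h a * E a b) *: 'X^(a + b) = 0.
    apply: poly_ext => u; rewrite horner0 -[RHS](hu u) horner_sum; apply: eq_bigr => a _.
    by rewrite horner_sum; apply: eq_bigr => b _; rewrite hornerZ hornerXn.
  move/(congr1 (fun q : {poly K} => q`_e)); rewrite coef0 coef_sum => he.
  rewrite -[RHS]he; apply: eq_bigr => a _; rewrite coef_sum big_mkcond /=.
  apply: eq_bigr => b _; rewrite coefZ coefXn eq_sym.
  by case: eqP; rewrite ?mulr1 ?mulr0.
pose P g : {poly K} := \poly_(a < d.+1) (c (g, inord a) * u ^+ a).
have PE g z : (P g).[z] = Defs.form c g (z * u) 1.
  rewrite /P horner_poly /Defs.form; apply: eq_bigr => a _.
  by rewrite inord_val expr1n mulr1 exprMn -mulrA [u ^+ _ * _]mulrC.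
have uc z : (z * u, 1) != (0, 0) :> K * K by rewrite xpair_eqE oner_eq0 andbF.
have hd : ('X - 1%:P) ^+ k %| exch al be x P (fun g => (P g).[1]%:P).
  apply: dvdp_exch_family => // [z|].
    by have [A hA] := hc _ _ (uc z); exists A => g; rewrite PE hA.
  by have [g hg] := nzc _ _ (uc 1); exists g; rewrite PE.
have sz : (size (exch al be x P (fun g => (P g).[1]%:P)) <= d.+1)%N.
  apply/leq_sizeP => i hi; rewrite coef_exch_polyC.
  (* The product [0 * 0] puts the vanishing function in the form that [altextZ] expects. *)
  rewrite (eq_exch _ _ _ (P' := fun g => 0 * 0) (Q' := fun g => 0 * 0 + (P g).[1])) //.
    by rewrite /exch big1 // => p _; rewrite altextZ mul0r mul0r mulr0.
  - by move=> g; rewrite coef_poly ltnNge hi mul0r.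
  - by move=> g; rewrite mul0r add0r.
rewrite -[RHS](diff_vanish_functional hh hd sz); apply: eq_bigr => a _.
rewrite coef_exch_polyC.
have -> : exch al be x (fun g => (P g)`_a) (fun g => (P g).[1])
   = exch al be x (fun g => u ^+ a * c (g, a)) (fun g => \sum_(b < d.+1) u ^+ b * c (g, b)).
  apply: eq_exch => g; first by rewrite coef_poly ltn_ord inord_val mulrC.
  rewrite horner_poly; apply: eq_bigr => b _.
  by rewrite expr1n mulr1 inord_val mulrC.
rewrite exch_sumr big_distrr /=; apply: eq_bigr => b _.
by rewrite exchZ -mulrA exprD [_ * E a b]mulrC.
Qed.

Lemma exch_rel_Idn al be x e k h :
  (k + below (val al) x <= below (val be) x)%N -> diff_vanish k h ->
  Idn (exch_rel al be x e h).
Proof.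
move=> hk hh c hc l; rewrite /evalp /exch_rel rmorph_sum.
pose v := (fun k0 : 'I_(nvar n d) => l * c (enum_val k0)).
have hv g (a : 'I_d.+1) : (pvar R (g, a)).@[v] = l * c (g, a).
  by rewrite /pvar mevalXU /v enum_rankK.
transitivity (l * l * \sum_(a < d.+1) \sum_(b < d.+1 | (a + b == e)%N)
    h a * exch al be x (fun g => c (g, a)) (fun g => c (g, b))); last first.
  by rewrite (sum_exch_GrMap _ hc hk hh) mulr0.
rewrite big_distrr /=; apply: eq_bigr => a _; rewrite rmorph_sum big_distrr.
apply: eq_bigr => b _; rewrite /= mevalZ (exch_morph _ _ _ (meval v)).
have -> : exch al be x (fun g => (pvar R (g, a)).@[v]) (fun g => (pvar R (g, b)).@[v])
    = exch al be x (fun g => l * c (g, a)) (fun g => l * c (g, b)).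
  by apply: eq_exch => g; exact: hv.
by rewrite exchZ mulrCA.
Qed.

End ExchangeRelation.

(** * Straightening modulo I + L *)

Section IdealIL.
Variables (R : realType) (n d : nat).
Implicit Types (f g h : polyring R n d).

Lemma Idn0 : Idn (0 : polyring R n d).
Proof. by move=> c _ l; rewrite /evalp raddf0. Qed.

Lemma IdnD f g : Idn f -> Idn g -> Idn (f + g).
Proof.
move=> hf hg c hc l; move: (hf c hc l) (hg c hc l).
by rewrite /evalp mevalD => -> ->; rewrite addr0.
Qed.

Lemma IdnM h f : Idn f -> Idn (h * f).
Proof.
by move=> hf c hc l; move: (hf c hc l); rewrite /evalp mevalM => ->; rewrite mulr0.
Qed.

Lemma in_I_plus_L_Idn f : Idn f -> in_I_plus_L f.
Proof.
move=> hf; exists f; split=> //; exists (fun=> 0).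
by rewrite big1 ?addr0 // => x _; rewrite mul0r.
Qed.

Lemma in_I_plus_L0 : in_I_plus_L (0 : polyring R n d).
Proof. exact/in_I_plus_L_Idn/Idn0. Qed.

Lemma in_I_plus_LD f g : in_I_plus_L f -> in_I_plus_L g -> in_I_plus_L (f + g).
Proof.
move=> [f' [hf' [q ->]]] [g' [hg' [r ->]]]; exists (f' + g'); split; first exact: IdnD.
exists (fun x => q x + r x); rewrite addrACA -big_split; congr (_ + _).
by apply: eq_bigr => x _; rewrite mulrDl.
Qed.

Lemma in_I_plus_LM h f : in_I_plus_L f -> in_I_plus_L (h * f).
Proof.
move=> [f' [hf' [q ->]]]; exists (h * f'); split; first exact: IdnM.
exists (fun x => h * q x); rewrite mulrDr big_distrr; congr (_ + _).
by apply: eq_bigr => x _; rewrite /= mulrA.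
Qed.

Lemma in_I_plus_LZ c f : in_I_plus_L f -> in_I_plus_L (c *: f).
Proof. by rewrite -mul_mpolyC; exact: in_I_plus_LM. Qed.

Lemma in_I_plus_L_Lgen a (be : {set 'I_(n + n)}) : (#|be| + 2 == n)%N ->
  in_I_plus_L (Lgen R a be : polyring R n d).
Proof.
move=> hbe; exists 0; split; first exact: Idn0.
exists (fun y => (y == (a, be))%:R); rewrite add0r (bigD1 (a, be)) //= eqxx mul1r.
by rewrite big1 ?addr0 // => y /andP[_ /negPf->]; rewrite mul0r.
Qed.

End IdealIL.

Section ExchangeTerms.
Variables (n : nat) (al be : nsubset n) (x : nat).

Lemma uniq_fseq (T : eqType) (g : 'I_n -> T) : uniq (fseq g) = injectiveb g.
Proof. by []. Qed.

Lemma sel_inj (ga : nsubset n) : injective (sel ga).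
Proof. by apply/injectiveP; rewrite -uniq_fseq fseq_sel enum_uniq. Qed.

Lemma mem_sel (ga : nsubset n) r : sel ga r \in val ga.
Proof.
by rewrite -mem_enum -fseq_sel; apply/mapP; exists r; rewrite ?mem_enum.
Qed.

Definition rank (ga : nsubset n) : nat := (\sum_(y in val ga) y)%N.

Lemma altextP (V : pzRingType) (P : nsubset n -> V) s :
  altext P s = 0 \/ exists ga : nsubset n,
    [/\ val ga = [set y in s], altext P s = (-1) ^+ inversions s * P ga
      & rank ga = (\sum_(y <- s) y)%N].
Proof.
rewrite /altext; case: ifPn => us; last by left.
case: insubP => [ga _ e|_]; last by left.
right; exists ga; split=> //; rewrite /rank e [RHS](big_uniq _ us) /=.
by apply: eq_bigl => y; rewrite inE.
Qed.

Lemma sum_slotcol : (\sum_s slotcol al be s = rank al + rank be)%N.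
Proof.
rewrite big_split_ord /=; congr (_ + _)%N.
  by rewrite /rank -(sum_sel (fun y => y : nat)); apply: eq_bigr => r _; rewrite slotcol_lshift.
by rewrite /rank -(sum_sel (fun y => y : nat)); apply: eq_bigr => r _; rewrite slotcol_rshift.
Qed.

Definition stab_perm (p : 'S_(n + n)) := [forall j, (p (lshift n j) < n)%N].

(** An admissible permutation mixing the two blocks trades labels of al that are at least x for
    equally many labels of be below x. *)
Lemma sum_topseq_lt (p : 'S_(n + n)) : okperm al be x p -> ~~ stab_perm p ->
  (\sum_(y <- topseq al be p) y < rank al)%N.
Proof.
move=> /andP[/forallP hT /forallP hB] /forallPn[j0 hj0].
pose S := [set p (lshift n j) | j : 'I_n]; pose L := [set lshift n j | j : 'I_n].
have cS : #|S| = n by rewrite card_imset ?card_ord // => i j /perm_inj/lshift_inj.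
have cL : #|L| = n by rewrite card_imset ?card_ord //; exact: lshift_inj.
have inL s : (s \in L) = (s < n)%N.
  apply/imsetP/idP => [[j _ ->]|hs]; first exact: (ltn_ord j).
  by exists (Ordinal hs) => //; apply: val_inj.
have cD : #|S :\: L| = #|L :\: S|.
  by apply: (@addnI #|S :&: L|); rewrite [LHS]cardsID setIC cardsID cL.
have posD : (0 < #|S :\: L|)%N.
  apply/card_gt0P; exists (p (lshift n j0)); rewrite inE inL hj0.
  by apply/imsetP; exists j0.
have SE : (\sum_(y <- topseq al be p) y = \sum_(s in S) slotcol al be s)%N.
  rewrite big_map big_enum /= [RHS]big_imset //=.
  by move=> i j _ _ /perm_inj/lshift_inj.
have LE : (rank al = \sum_(s in L) slotcol al be s)%N.
  rewrite big_imset /=; last by move=> i j _ _ /lshift_inj.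
  by rewrite /rank -(sum_sel (fun y => y : nat)); apply: eq_bigr => r _; rewrite slotcol_lshift.
rewrite SE LE (big_setID L) /= [X in (_ < X)%N](big_setID S) /= setIC ltn_add2l.
have h1 : (\sum_(s in S :\: L) (slotcol al be s).+1 <= #|S :\: L| * x)%N.
  rewrite -sum_nat_const; apply: leq_sum => s; rewrite inE inL => /andP[sL /imsetP[j _ e]].
  by have := hT j; rewrite -e /okT (negPf sL).
have h2 : (#|L :\: S| * x <= \sum_(s in L :\: S) (slotcol al be s))%N.
  rewrite -sum_nat_const; apply: leq_sum => s; rewrite inE inL => /andP[sS sL].
  have [j e|j e] := split_ordP ((p^-1)%g s).
    by case/imsetP: sS; exists j => //; rewrite -e permKV.
  by have := hB j; rewrite -e permKV /okB leqNgt sL.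
move: h1; under eq_bigr do rewrite -addn1.
rewrite big_split /= sum1_card => {}h1; apply: leq_trans h2; rewrite -cD.
by apply: leq_trans h1; rewrite -addn1 leq_add2l.
Qed.

Lemma sum_botseq (p : 'S_(n + n)) :
  (\sum_(y <- topseq al be p) y + \sum_(y <- botseq al be p) y = rank al + rank be)%N.
Proof.
rewrite -sum_slotcol (reindex_inj (@perm_inj _ p)) big_split_ord /=.
by congr (_ + _)%N; rewrite big_map big_enum.
Qed.

Lemma stab_perm_okperm p : stab_perm p -> okperm al be x p.
Proof.
move=> /forallP hp; apply/andP; split; apply/forallP => j; first by rewrite /okT hp.
rewrite /okB; case: leqP => //= hj.
pose q (i : 'I_n) := Ordinal (hp i).
have qinj : injective q.
  by move=> i i' /(congr1 val) /= /val_inj/perm_inj/lshift_inj.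
have [q' _ qK] := injF_bij qinj.
have : p (lshift n (q' (Ordinal hj))) = p (rshift n j).
  by apply: val_inj; have /(congr1 val) := qK (Ordinal hj).
by move/perm_inj/eqP; rewrite eq_lrshift.
Qed.

(** Such a p reorders al and be separately, and the signs of the two reorderings multiply to its
    own. The matrices [E] express those signs as determinants, whose block sum is a permutation
    matrix of p. *)
Lemma exch_term_stab (V : comNzRingType) (P Q : nsubset n -> V) p : stab_perm p ->
  (-1) ^+ p * (altext P (topseq al be p) * altext Q (botseq al be p)) = P al * Q be.
Proof.
move=> sp; have /forallP hp := sp.
have hq : forall j, (n <= p (rshift n j))%N.
  move=> j; case: leqP => //= hj.
  pose q (i : 'I_n) := Ordinal (hp i).
  have qinj : injective q.
    by move=> i i' /(congr1 val) /= /val_inj/perm_inj/lshift_inj.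
  have [q' _ qK] := injF_bij qinj.
  have : p (lshift n (q' (Ordinal hj))) = p (rshift n j).
    by apply: val_inj; have /(congr1 val) := qK (Ordinal hj).
  by move/perm_inj/eqP; rewrite eq_lrshift.
pose E (ga : nsubset n) : 'M[V]_(n, n + n) := \matrix_(i, y) (y == sel ga i)%:R.
have E1 ga : minor (E ga) ga = 1.
  rewrite minor_sel -[RHS](det1 V n); congr (\det _); apply/matrixP => i j.
  by rewrite !mxE (inj_eq (@sel_inj _)) eq_sym.
have altE (F : nsubset n -> V) (ga : nsubset n) (g : 'I_n -> 'I_(n + n)) :
    injective g -> (forall j, g j \in val ga) ->
    altext F (fseq g) = cdet (E ga) (fseq g) * F ga.
  move=> ginj gga; rewrite -altext_minor ?size_fseq // /altext uniq_fseq.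
  have -> : injectiveb g by apply/injectiveP.
  have -> : [set y in fseq g] = val ga.
    apply/eqP; rewrite eqEcard; apply/andP; split.
      by apply/subsetP => y; rewrite inE => /mapP[j _ ->].
    rewrite (eqP (valP ga)) cardsE (card_uniqP _) ?size_fseq // uniq_fseq.
    exact/injectiveP.
  by rewrite valK E1 mulr1.
have ltop j : {i | p (lshift n j) = lshift n i}.
  by exists (Ordinal (hp j)); apply: val_inj.
have lbot j : {i | p (rshift n j) = rshift n i}.
  have := ltn_ord (p (rshift n j)); rewrite -ltn_subLR // => h.
  by exists (Ordinal h); apply: val_inj => /=; rewrite subnKC.
rewrite /topseq /botseq (altE P al) ?(altE Q be); first last.
- by move=> j; have [i ->] := ltop j; rewrite slotcol_lshift mem_sel.
- move=> j j'; have [i e] := ltop j; have [i' e'] := ltop j'.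
  rewrite e e' !slotcol_lshift => /sel_inj ii; apply: (@lshift_inj n n); apply: (@perm_inj _ p).
  by rewrite e e' ii.
- by move=> j; have [i ->] := lbot j; rewrite slotcol_rshift mem_sel.
- move=> j j'; have [i e] := lbot j; have [i' e'] := lbot j'.
  rewrite e e' !slotcol_rshift => /sel_inj ii; apply: (@rshift_inj n n); apply: (@perm_inj _ p).
  by rewrite e e' ii.
set a := cdet _ _; set b := cdet _ _.
suff ab : a * b = (-1) ^+ p.
  by rewrite [X in _ * X]mulrACA ab signrMK.
rewrite -det_perm -det_tr /a /b !cdet_fseq -(det_ublock _ 0); congr (\det _).
apply/matrixP => u v; rewrite [RHS]mxE [in RHS]mxE.
case: (split_ordP u) => i ->; case: (split_ordP v) => j ->.
- rewrite block_mxEul !mxE; have [k ->] := ltop j.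
  by rewrite slotcol_lshift (inj_eq (@sel_inj _)) (inj_eq (@lshift_inj _ _)).
- rewrite block_mxEur !mxE; have [k ->] := lbot j.
  by rewrite eq_rlshift.
- rewrite block_mxEdl !mxE; have [k ->] := ltop j.
  by rewrite eq_lrshift.
- rewrite block_mxEdr !mxE; have [k ->] := lbot j.
  by rewrite slotcol_rshift (inj_eq (@sel_inj _)) (inj_eq (@rshift_inj _ _)).
Qed.

Lemma exchE (V : comNzRingType) (P Q : nsubset n -> V) :
  exch al be x P Q = (P al * Q be) *+ #|stab_perm| +
   \sum_(p : 'S_(n + n) | okperm al be x p && ~~ stab_perm p)
     (-1) ^+ p * (altext P (topseq al be p) * altext Q (botseq al be p)).
Proof.
rewrite /exch (bigID stab_perm) /=; congr (_ + _).
rewrite (eq_bigl stab_perm); last first.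
  by move=> p; apply: andb_idl; exact: stab_perm_okperm.
by rewrite -sumr_const; apply: eq_bigr => p; exact: exch_term_stab.
Qed.

Lemma card_stab_perm : (0 < #|stab_perm|)%N.
Proof. by apply/card_gt0P; exists 1%g; apply/forallP => j; rewrite perm1 /= ltn_ord. Qed.

End ExchangeTerms.

Section Straighten.
Variables (R : realType) (n d : nat).
Hypothesis n_gt0 : (0 < n)%N.
Local Notation K := (Cplx R).
Implicit Types (A B : pidx n d) (al be : nsubset n) (f : polyring R n d).

(* The factor of the level exceeds every rank, so a lower level has smaller
   rho; rho is constant along the relations defining L. *)
Definition rho A : nat := (A.2 * ((n + n) * (n + n)) + rank A.1)%N.

Lemma rank_lt al : (rank al < (n + n) * (n + n))%N.
Proof.
apply: (@leq_ltn_trans (\sum_(y in val al) (n + n))%N).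
  by apply: leq_sum => y _; exact: ltnW.
by rewrite sum_nat_const (eqP (valP al)) ltn_mul2r addn_gt0 n_gt0 /= -[X in (X < _)%N]addn0 ltn_add2l.
Qed.

Lemma rho_level_lt A B : (A.2 < B.2)%N -> (rho A < rho B)%N.
Proof.
rewrite /rho => h; apply: (@leq_trans (A.2.+1 * ((n + n) * (n + n)))%N).
  by rewrite mulSn addnC ltn_add2r rank_lt.
by apply: leq_trans (leq_addr _ _); rewrite leq_mul2r h orbT.
Qed.

Lemma rho_le_level A B : (rho A <= rho B)%N -> (A.2 <= B.2)%N.
Proof. by apply: contraTT; rewrite -!ltnNge => /rho_level_lt. Qed.

Definition spread (r t : nat) f := exists ts : seq (K * (pidx n d * pidx n d)),
  f = \sum_(u <- ts) u.1 *: (pvar R u.2.1 * pvar R u.2.2) /\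
  forall u, u \in ts -> (rho u.2.1 + rho u.2.2 = t)%N /\ (minn (rho u.2.1) (rho u.2.2) < r)%N.

Lemma spread0 r t : spread r t 0.
Proof. by exists [::]; split=> //; rewrite big_nil. Qed.

Lemma spreadD r t f g : spread r t f -> spread r t g -> spread r t (f + g).
Proof.
move=> [ts [-> h]] [us [-> k]]; exists (ts ++ us); split; first by rewrite big_cat.
by move=> u; rewrite mem_cat => /orP[/h|/k].
Qed.

Lemma spreadZ r t c f : spread r t f -> spread r t (c *: f).
Proof.
move=> [ts [-> h]]; exists [seq (c * u.1, u.2) | u <- ts]; split.
  by rewrite big_map scaler_sumr; apply: eq_bigr => u _; rewrite scalerA.
by move=> u /mapP[v /h hv ->].
Qed.

Lemma spread_sum r t (I : Type) (s : seq I) (P : pred I) (F : I -> polyring R n d) :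
  (forall i, P i -> spread r t (F i)) -> spread r t (\sum_(i <- s | P i) F i).
Proof.
by move=> h; apply: (big_ind (spread r t)) => //; [exact: spread0 | exact: spreadD].
Qed.

Lemma spread_pair r t A B : (rho A + rho B = t)%N -> (minn (rho A) (rho B) < r)%N ->
  spread r t (pvar R A * pvar R B).
Proof.
move=> h k; exists [:: (1, (A, B))]; split; first by rewrite big_seq1 scale1r.
by move=> u; rewrite inE => /eqP->.
Qed.

Lemma spread_sign r t k f : spread r t f -> spread r t ((-1) ^+ k * f).
Proof.
rewrite -signr_odd; case: odd; last by rewrite expr0 mul1r.
by rewrite expr1 mulN1r -scaleN1r; exact: spreadZ.
Qed.

(* The polynomial weights h vanish on the levels in (a, b], leaving only the
   level a and levels with a factor of smaller level. *)
Lemma straighten A B x : (A.2 <= B.2)%N ->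
  (B.2 + below (val A.1) x < A.2 + below (val B.1) x)%N ->
  exists2 f, spread (rho A) (rho A + rho B) f & in_I_plus_L (pvar R A * pvar R B - f).
Proof.
case: A B => [al a] [be b] /= ab hx.
pose h (i : nat) : K := \prod_(j <- iota a.+1 (b - a)) (i%:R - j%:R).
have hh : diff_vanish (b - a).+1 h.
  rewrite /h; elim: (b - a)%N (a.+1) => [|m IH] j.
    by move=> i /=; rewrite !big_nil subrr.
  by apply: eq_diff_vanish (diff_vanish_mul j%:R (IH j.+1)) => i; rewrite big_cons.
have ha : h a != 0.
  rewrite /h prodf_seq_neq0; apply/allP => j; rewrite mem_iota /= => hj.
  by rewrite subr_eq0 eqr_nat; lia.
have hz i : (a < i <= b)%N -> h i = 0.
  move=> hi; rewrite /h; apply/eqP; rewrite prodf_seq_eq0; apply/hasP; exists i.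
    by rewrite mem_iota; lia.
  by rewrite subrr eqxx.
(* The strict inequality at x yields b - a + 1 orders of vanishing, one more than the degree of
   h. *)
have rel : in_I_plus_L (exch_rel d al be x (a + b) h).
  by apply/in_I_plus_L_Idn/(exch_rel_Idn _ _ hh); rewrite /=; move: hx ab; lia.
set A := (al, a); set B := (be, b); set t := (rho A + rho B)%N.
suff [g gs e] : exists2 g, spread (rho A) t g &
    exch_rel d al be x (a + b) h =
      (h a * #|stab_perm (n := n)|%:R) *: (pvar R A * pvar R B) + g.
  set c := h a * _ in e.
  have c_nz : c != 0.
    by rewrite mulf_neq0 // pnatr_eq0 -lt0n card_stab_perm.
  exists (- c^-1 *: g); first exact: spreadZ.
  have -> : pvar R A * pvar R B - - c^-1 *: g = c^-1 *: exch_rel d al be x (a + b) h.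
    by rewrite e scalerDr scalerA mulVf // scale1r scaleNr opprK.
  exact: in_I_plus_LZ.
have term (a' b' : 'I_d.+1) p : (a' + b' = a + b)%N ->
   ((a' < a) || (b' < a) || (a' == a) && okperm al be x p && ~~ stab_perm p)%N ->
   spread (rho A) t ((-1) ^+ p * (altext (fun g => pvar R (g, a')) (topseq al be p)
             * altext (fun g => pvar R (g, b')) (botseq al be p))).
  move=> sab ok; apply/spread_sign.
  have srk := sum_botseq al be p.
  set s1 := (\sum_(y <- topseq _ _ _) _)%N in srk; set s2 := (\sum_(y <- botseq _ _ _) _)%N in srk.
  set N := ((n + n) * (n + n))%N.
  have tot : (a' * N + s1 + (b' * N + s2) = t)%N.
    by rewrite /t /rho /= addnACA -mulnDl sab srk addnACA -mulnDl.
  have [e1|[g1 [_ w1 e1]]] := altextP (fun g => pvar R (g, a')) (topseq al be p).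
    by rewrite e1 mul0r; exact: spread0.
  have [e2|[g2 [_ w2 e2]]] := altextP (fun g => pvar R (g, b')) (botseq al be p).
    by rewrite e2 mulr0; exact: spread0.
  rewrite w1 w2 mulrACA -mulrA; do 2!apply: spread_sign.
  apply: spread_pair; first by rewrite /rho /= e1 e2.
  rewrite gtn_min.
  case/orP: ok => [/orP[h1|h1]|/andP[/andP[/eqP-> okp] nst]].
  - by apply/orP; left; exact: (@rho_level_lt (g1, a') A).
  - by apply/orP; right; exact: (@rho_level_lt (g2, b') A).
  - by rewrite /rho /= ltn_add2l e1 (sum_topseq_lt okp).
pose g0 : polyring R n d := \sum_(p : 'S_(n + n) | okperm al be x p && ~~ stab_perm p)
  (-1) ^+ p * (altext (fun g => pvar R (g, a)) (topseq al be p)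
             * altext (fun g => pvar R (g, b)) (botseq al be p)).
have e0 : exch al be x (fun g => pvar R (g, a)) (fun g => pvar R (g, b)) =
    #|stab_perm (n := n)|%:R *: (pvar R A * pvar R B) + g0.
  by rewrite exchE scaler_nat.
have g0s : spread (rho A) t g0.
  apply: spread_sum => p /andP[okp nst].
  by apply: term => //; rewrite eqxx okp nst orbT.
clearbody g0.
pose X (a' b' : 'I_d.+1) : polyring R n d :=
  exch al be x (fun g => pvar R (g, a')) (fun g => pvar R (g, b')).
have Xs (a' b' : 'I_d.+1) : a' != a -> (a' + b' == a + b)%N -> spread (rho A) t (h a' *: X a' b').
  move=> na /eqP sab; case: (boolP (a < a' <= b)%N) => [/hz->|nab].
    by rewrite scale0r; exact: spread0.
  apply: spreadZ; rewrite /X /exch; apply: spread_sum => p okp; apply: term => //.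
  (* If a' is not below a it exceeds b, and then b' < a because the sum of the levels is fixed. *)
  by move: na sab nab; rewrite -val_eqE /=; lia.
have {}e0 : X a b = #|stab_perm (n := n)|%:R *: (pvar R A * pvar R B) + g0 by exact: e0.
have -> : exch_rel d al be x (a + b) h =
    \sum_(a' < d.+1) \sum_(b' < d.+1 | (a' + b' == a + b)%N) h a' *: X a' b' by [].
clearbody X; rewrite (bigD1 a isT) /=.
rewrite [\sum_(b' < d.+1 | (a + b' == a + b)%N) _](bigD1 b) ?eqxx //=.
rewrite e0 scalerDr scalerA -!addrA.
eexists; last by [].
apply: spreadD; first exact: spreadZ.
apply: spreadD.
  rewrite big_pred0; first exact: spread0.
  by move=> b'; rewrite eqn_add2l -val_eqE; case: eqP.
apply: spread_sum => a' na; apply: spread_sum => b'; exact: Xs.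
Qed.

End Straighten.

(* The relations of the Specht module of shape (m, m), with Garnir-type
   consequences obtained by inclusion-exclusion. *)
Section SubsetRelations.
Variables (K : numFieldType) (V : lmodType K) (I : finType) (U : {set I}) (m : nat).
Variables (phi : {set I} -> V) (Z : V -> Prop).
Hypothesis Z0 : Z 0.
Hypothesis ZD : forall u v, Z u -> Z v -> Z (u + v).
Hypothesis ZZ : forall c u, Z u -> Z (c *: u).
Hypothesis rel : forall S : {set I}, S \subset U -> #|S|.+1 = m ->
  Z (\sum_(i in U :\: S) phi (i |: S)).
Implicit Types S X Y : {set I}.

Let dom X Y S := [&& S \subset U, #|S| == m, X \subset S & [disjoint S & Y]].
Let s X Y := \sum_(S | dom X Y S) phi S.

Lemma Z_sum (J : finType) (P : pred J) (F : J -> V) :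
  (forall i, P i -> Z (F i)) -> Z (\sum_(i | P i) F i).
Proof. by move=> h; apply: (big_ind Z). Qed.

Lemma s_full X : X \subset U -> #|X| = m -> s X set0 = phi X.
Proof.
move=> XU cX; rewrite /s (big_pred1 X) // => S /=; rewrite /dom.
apply/and4P/eqP => [[SU /eqP cS XS _]|->].
  by apply/esym/eqP; rewrite eqEcard XS cX cS leqnn.
by split; rewrite ?cX // disjoint_sym disjoints_subset sub0set.
Qed.

(** Summing over the ways to enlarge X by one element counts each S containing X exactly m - |X|
    times, a number invertible in K; so the claim descends from larger X. *)
Lemma Z_s_superset X : X \subset U -> (#|X| < m)%N -> Z (s X set0).
Proof.
move: {2}(m - #|X|)%N (leqnn (m - #|X|)) => k.
elim: k X => [|k IH] X hk XU hX; first by move: hk hX; lia.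
have e : \sum_(i in U :\: X) s (i |: X) set0 = (m - #|X|)%:R *: s X set0.
  rewrite /s scaler_sumr.
  rewrite (exchange_big_dep (dom X set0)) /=; last first.
    move=> i S _ /and4P[h1 h2 h3 h4]; apply/and4P; split=> //.
    by apply: subset_trans h3; exact: subsetU1.
  apply: eq_bigr => S /and4P[SU /eqP cS XS _].
  rewrite (eq_bigl (mem (S :\: X))); last first.
    move=> i; rewrite !inE /dom SU cS eqxx subUset sub1set XS andbT.
    rewrite disjoint_sym disjoints_subset sub0set andbT.
    by case iS: (i \in S); rewrite ?andbF // (subsetP SU) // ?andbT.
  by rewrite sumr_const cardsD (setIidPr XS) cS scaler_nat.
have nz : (m - #|X|)%:R != 0 :> K by rewrite pnatr_eq0; move: hX; lia.
have -> : s X set0 = (m - #|X|)%:R^-1 *: \sum_(i in U :\: X) s (i |: X) set0.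
  by rewrite e scalerA mulVf // scale1r.
apply: ZZ; have cX i : i \in U :\: X -> #|i |: X| = #|X|.+1.
  by rewrite inE => /andP[iX _]; rewrite cardsU1 iX.
have sX i : i \in U :\: X -> i |: X \subset U.
  by rewrite inE => /andP[_ iU]; rewrite subUset sub1set iU.
case: (eqVneq (#|X|.+1) m) => hm.
  rewrite (eq_bigr (fun i => phi (i |: X))); first exact: rel.
  by move=> i hi; rewrite s_full ?sX // cX.
apply: Z_sum => i hi; apply: IH; rewrite ?sX // cX //; move: hX hk hm; lia.
Qed.

Lemma disjoint_setU1 (T : finType) (A B : {set T}) y :
  [disjoint y |: A & B] = (y \notin B) && [disjoint A & B].
Proof.
by rewrite -setI_eq0 setIUl setU_eq0 !setI_eq0 disjoints1.
Qed.

Lemma s_setU1 X Y y : y \notin X -> s X Y = s X (y |: Y) + s (y |: X) Y.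
Proof.
move=> yX; rewrite /s (bigID (fun S => y \in S)) /= addrC; congr (_ + _).
  apply: eq_bigl => S; rewrite /dom -!andbA; congr [&& _, _, _ & _].
  by rewrite ![[disjoint S & _]]disjoint_sym disjoint_setU1 andbC.
apply: eq_bigl => S; rewrite /dom subUset sub1set.
by case: (y \in S); rewrite /= ?andbF ?andbT.
Qed.

(** Induction on Y: the sets avoiding Y are those avoiding Y minus y, except the ones that contain
    y. When the sizes add up to m, only the term with all of Y moved into X survives, with one sign
    for each element. *)
Lemma subset_exchange X Y : X \subset U -> Y \subset U -> [disjoint X & Y] ->
  ((#|X| + #|Y| < m)%N -> Z (s X Y)) /\
  ((#|X| + #|Y|)%N = m -> Z (s X Y - (-1) ^+ #|Y| *: phi (X :|: Y))).
Proof.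
move: {2}#|Y| (erefl #|Y|) => k; elim: k X Y => [|k IH] X Y cY XU YU dXY.
  move/cards0_eq: (cY) => ->; rewrite cards0 addn0; split=> h.
    exact: Z_s_superset.
  by rewrite s_full // setU0 expr0 scale1r subrr.
have [y yY] : exists y, y \in Y by apply/card_gt0P; rewrite cY.
have YE : Y = y |: (Y :\ y) by rewrite setD1K.
have yX : y \notin X.
  by apply/negP => yX; have := disjointFl dXY yY; rewrite yX.
have cY' : #|Y :\ y| = k by have := cardsD1 y Y; rewrite yY cY; lia.
have YU' : Y :\ y \subset U by apply: subset_trans YU; exact: subsetDl.
have dXY' : [disjoint X & Y :\ y] by apply: disjointWr dXY; exact: subsetDl.
have yXU : y |: X \subset U by rewrite subUset sub1set XU (subsetP YU).
have dyXY : [disjoint y |: X & Y :\ y] by rewrite disjoint_setU1 dXY' !inE eqxx.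
have cyX : #|y |: X| = #|X|.+1 by rewrite cardsU1 yX.
have sE : s X Y = s X (Y :\ y) - s (y |: X) (Y :\ y).
  by rewrite (s_setU1 (Y :\ y) yX) -YE addrK.
have ZN u : Z u -> Z (- u) by rewrite -scaleN1r; exact: ZZ.
have [IH1 IH2] := IH X (Y :\ y) cY' XU YU' dXY'.
have [IH3 IH4] := IH (y |: X) (Y :\ y) cY' yXU YU' dyXY.
rewrite cY' in IH1 IH2 IH3 IH4; rewrite cyX in IH3 IH4; split=> h.
  by rewrite sE; apply: ZD; [apply: IH1|apply/ZN/IH3]; move: h; rewrite cY; lia.
rewrite cY in h; rewrite sE -addrA; apply: ZD; first by apply: IH1; move: h; lia.
have -> : - s (y |: X) (Y :\ y) - (-1) ^+ #|Y| *: phi (X :|: Y)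
  = - (s (y |: X) (Y :\ y) - (-1) ^+ k *: phi (y |: X :|: Y :\ y)).
  rewrite opprB addrC; congr (_ - _).
  by rewrite cY exprS mulN1r scaleNr opprK -setUA setUCA -YE.
by apply/ZN/IH4; move: h; lia.
Qed.

Lemma subset_exchangeE X Y : X \subset U -> Y \subset U -> [disjoint X & Y] ->
  (#|X| + #|Y|)%N = m ->
  Z (phi (X :|: Y) - (-1) ^+ #|Y| *:
       \sum_(S : {set I} | [&& S \subset U, #|S| == m, X \subset S & [disjoint S & Y]]) phi S).
Proof.
move=> XU YU dXY h; have [_ /(_ h)] := subset_exchange XU YU dXY.
move/(ZZ (- (-1) ^+ #|Y|)); rewrite scalerBr scalerA mulNr -expr2 sqrr_sign.
by rewrite scaleN1r opprK addrC scaleNr.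
Qed.

End SubsetRelations.

(** * Weight classes of coordinates and Dyck reduction modulo L *)

Section Pairing.
Variable n : nat.
Implicit Types (y : 'I_(n + n)) (i j : 'I_n) (A T : {set 'I_(n + n)}) (S : {set 'I_n}).

Definition idx y : 'I_n := match split y with inl r => rev_ord r | inr r => r end.

Lemma idx_barI i : idx (barI i) = i.
Proof.
rewrite /idx /barI; case: splitP => [j /= e|k /= e].
  by rewrite (_ : j = rev_ord i) ?rev_ordK //; apply: val_inj.
by have := ltn_ord (rev_ord i); rewrite /= e; lia.
Qed.

Lemma idx_posI i : idx (posI i) = i.
Proof.
rewrite /idx /posI; case: splitP => [j /= e|k /= /addnI e]; last exact/esym/val_inj.
by have := ltn_ord j; rewrite -e; lia.
Qed.

Lemma idxP y : y = barI (idx y) \/ y = posI (idx y).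
Proof.
case: (split_ordP y) => j ->; last by right; rewrite (idx_posI j).
by left; rewrite -[j]rev_ordK -/(barI _) idx_barI.
Qed.

Lemma eq_idx y i : (idx y == i) = (y == barI i) || (y == posI i).
Proof.
apply/eqP/orP => [<-|[/eqP->|/eqP->]]; rewrite ?idx_barI ?idx_posI //.
by case: (idxP y) => e; [left|right]; rewrite -e.
Qed.

Lemma sum_idx (V : nmodType) (G : 'I_(n + n) -> V) :
  \sum_y G y = \sum_i (G (barI i) + G (posI i)).
Proof.
rewrite big_split_ord big_split /=; congr (_ + _).
by rewrite (reindex_inj rev_ord_inj).
Qed.

Lemma val_barI i : val (barI i) = (n - i.+1)%N. Proof. by []. Qed.
Lemma val_posI i : val (posI i) = (n + i)%N. Proof. by []. Qed.

Lemma sum_mem_idx (G : 'I_(n + n) -> nat) A :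
  (\sum_(y in A) G y = \sum_i ((barI i \in A) * G (barI i) + (posI i \in A) * G (posI i)))%N.
Proof.
by rewrite big_mkcond sum_idx; apply: eq_bigr => i _; do 2!case: (_ \in A); rewrite ?mul1n.
Qed.

Lemma card_sum_mem S : (#|S| = \sum_i (i \in S))%N.
Proof. by rewrite -sum1_card big_mkcond; apply: eq_bigr => i _; case: (i \in S). Qed.

Lemma card_idx A : (#|A| = \sum_i ((barI i \in A) + (posI i \in A)))%N.
Proof.
by rewrite -sum1_card sum_mem_idx; apply: eq_bigr => i _; rewrite !muln1.
Qed.

Lemma below_idx A x : (below A x =
  \sum_i ((barI i \in A) * (n - i.+1 < x) + (posI i \in A) * (n + i < x)))%N.
Proof. by rewrite /below card_idx; apply: eq_bigr => i _; rewrite !inE !mulnb. Qed.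

Definition pairs S : {set 'I_(n + n)} := [set y | idx y \in S].
(** A torus weight of Sp(2n) is given by the unpaired labels T; the index sets of that weight differ
    by the set S of indices carrying a full pair. *)
Definition cls T S := T :|: pairs S.
Definition free T : {set 'I_n} := [set i | (barI i \notin T) && (posI i \notin T)].

Definition Pset A : {set 'I_n} := [set i | (barI i \in A) && (posI i \in A)].
Definition core A := [set y in A | idx y \notin Pset A].

Lemma free_core A : free (core A) = Pset A :|: free A.
Proof.
apply/setP => i; rewrite !inE !idx_barI !idx_posI.
by do 2!case: (_ \in A).
Qed.

Lemma cls_core A : cls (core A) (Pset A) = A.
Proof.
apply/setP => y; rewrite !inE.
by case: (idxP y) => ->; rewrite ?idx_barI ?idx_posI; do 2!case: (_ \in A).
Qed.

Lemma core_single A i : ~~ ((barI i \in core A) && (posI i \in core A)).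
Proof. by rewrite !inE idx_barI idx_posI; do 2!case: (_ \in A). Qed.

Lemma card_cls T S : S \subset free T -> (#|cls T S| = #|T| + #|S|.*2)%N.
Proof.
move=> /subsetP hS; rewrite !card_idx card_sum_mem -addnn -!big_split /=; apply: eq_bigr => i _; rewrite !inE idx_barI idx_posI.
have := hS i; rewrite inE; case: (i \in S) => [/(_ isT)/andP[/negPf-> /negPf->]|_] //=.
by rewrite !orbF !addn0.
Qed.

Lemma card_free T : (forall i, ~~ ((barI i \in T) && (posI i \in T))) ->
  (#|T| + #|free T| = n)%N.
Proof.
move=> hT; rewrite card_idx card_sum_mem -big_split /=.
rewrite -[RHS]card_ord -sum1_card; apply: eq_bigr => i _; rewrite inE.
by have := hT i; do 2!case: (_ \in T).
Qed.

(** Counting labels gives n = |core| + 2 |Pset| and counting indices gives n = |core| + |Pset| +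
    |free|. So a weight class consists of the m-subsets of a set of size 2m, whence the shape (m,
    m). *)
Lemma card_Pset_free A : #|A| = n -> #|Pset A| = #|free A|.
Proof.
move=> cA; have := card_free (core_single A); rewrite free_core.
have dPf : [disjoint Pset A & free A].
  rewrite -setI_eq0; apply/eqP/setP => i; rewrite !inE.
  by do 2!case: (_ \in A).
have -> : #|Pset A :|: free A| = (#|Pset A| + #|free A|)%N by apply/eqP; rewrite (leq_card_setU _ _).2.
have := @card_cls (core A) (Pset A); rewrite cls_core free_core subsetUl => /(_ isT).
by rewrite cA; lia.
Qed.

Lemma cls_setU1 T S i : cls T S :|: [set barI i; posI i] = cls T (i |: S).
Proof.
apply/setP => y; rewrite !inE eq_idx -!orbA; congr (_ || _).
by rewrite orbC -!orbA.
Qed.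

(** The two labels of a pair are at n - i - 1 and n + i, with sum 2n - 1 whatever i is. *)
Lemma rank_cls (al be : nsubset n) T S S' : S \subset free T -> S' \subset free T ->
  val al = cls T S -> val be = cls T S' -> rank al = rank be.
Proof.
move=> hS hS' e e'.
have cS (ga : nsubset n) S0 : S0 \subset free T -> val ga = cls T S0 -> (#|T| + #|S0|.*2)%N = n.
  by move=> h ee; rewrite -card_cls // -ee (eqP (valP ga)).
have rE (ga : nsubset n) S0 : S0 \subset free T -> val ga = cls T S0 ->
    rank ga = (\sum_(y in T) y + #|S0| * (n + n).-1)%N.
  move=> /subsetP h ee; rewrite /rank ee !sum_mem_idx card_sum_mem big_distrl -big_split; apply: eq_bigr => i _ /=; rewrite !inE idx_barI idx_posI.
  have := h i; rewrite inE; case: (i \in S0) => [/(_ isT)/andP[/negPf-> /negPf->]|_] /=.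
    by have := ltn_ord i; lia.
  by rewrite !orbF !addn0.
rewrite (rE al S) // (rE be S') //; congr (_ + _ * _)%N.
by have := cS al S hS e; have := cS be S' hS' e'; lia.
Qed.

Definition between T i : nat := #|[set y in T | (barI i < y < posI i)%N]|.

Lemma count_enum (A : {set 'I_(n + n)}) (P : pred 'I_(n + n)) :
  count P (enum A) = #|[set y in A | P y]|.
Proof.
rewrite -size_filter cardE; apply/perm_size/uniq_perm; rewrite ?enum_uniq //.
  by rewrite filter_uniq ?enum_uniq.
by move=> y; rewrite mem_filter !mem_enum inE andbC.
Qed.

(** Every other full pair contributes exactly two inversions and a label of T below [barI i] also
    two, so only the labels of T between [barI i] and [posI i] affect the parity. *)
Lemma odd_inversions_pair T S i : S \subset free T -> i \in free T -> i \notin S ->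
  odd (inversions [:: barI i, posI i & enum (cls T S)]) = odd (between T i).
Proof.
move=> /subsetP hS iT iS; rewrite /= inversions_sorted ?sorted_enum_ord //.
rewrite !count_enum -!/(below _ _) ltnNge (_ : (n - i.+1 <= n + i)%N) /=; last by lia.
rewrite add0n addn0; have hi := ltn_ord i.
have belowU x : below (cls T S) x = (below T x + below (pairs S) x)%N.
  rewrite !below_idx -big_split; apply: eq_bigr => j _ /=; rewrite !inE idx_barI idx_posI.
  have := hS j; rewrite inE; case: (j \in S) => [/(_ isT)/andP[/negPf-> /negPf->]|_] //=.
  by rewrite !orbF !addn0.
have hpairs : (below (pairs S) (n - i.+1) + below (pairs S) (n + i) = #|S|.*2)%N.
  rewrite !below_idx -addnn card_sum_mem -!big_split /=; apply: eq_bigr => j _.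
  rewrite !inE idx_barI idx_posI; have hj := ltn_ord j.
  case jS: (j \in S) => //=; have : (nat_of_ord j != i)%N by apply: contraNneq iS => /val_inj<-.
  lia.
have hT : (below T (n + i) = below T (n - i.+1) + between T i)%N.
  rewrite /below /between -cardsUI; move: iT; rewrite inE => /andP[bT pT].
  have -> : [set z in T | (z < n - i.+1)%N] :&: [set y in T | (barI i < y < posI i)%N] = set0.
    by apply/setP => y; rewrite !inE val_barI val_posI; case: (y \in T) => //=; lia.
  rewrite cards0 addn0; congr #|pred_of_set _|; apply/setP => y.
  rewrite !inE val_barI val_posI; case yT: (y \in T) => //=.
  have : (nat_of_ord y != n - i.+1)%N by apply: contraNneq bT => e; rewrite -(_ : y = barI i) //; apply: val_inj.
  lia.
by rewrite !belowU addnACA hpairs hT addnA addnn !oddD !odd_double addbF.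
Qed.

End Pairing.

Section LRelations.
Variables (R : realType) (n d : nat).
Local Notation K := (Cplx R).
Implicit Types (al be : nsubset n) (a : 'I_d.+1) (T : {set 'I_(n + n)}) (S X Y : {set 'I_n}).

(** The sign factors over the elements of S, which turns the generators of L into the unsigned
    relations on subsets. *)
Definition classvar T a S : polyring R n d :=
  (-1 : K) ^+ (\sum_(i in S) between T i)%N *: pvarS R (cls T S) a.

Lemma pvarS_val al a : pvarS R (val al) a = pvar R (al, a).
Proof. by rewrite /pvarS valK. Qed.

Lemma Lgen_classvar T a S : S \subset free T -> (#|T| + (#|S|.+1).*2)%N = n ->
  in_I_plus_L (\sum_(i in free T :\: S) classvar T a (i |: S)).
Proof.
move=> hS cT; pose k := (\sum_(i in S) between T i)%N.
have -> : \sum_(i in free T :\: S) classvar T a (i |: S) = (-1 : K) ^+ k *: Lgen R a (cls T S).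
  rewrite /Lgen scaler_sumr; apply: eq_big => [i|i].
    by rewrite !inE idx_barI idx_posI !negb_or; case: (i \in S); rewrite ?andbF ?andbT.
  rewrite !inE => /andP[iS iT]; rewrite /classvar (big_setU1 _ iS) /= cls_setU1 scalerA.
  congr (_ *: _); rewrite exprD mulrC; congr (_ * _).
  have iF : i \in free T by rewrite inE.
  have ho := odd_inversions_pair hS iF iS.
  by rewrite -[LHS]signr_odd -ho signr_odd.
apply/in_I_plus_LZ/in_I_plus_L_Lgen; rewrite card_cls //; apply/eqP; move: cT; rewrite doubleS; lia.
Qed.

Lemma classvar_exchange T a X Y : X \subset free T -> Y \subset free T -> [disjoint X & Y] ->
  (#|T| + (#|X| + #|Y|).*2)%N = n ->
  in_I_plus_L (classvar T a (X :|: Y) - (-1 : K) ^+ #|Y| *: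
    \sum_(S : {set 'I_n} | [&& S \subset free T, #|S| == (#|X| + #|Y|)%N, X \subset S & [disjoint S & Y]])
       classvar T a S).
Proof.
move=> hX hY dXY hT; apply: (subset_exchangeE (Z := @in_I_plus_L R n d)) => //.
- exact: in_I_plus_L0.
- exact: in_I_plus_LD.
- by move=> c f; exact: in_I_plus_LZ.
- by move=> S hS cS; apply: Lgen_classvar => //; rewrite cS.
Qed.

Lemma card_val al : #|val al| = n. Proof. exact/eqP/(valP al). Qed.

Lemma card_core al : (#|core (val al)| + #|Pset (val al)|.*2 = n)%N.
Proof.
rewrite -card_cls ?cls_core ?card_val // free_core; exact: subsetUl.
Qed.

(* The complement of the barred set: coordinates of the orthogonal subspace. *)
Definition tau al : nsubset n := insubd al (cls (core (val al)) (free (val al))).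

Lemma val_tau al : val (tau al) = cls (core (val al)) (free (val al)).
Proof.
rewrite val_insubd card_cls; last by rewrite free_core subsetUr.
by rewrite -card_Pset_free ?card_val // card_core eqxx.
Qed.

Lemma rank_tau al : rank (tau al) = rank al.
Proof.
apply: (rank_cls _ _ (val_tau al) (esym (cls_core (val al)))); rewrite free_core.
  exact: subsetUr.
exact: subsetUl.
Qed.

Lemma disjoint_Pset_free (A : {set 'I_(n + n)}) : [disjoint Pset A & free A].
Proof.
rewrite -setI_eq0; apply/eqP/setP => i; rewrite !inE.
by do 2!case: (_ \in A).
Qed.

(** The exchange with X empty and Y the set of all full pairs: the only set of the right size
    avoiding Y is the set of empty pairs. *)
Lemma pvar_tau al a : exists k,
  in_I_plus_L (pvar R (al, a) - (-1 : K) ^+ k *: pvar R (tau al, a)).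
Proof.
set T := core (val al); set P := Pset (val al); set F := free (val al).
have fT : free T = P :|: F by exact: free_core.
have PF : #|P| = #|F| by exact: card_Pset_free (card_val al).
have cT : (#|T| + (#|@set0 'I_n| + #|P|).*2 = n)%N by rewrite cards0; exact: card_core.
have := @classvar_exchange T a set0 P.
rewrite sub0set fT subsetUl disjoint_sym disjoints_subset setC0 subsetT.
move=> /(_ isT isT isT cT); rewrite (big_pred1 F); last first.
  move=> S /=; rewrite cards0 add0n sub0set /=; apply/and3P/eqP => [[SU /eqP cS dS]|->].
    apply/eqP; rewrite eqEcard cS PF leqnn andbT.
    apply/subsetP => i iS; have /setUP[iP|//] := subsetP SU _ iS.
    by have := disjointFr dS iS; rewrite iP.
  by rewrite subsetUr PF eqxx disjoint_sym disjoint_Pset_free.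
rewrite set0U /classvar cls_core pvarS_val -val_tau pvarS_val scalerA -exprD.
set i := (\sum_(_ in P) _)%N; set j := (#|P| + _)%N => h; exists (i + j)%N.
have := in_I_plus_LZ ((-1) ^+ i) h.
by rewrite scalerBr !scalerA -expr2 sqrr_sign scale1r -exprD.
Qed.

(** The ballot condition on empty and full pairs read by increasing index. The solutions in a weight
    class are counted by a Catalan number, the dimension of the two-row Specht module. *)
Definition dyck al := [forall k : 'I_n.+1,
  #|[set i in Pset (val al) | (i < k)%N]| <= #|[set i in free (val al) | (i < k)%N]|]%N.

Lemma sum_expn2_lt S k : (k <= n)%N -> (forall i, i \in S -> (i < k)%N) ->
  (\sum_(i in S) 2 ^ i < 2 ^ k)%N.
Proof.
move=> kn hS; apply: (@leq_ltn_trans (\sum_(i < n | (i < k)%N) 2 ^ i)%N).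
  rewrite big_mkcond [X in (_ <= X)%N]big_mkcond; apply: leq_sum => i _.
  by case: ifP => // /hS->.
rewrite (big_ord_narrow kn) /=; elim: (k) => [|m IH]; first by rewrite big_ord0.
by rewrite big_ord_recr /= expnS mul2n -addnn -addSn leq_add2r.
Qed.

Lemma Pset_cls T S : (forall i, ~~ ((barI i \in T) && (posI i \in T))) -> S \subset free T ->
  Pset (cls T S) = S.
Proof.
move=> sT /subsetP hS; apply/setP => i; rewrite !inE idx_barI idx_posI.
case iS: (i \in S); first by rewrite !orbT.
by rewrite !orbF (negPf (sT i)).
Qed.

(* At a prefix {i < k} violating the ballot condition, exchanging the pairs below
   k forces a pair at or above k, which increases the sum of the 2^i. *)
Lemma dyck_reduce al a : exists2 ts : seq (K * nsubset n),
  (forall u, u \in ts -> dyck u.2 /\ rank u.2 = rank al) &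
  in_I_plus_L (pvar R (al, a) - \sum_(u <- ts) u.1 *: pvar R (u.2, a)).
Proof.
pose mu (ga : nsubset n) := (\sum_(i in Pset (val ga)) 2 ^ i)%N.
have mu_lt ga : (mu ga < 2 ^ n)%N by apply: sum_expn2_lt => // i _; exact: ltn_ord.
move: {2}(2 ^ n - mu al)%N (leqnn (2 ^ n - mu al)) => N.
elim: N al => [|N IH] al hN; first by have := mu_lt al; move: hN; lia.
have [dy|] := boolP (dyck al).
  exists [:: (1, al)]; first by move=> u; rewrite inE => /eqP->.
  by rewrite big_seq1 scale1r subrr; exact: in_I_plus_L0.
move=> /forallPn[k]; rewrite -ltnNge => hk.
set T := core (val al); set P := Pset (val al) in hk *; set F := free (val al) in hk.
have fT : free T = P :|: F by exact: free_core.
pose Y := [set i in P | (i < k)%N]; pose X := [set i in P | (k <= i)%N].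
have XYP : X :|: Y = P.
  by apply/setP => i; rewrite !inE -andb_orr; case: (leqP k i); rewrite ?andbT.
have dXY : [disjoint X & Y].
  by rewrite -setI_eq0; apply/eqP/setP => i; rewrite !inE; case: ltnP; rewrite ?andbF.
have XP : X \subset P by rewrite -XYP subsetUl.
have YP : Y \subset P by rewrite -XYP subsetUr.
have cXY : (#|X| + #|Y|)%N = #|P|.
  by apply/esym; rewrite -XYP -cardsUI (disjoint_setI0 dXY) cards0 addn0.
have := @classvar_exchange T a X Y.
rewrite fT cXY XYP dXY (subset_trans XP (subsetUl _ _)) (subset_trans YP (subsetUl _ _)).
move=> /(_ isT isT isT (card_core al)); rewrite {1}/classvar cls_core pvarS_val.
set sg := _ ^+ _; set sy := _ ^+ _ => h.
have {}h : in_I_plus_L (pvar R (al, a) - (sg * sy) *: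
   \sum_(S : {set 'I_n} | [&& S \subset P :|: F, #|S| == #|P|, X \subset S & [disjoint S & Y]])
     classvar T a S).
  have := in_I_plus_LZ sg h; rewrite scalerBr !scalerA -expr2 /sg sqrr_sign scale1r.
  by [].
suff [ts hts e] : exists2 ts : seq (K * nsubset n),
    (forall u, u \in ts -> dyck u.2 /\ rank u.2 = rank al) &
    in_I_plus_L (\sum_(S : {set 'I_n} | [&& S \subset P :|: F, #|S| == #|P|, X \subset S & [disjoint S & Y]])
     classvar T a S - \sum_(u <- ts) u.1 *: pvar R (u.2, a)).
  exists [seq (sg * sy * u.1, u.2) | u <- ts].
    by move=> u /mapP[v /hts hv ->].
  rewrite big_map /=; have := in_I_plus_LD h (in_I_plus_LZ (sg * sy) e).
  rewrite scalerBr addrA subrK [X in in_I_plus_L (_ - X) -> _]scaler_sumr.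
  by rewrite [X in in_I_plus_L (_ - X) -> _](eq_bigr _ (fun u _ => scalerA _ _ _)).
apply: (big_ind (fun f => exists2 ts : seq (K * nsubset n),
    (forall u, u \in ts -> dyck u.2 /\ rank u.2 = rank al) &
    in_I_plus_L (f - \sum_(u <- ts) u.1 *: pvar R (u.2, a)))).
- by exists [::] => //; rewrite big_nil subr0; exact: in_I_plus_L0.
- move=> f g [ts hts e] [us hus e']; exists (ts ++ us).
    by move=> u; rewrite mem_cat => /orP[/hts|/hus].
  by rewrite big_cat /= opprD addrACA; exact: in_I_plus_LD.
move=> S /and4P[SU /eqP cS XS dSY].
have cSn : #|cls T S| == n by rewrite card_cls ?fT // cS card_core.
pose ga : nsubset n := Sub (cls T S) cSn.
have rga : rank ga = rank al.
  apply: (rank_cls (T := T) (S := S) (S' := P)); rewrite ?fT ?subsetUl //.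
  by rewrite cls_core.
have Pga : Pset (val ga) = S.
  by apply: Pset_cls; [exact: core_single | rewrite fT].
have mu_ga : (mu al < mu ga)%N.
  rewrite /mu Pga -/P.
  (* Since S avoids [Y], below k it only has indices of empty pairs, fewer than |Y|; the total sizes
     being equal, S has more than |X| indices from k on. *)
  have SX : (#|X| < #|[set i in S | (k <= i)%N]|)%N.
    have : (#|[set i in S | (k <= i)%N]| + #|[set i in S | (i < k)%N]| = #|S|)%N.
      rewrite -(cardsID [set i : 'I_n | (k <= i)%N] S); congr (_ + _)%N.
        by congr #|pred_of_set _|; apply/setP => i; rewrite !inE.
      by congr #|pred_of_set _|; apply/setP => i; rewrite !inE -ltnNge andbC.
    have : (#|[set i in S | (i < k)%N]| <= #|[set i in F | (i < k)%N]|)%N.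
      apply/subset_leq_card/subsetP => i; rewrite !inE => /andP[iS ik]; rewrite ik andbT.
      have /setUP[iP|] := subsetP SU _ iS; last by rewrite inE.
      by have := disjointFr dSY iS; rewrite inE iP ik.
    by move: hk cXY cS; rewrite -/Y; lia.
  have [j jS jX] : exists2 j, j \in [set i in S | (k <= i)%N] & j \notin X.
    by apply/subsetPn; apply: contraTN SX => /subset_leq_card; rewrite -leqNgt.
  move: jS; rewrite inE => /andP[jS kj].
  (* The single index j, at least k, outweighs all of [Y], whose powers of 2 sum to less than 2 ^
     k. *)
  apply: (@leq_trans (\sum_(i in j |: X) 2 ^ i)%N).
    rewrite (big_setU1 _ jX) /= (big_setID X) /= (setIidPr XP) addnC ltn_add2r.
    have -> : P :\: X = Y.
      by apply/setP => i; rewrite !inE; case: (leqP k i); do 2!case: (_ \in val al).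
    apply: (@leq_trans (2 ^ k)%N); last by rewrite leq_exp2l.
    by apply: sum_expn2_lt => [|i]; [rewrite -ltnS | rewrite inE => /andP[]].
  have jXS : j |: X \subset S by rewrite subUset sub1set jS.
  by rewrite [leqRHS](big_setID (j |: X)) /= (setIidPr jXS) leq_addr.
have [|ts hts e] := IH ga; first by have := mu_lt ga; move: hN mu_ga; lia.
set c : K := (-1) ^+ (\sum_(i in S) between T i)%N.
exists [seq (c * u.1, u.2) | u <- ts].
  by move=> u /mapP[v /hts [h1 h2] ->]; rewrite /= h2 rga.
have -> : classvar T a S = c *: pvar R (ga, a) by rewrite -pvarS_val.
rewrite big_map /=; have := in_I_plus_LZ c e.
rewrite scalerBr [X in in_I_plus_L (_ - X) -> _]scaler_sumr.
by rewrite [X in in_I_plus_L (_ - X) -> _](eq_bigr _ (fun u _ => scalerA _ _ _)).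
Qed.

End LRelations.

Lemma pairwise_witness (T : eqType) (le r : rel T) (s : seq T) :
  pairwise le s -> ~~ pairwise r s ->
  exists x y t, [/\ perm_eq s [:: x, y & t], le x y & ~~ r x y].
Proof.
elim: s => //= x s IH /andP[/allP lx ls]; rewrite negb_and => /orP[/allPn[y ys ry]|/(IH ls)].
  by exists x, y, (rem y s); split=> //; [rewrite perm_cons perm_to_rem | exact: lx].
move=> [u [v [t [p le_uv r_uv]]]]; exists u, v, (x :: t); split=> //.
apply: perm_trans (_ : perm_eq _ (x :: [:: u, v & t])) _; first by rewrite perm_cons.
by rewrite -[x :: _]/([:: x] ++ [:: u; v] ++ t) perm_catCA.
Qed.

(** * Standard monomials span modulo I + L *)

Section Spanning.
Variables (R : realType) (n d : nat).
Hypothesis n_gt0 : (0 < n)%N.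
Local Notation K := (Cplx R).
Implicit Types (A B : pidx n d) (s t : seq (pidx n d)) (f g : polyring R n d).

(** Failure at one x is the inequality required by [straighten]; in terms of depths this is the
    pointwise order. *)
Definition dle A B :=
  [forall x : 'I_(n + n).+1, below (val B.1) x + A.2 <= below (val A.1) x + B.2]%N.

Definition stdrel A B := dle A B && dle (tau A.1, A.2) B.

Definition std s := all (fun A => dyck A.1) s && pairwise stdrel s.

Definition pmonom s : polyring R n d := \prod_(A <- s) pvar R A.

Definition comb (C : seq (pidx n d) -> Prop) f :=
  exists2 ts : seq (K * seq (pidx n d)), (forall u, u \in ts -> C u.2) &
    in_I_plus_L (f - \sum_(u <- ts) u.1 *: pmonom u.2).

Lemma combD C f g : comb C f -> comb C g -> comb C (f + g).
Proof.
move=> [ts hts e] [us hus e']; exists (ts ++ us).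
  by move=> u; rewrite mem_cat => /orP[/hts|/hus].
by rewrite big_cat /= opprD addrACA; exact: in_I_plus_LD.
Qed.

Lemma combZ C c f : comb C f -> comb C (c *: f).
Proof.
move=> [ts hts e]; exists [seq (c * u.1, u.2) | u <- ts].
  by move=> u /mapP[v /hts hv ->].
rewrite big_map /=; have := in_I_plus_LZ c e.
rewrite scalerBr [X in in_I_plus_L (_ - X) -> _]scaler_sumr.
by rewrite [X in in_I_plus_L (_ - X) -> _](eq_bigr _ (fun u _ => scalerA _ _ _)).
Qed.

Lemma comb0 C : comb C 0.
Proof. by exists [::] => //; rewrite big_nil subrr; exact: in_I_plus_L0. Qed.

Lemma comb_sum C (I : eqType) (r : seq I) (F : I -> polyring R n d) :
  (forall i, i \in r -> comb C (F i)) -> comb C (\sum_(i <- r) F i).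
Proof.
by move=> h; rewrite big_seq; apply: (big_ind (comb C)) => //; [exact: comb0 | exact: combD].
Qed.

Lemma comb_congr C f g : in_I_plus_L (f - g) -> comb C g -> comb C f.
Proof.
move=> h [ts hts e]; exists ts => //.
by rewrite -(subrK g f) -addrA; exact: in_I_plus_LD.
Qed.

Lemma comb_pmonom (C : seq (pidx n d) -> Prop) s : C s -> comb C (pmonom s).
Proof.
move=> hs; exists [:: (1, s)]; first by move=> u; rewrite inE => /eqP->.
by rewrite big_seq1 scale1r subrr; exact: in_I_plus_L0.
Qed.

Lemma comb_trans C D f : comb C f -> (forall s, C s -> comb D (pmonom s)) -> comb D f.
Proof.
move=> [ts hts e] h; apply: comb_congr e _; apply: comb_sum => u /hts hu.
exact/combZ/h.
Qed.

Lemma pmonom_cat s t : pmonom (s ++ t) = pmonom s * pmonom t.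
Proof. exact: big_cat. Qed.

Lemma pmonom_cons A s : pmonom (A :: s) = pvar R A * pmonom s.
Proof. exact: big_cons. Qed.

Lemma perm_pmonom s t : perm_eq s t -> pmonom s = pmonom t.
Proof. exact: perm_big. Qed.

(** The list of rho's is retained so that passing to Dyck variables leaves [energy], the measure of
    progress of straightening, unchanged. *)
Lemma comb_dyck s :
  comb (fun t => all (fun A => dyck A.1) t /\ [seq rho A | A <- t] = [seq rho A | A <- s]) (pmonom s).
Proof.
elim: s => [|[al a] s [ts hts e]]; first exact: comb_pmonom.
have [us hus e'] := @dyck_reduce R n d al a.
apply: (comb_congr (g := (\sum_(u <- us) u.1 *: pvar R (u.2, a)) * (\sum_(u <- ts) u.1 *: pmonom u.2))).
  rewrite pmonom_cons; set P := pvar _ _ in e' *; set P' := \sum_(u <- us) _ in e' *.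
  have -> : P * pmonom s - P' * \sum_(u <- ts) u.1 *: pmonom u.2 =
    P * (pmonom s - \sum_(u <- ts) u.1 *: pmonom u.2) + (\sum_(u <- ts) u.1 *: pmonom u.2) * (P - P').
    by rewrite !mulrBr addrA ![_ * P]mulrC subrK [P' * _]mulrC.
  by apply: in_I_plus_LD; exact: in_I_plus_LM.
rewrite big_distrl; apply: comb_sum => u /hus [du ru]; rewrite big_distrr.
apply: comb_sum => v /hts [dv rv] /=.
rewrite -scalerAl -scalerAr scalerA -(pmonom_cons (u.2, a)); apply/combZ/comb_pmonom.
by rewrite /= du dv rv /rho /= ru.
Qed.

Definition energy s := (\sum_(A <- s) rho A ^ 2)%N.

(** A failure for tau A is straightened after replacing A by tau A modulo L, which costs a sign and
    preserves rho. *)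
Lemma stdrelPn A B : ~~ stdrel A B -> (A.2 <= B.2)%N ->
  exists2 f, spread (rho A) (rho A + rho B) f & in_I_plus_L (pvar R A * pvar R B - f).
Proof.
move=> hAB lev; have [k hk] := @pvar_tau R n d A.1 A.2.
have str A' : A'.2 = A.2 -> ~~ dle A' B ->
    exists2 f, spread (rho A') (rho A' + rho B) f & in_I_plus_L (pvar R A' * pvar R B - f).
  move=> lev' /forallPn[x]; rewrite -ltnNge => hx.
  by apply: (@straighten R n d n_gt0 A' B x); [rewrite lev' | move: hx; lia].
move: hAB; rewrite negb_and => /orP[|/str]; first exact: str.
have rA : rho (tau A.1, A.2) = rho A by rewrite /rho rank_tau.
rewrite rA => -[//|f hf e]; exists ((-1 : K) ^+ k *: f); first exact: spreadZ.
have -> : pvar R A * pvar R B - (-1 : K) ^+ k *: f =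
  (-1 : K) ^+ k *: (pvar R (tau A.1, A.2) * pvar R B - f)
   + pvar R B * (pvar R (A.1, A.2) - (-1 : K) ^+ k *: pvar R (tau A.1, A.2)).
  rewrite -surjective_pairing scalerBr mulrBr -scalerAr ![pvar R B * _]mulrC.
  by rewrite [RHS]addrC addrA subrK.
by apply: in_I_plus_LD; [exact: in_I_plus_LZ | exact: in_I_plus_LM].
Qed.

Lemma energy_lt x y x' y' : (x <= y)%N -> (x' + y' = x + y)%N -> (minn x' y' < x)%N ->
  (x ^ 2 + y ^ 2 < x' ^ 2 + y' ^ 2)%N.
Proof.
wlog xy' : x' y' / (x' <= y')%N => [h|].
  case/orP: (leq_total x' y') => /h hh e1 e2 e3; first exact: hh.
  by rewrite [ltnRHS]addnC; apply: hh => //; [rewrite addnC | rewrite minnC].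
move=> xy e; rewrite (minn_idPl xy') => lt.
have [k xE] : exists k, x = (x' + k)%N by exists (x - x')%N; lia.
have [j yE] : exists j, y = (x + j)%N by exists (y - x)%N; lia.
have -> : y' = (y + k)%N by lia.
have : (0 < k)%N by lia.
by subst x y; rewrite -!mulnn; nia.
Qed.

Definition rho_max : nat := ((d.+1 * ((n + n) * (n + n))) ^ 2)%N.

Lemma rho_bound A : (rho A ^ 2 <= rho_max)%N.
Proof.
rewrite leq_exp2r //; apply: (@leq_trans (A.2.+1 * ((n + n) * (n + n)))%N).
  by rewrite /rho mulSn addnC leq_add2r; apply/ltnW/rank_lt.
by rewrite leq_mul2r ltn_ord orbT.
Qed.

Lemma energy_bound s : (energy s <= size s * rho_max)%N.
Proof.
rewrite /energy; elim: s => [|A s IH]; first by rewrite big_nil.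
by rewrite big_cons mulSn; apply: leq_add => //; exact: rho_bound.
Qed.

(* Straightening keeps the sum of the rho's and spreads them apart, so the sum of
   their squares increases. *)
Lemma comb_std_pmonom s : comb (fun t => std t) (pmonom s).
Proof.
have [N] := ubnP (size s * rho_max - energy s); elim: N s => // N IH s.
rewrite ltnS => hN; apply: comb_trans (comb_dyck s) _ => t [dt rt].
have st : size t = size s by rewrite -(size_map (@rho n d)) rt size_map.
have et : energy t = energy s.
  by rewrite /energy -!(big_map (@rho n d) xpredT (fun k => k ^ 2)%N) rt.
(* Sorting by rho also sorts the levels, giving the orientation that [stdrelPn] requires of a
   violating pair. *)
pose u := sort (relpre (@rho n d) leq) t.
have tu : perm_eq t u by rewrite perm_sym perm_sort.
rewrite (perm_pmonom tu); have [h|nst] := boolP (pairwise stdrel u).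
  by apply: comb_pmonom; rewrite /std h andbT -(eq_all_r (perm_mem tu)).
have su : pairwise (relpre (@rho n d) leq) u.
  rewrite -sorted_pairwise; first by apply: sort_sorted => ? ?; exact: leq_total.
  by move=> ? ? ? /=; exact: leq_trans.
have [A [B [v [uv AB nAB]]]] := pairwise_witness su nst.
have [f [ts [fE hts]] e] := stdrelPn nAB (rho_le_level n_gt0 AB).
rewrite (perm_pmonom uv) !pmonom_cons mulrA; apply: (comb_congr (g := f * pmonom v)).
  by rewrite -mulrBl mulrC; exact: in_I_plus_LM.
rewrite fE big_distrl; apply: comb_sum => w /hts [w1 w2] /=.
rewrite -scalerAl -mulrA -!pmonom_cons; apply/combZ/IH.
have lt_en : (energy t < energy [:: w.2.1, w.2.2 & v])%N.
  rewrite /energy (perm_big _ (perm_trans tu uv)) !big_cons /= !addnA ltn_add2r.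
  exact: energy_lt.
have sz : size [:: w.2.1, w.2.2 & v] = size s.
  by rewrite -st (perm_size (perm_trans tu uv)).
have := energy_bound [:: w.2.1, w.2.2 & v]; rewrite sz.
rewrite et in lt_en => hb; apply: leq_trans hN.
by apply: ltn_sub2l => //; exact: leq_trans lt_en hb.
Qed.

Lemma mpoly_pmonom (m : 'X_{1..nvar n d}) : exists s, 'X_[m] = pmonom s.
Proof.
rewrite mpolyXE_id; apply: (big_ind (fun f => exists s, f = pmonom s)).
- by exists [::]; rewrite /pmonom big_nil.
- by move=> _ _ [s ->] [t ->]; exists (s ++ t); rewrite pmonom_cat.
move=> i _; exists (nseq (m i) (enum_val i)); elim: (m i) => [|k IH].
  by rewrite expr0 /pmonom big_nil.
by rewrite exprS IH /= pmonom_cons /pvar enum_valK.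
Qed.

Lemma comb_std f : comb (fun t => std t) f.
Proof.
rewrite (mpolyE f); apply: comb_sum => m _; apply: combZ.
by have [s ->] := mpoly_pmonom m; exact: comb_std_pmonom.
Qed.

End Spanning.

(** * A one-parameter family of maps to the Lagrangian Grassmannian *)

Section ColumnMove.
Variable n : nat.
Hypothesis n_gt0 : (0 < n)%N.
Implicit Types (al : nsubset n) (x y l : 'I_(n + n)).

Definition moveset al l x : nsubset n := insubd al (l |: val al :\ x).

Lemma val_moveset al l x : x \in val al -> l \notin val al -> val (moveset al l x) = l |: val al :\ x.
Proof.
move=> xal lal; rewrite val_insubd ifT // cardsU1 !inE (negPf lal) andbF /=.
by have := cardsD1 x (val al); rewrite xal (eqP (valP al)) => <-.
Qed.

Definition colmove (R : pzRingType) (M : 'M[R]_(n, n + n)) l x (t : R) : 'M[R]_(n, n + n) :=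
  \matrix_(i, j) (M i j + (j == x)%:R * (t * M i l)).

(** Multilinearity in column x; the new summand has a repeated column when l already lies in al. The
    sign stays unspecified because only degrees matter. *)
Lemma minor_colmove (R : comNzRingType) (M : 'M[R]_(n, n + n)) l x t al : l != x ->
  if (x \in val al) && (l \notin val al) then
    exists k, minor (colmove M l x t) al = minor M al + (-1) ^+ k * (t * minor M (moveset al l x))
  else minor (colmove M l x t) al = minor M al.
Proof.
move=> lx; have [xal|xal] /= := boolP (x \in val al); last first.
  rewrite !minor_sel; congr (\det _); apply/matrixP => i j; rewrite !mxE.
  case: eqP => [e|_]; last by rewrite mul0r addr0.
  by rewrite -e mem_sel in xal.
have [r er] : exists r, x = sel al r.
  by move: xal; rewrite -mem_enum -fseq_sel => /mapP[r _ ->]; exists r.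
have e : minor (colmove M l x t) al = minor M al + t * cdet M (repl al r l).
  rewrite !minor_sel -[\det (colsub _ M)]mul1r cdet_fseq -![\det (colsub _ _)]det_tr.
  apply: (determinant_multilinear (i0 := r)).
  - by apply/rowP => i; rewrite !mxE er !eqxx mul1r mul1r.
  - apply/matrixP => u v; rewrite !mxE er (inj_eq (@sel_inj _ _)) eq_sym.
    by rewrite (negPf (neq_lift _ _)) mul0r addr0.
  - apply/matrixP => u v; rewrite !mxE er (inj_eq (@sel_inj _ _)).
    by rewrite ![_ == r]eq_sym (negPf (neq_lift _ _)) mul0r addr0.
have sl : [set y in repl al r l] = l |: val al :\ x.
  apply/setP => y; rewrite !inE; apply/mapP/orP => [[j _ ->]|].
    case: (eqVneq j r) => [_|jr]; [by left | right].
    by apply/andP; split; [rewrite er (inj_eq (@sel_inj _ _)) | exact: mem_sel].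
  move=> [/eqP->|/andP[yx]]; first by exists r; rewrite ?mem_enum // eqxx.
  rewrite -mem_enum -fseq_sel => /mapP[j _ yj]; exists j; rewrite ?mem_enum //.
  by case: eqP => // jr; rewrite yj jr -er eqxx in yx.
have c1 : #|l |: val al :\ x| = ((l \notin val al) + n.-1)%N.
  rewrite cardsU1 !inE lx andTb; congr (_ + _)%N.
  have := cardsD1 x (val al); rewrite xal card_val => e'.
  exact: (esym (congr1 predn e')).
have [lal|lal] /= := boolP (l \in val al).
  rewrite e cdet_dup ?mulr0 ?addr0 ?size_repl //; apply/negP => /card_uniqP.
  by rewrite -cardsE sl c1 lal size_repl; lia.
have us : uniq (repl al r l).
  by apply/card_uniqP; rewrite -cardsE sl c1 lal size_repl; lia.
exists (inversions (repl al r l)); rewrite e -altext_minor ?size_repl // /altext us sl.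
by rewrite -val_moveset // valK mulrCA.
Qed.

End ColumnMove.

Section Depth.
Variable n : nat.
Hypothesis n_gt0 : (0 < n)%N.
Implicit Types (al : nsubset n) (x y l : 'I_(n + n)).

Lemma below_le_card (A : {set 'I_(n + n)}) k : (below A k <= #|A|)%N.
Proof. by apply/subset_leq_card/subsetP => z; rewrite inE => /andP[]. Qed.

Lemma below0 (A : {set 'I_(n + n)}) : below A 0 = 0%N.
Proof. by apply/eqP; rewrite cards_eq0; apply/eqP/setP => z; rewrite !inE ltn0 andbF. Qed.

Lemma below_full (A : {set 'I_(n + n)}) : below A (n + n) = #|A|.
Proof. by congr #|pred_of_set _|; apply/setP => z; rewrite inE ltn_ord andbT. Qed.

Lemma belowS (A : {set 'I_(n + n)}) x : below A x.+1 = (below A x + (x \in A))%N.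
Proof.
rewrite /below (cardsD1 x) !inE ltnSn andbT addnC; congr (_ + _)%N.
congr #|pred_of_set _|; apply/setP => z; rewrite !inE ltnS -val_eqE /=.
by case: (z \in A); rewrite ?andbF //= ltn_neqAle.
Qed.

Lemma below_le (A : {set 'I_(n + n)}) k : (k <= n + n)%N -> (below A k <= k)%N.
Proof.
elim: k => [|k IH] kn; first by rewrite below0.
rewrite -[k]/(val (Ordinal kn)) belowS /= -addn1; apply: leq_add; last exact: leq_b1.
exact/IH/ltnW.
Qed.

Lemma below_ge (A : {set 'I_(n + n)}) k : (k <= n + n)%N -> (#|A| + k <= below A k + (n + n))%N.
Proof.
move=> kn; rewrite -(subKn kn); move: (n + n - k)%N (leq_subr k (n + n)) => j.
elim: j => [|j IH] hj; first by rewrite subn0 below_full.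
have hk : (n + n - j.+1 < n + n)%N by lia.
have := IH (ltnW hj); have e : (n + n - j = (Ordinal hk).+1)%N by rewrite /=; lia.
by rewrite e belowS /=; case: (_ \in A); lia.
Qed.

Lemma below_move al l x (k : nat) : x \in val al -> l \notin val al ->
  (below (val (moveset al l x)) k + (x < k) = below (val al) k + (l < k))%N.
Proof.
move=> xal lal; rewrite val_moveset //.
have e1 : below (l |: val al :\ x) k = (below (val al :\ x) k + (l < k))%N.
  rewrite /below; have [lk|lk] := ltnP l k; last first.
    rewrite addn0; congr #|pred_of_set _|; apply/setP => z; rewrite !inE.
    by case: eqP => [->|] //=; rewrite ltnNge lk !andbF.
  have -> : [set z in l |: val al :\ x | (z < k)%N] = l |: [set z in val al :\ x | (z < k)%N].
    by apply/setP => z; rewrite !inE; case: eqP => [->|].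
  by rewrite cardsU1 !inE (negPf lal) andbF addnC.
have e2 : below (val al) k = (below (val al :\ x) k + (x < k))%N.
  rewrite /below; have [xk|xk] := ltnP x k; last first.
    rewrite addn0; congr #|pred_of_set _|; apply/setP => z; rewrite !inE.
    by case: eqP => [->|] //=; rewrite ltnNge xk !andbF.
  have -> : [set z in val al | (z < k)%N] = x |: [set z in val al :\ x | (z < k)%N].
    by apply/setP => z; rewrite !inE; case: eqP => [->|]; rewrite ?xal.
  by rewrite cardsU1 !inE eqxx addnC.
by rewrite e1 e2 addnAC.
Qed.

(* How far the periodic sequence of (al, a) has moved up at position k from that
   of the smallest coordinate; the truncated subtraction is exact for k <= 2n. *)
Definition dep al (a k : nat) : nat := (minn k n + a - below (val al) k)%N.

Lemma below_le_min al k : (k <= n + n)%N -> (below (val al) k <= minn k n)%N.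
Proof. by move=> kn; rewrite leq_min below_le //= -[leqRHS](card_val al) below_le_card. Qed.

Lemma dep_below al a k : (k <= n + n)%N -> (dep al a k + below (val al) k = minn k n + a)%N.
Proof. by move=> kn; rewrite /dep subnK // (leq_trans (below_le_min _ kn)) // leq_addr. Qed.

(** Labels are read modulo 2n as in an affine root system: a step from label 2n - 1 to label 0
    raises the level by one. *)
Definition prv x : 'I_(n + n) := Ordinal (ltn_pmod (x + (n + n).-1) (leq_trans n_gt0 (leq_addr n n))).

Lemma val_prv x : nat_of_ord (prv x) = if nat_of_ord x == 0%N then (n + n).-1 else x.-1.
Proof.
rewrite /=; case: eqP => [->|x0]; first by rewrite add0n modn_small //; lia.
rewrite (_ : x + (n + n).-1 = x.-1 + (n + n))%N; last by lia.
by rewrite modnDr modn_small //; have := ltn_ord x; lia.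
Qed.

Lemma prv_neq x : prv x != x.
Proof.
apply/eqP => /(congr1 (@nat_of_ord _)); rewrite val_prv.
by case: ifP; have := ltn_ord x; lia.
Qed.

Definition movable al (a : nat) x :=
  [&& x \in val al, prv x \notin val al & (nat_of_ord x == 0%N) ==> (0 < a)%N].

Lemma dep_move al a x y : movable al a x ->
  (dep (moveset al (prv x) x) (a - (nat_of_ord x == 0%N)) y + (y == x) = dep al a y)%N.
Proof.
move=> /and3P[xal lal hxa]; have := below_move y xal lal.
have := dep_below (moveset al (prv x) x) (a - (nat_of_ord x == 0%N)) (ltnW (ltn_ord y)).
have := dep_below al a (ltnW (ltn_ord y)); rewrite -[y == x]/(nat_of_ord y == x) val_prv; move: hxa.
have hx := ltn_ord x; have hy := ltn_ord y.
case: (eqVneq (nat_of_ord x) 0%N) => /= x0; first by rewrite x0; move=> a0; lia.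
by rewrite subn0 => _; lia.
Qed.

End Depth.

Section DegreeInvariant.
Variables (K : fieldType) (n : nat).
Hypothesis n_gt0 : (0 < n)%N.
Local Notation L := {poly K}.
Variable w : nat -> nat -> nat.
Implicit Types (al : nsubset n) (x y : 'I_(n + n)) (M : 'M[{poly L}]_(n, n + n)) (D : nat -> nat).

(** The expected degree in T: reaching depth [dep al a y] at y uses the first that many moves at y,
    the j-th with exponent w y j. *)
Definition weight al a : nat := (\sum_(y < n + n) \sum_(j < dep al a y) w y j)%N.

Definition attained D al a := [forall y : 'I_(n + n), dep al a y <= D y]%N.

(** The outer polynomial variable is the loop variable, whose exponent is the level a; the inner one
    is T, so [size] measures the degree in T. *)
Definition degree_inv M D := forall al a,
  if attained D al a then size ((minor M al)`_a) = (weight al a).+1 else (minor M al)`_a = 0.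

Local Notation mv al x := (moveset al (prv n_gt0 x) x).

Lemma weight_move al a x : movable n_gt0 al a x ->
  weight al a = (weight (mv al x) (a - (nat_of_ord x == 0%N))
                 + w x (dep (mv al x) (a - (nat_of_ord x == 0%N)) x))%N.
Proof.
move=> hm; rewrite /weight (bigD1 x) //= [in RHS](bigD1 x) //= addnAC.
have := dep_move x hm; rewrite eqxx addn1 => <-; rewrite big_ord_recr /=; congr (_ + _)%N.
apply: eq_bigr => y yx; have := dep_move y hm.
by rewrite (negPf yx) addn0 => ->.
Qed.

Definition step_coef x (e : nat) (c : K) : {poly L} :=
  (c *: 'X^e : L)%:P * (if nat_of_ord x == 0%N then 'X else 1).

Lemma coef_step_coef x e c (q : {poly L}) a :
  (step_coef x e c * q)`_a =
    if (nat_of_ord x == 0%N) && (a == 0%N) then 0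
    else (c *: 'X^e) * q`_(a - (nat_of_ord x == 0%N)).
Proof.
rewrite /step_coef -mulrA coefCM; case: ifP => _ /=; last by rewrite mul1r subn0.
by rewrite coefXM; case: eqP => _; rewrite ?mulr0 // subn1.
Qed.

Lemma size_scaleXnM e c (q : L) : c != 0 -> q != 0 -> size ((c *: 'X^e) * q) = (size q + e)%N.
Proof.
move=> c0 q0; rewrite -scalerAl size_scale // mulrC size_Mmonic ?monicXn //.
by rewrite size_polyXn addnS.
Qed.

(* A state D stands for the coordinate of depth vector D; it is addable at x when
   its sequence contains the predecessor of x but not x. *)
Definition addable D x := [/\ D (n + n)%N = D 0%N,
  (0 < x)%N -> (minn x.-1 n + 1 + D x = minn x n + D x.-1)%N,
  (minn x.+1 n + D x = minn x n + D x.+1)%N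
  & nat_of_ord x = 0%N -> D ((n + n).-1) = (D 0%N).+1].

(** The depth of (al, a) exceeds D at x only. Comparison with the two neighbouring positions forces
    x into al and its predecessor out of it; at the ends of the period the neighbour is found at the
    other end. *)
Lemma attained_movable D D' al a x : addable D x ->
  D' x = (D x).+1 -> (forall y, y != x -> D' y = D y) ->
  attained D' al a -> ~~ attained D al a ->
  movable n_gt0 al a x /\ dep al a x = (D x).+1.
Proof.
move=> [hD h1 h2 h0] Dx Dy /forallP hA /forallPn[z hz].
have zx : z = x by apply/eqP; apply: contraNT hz => zx; rewrite -Dy.
have hdx : dep al a x = (D x).+1.
  by apply/eqP; rewrite eqn_leq -{1}Dx hA /= ltnNge -zx.
split=> //; have hx := ltn_ord x.
have dx := dep_below al a (ltnW hx); rewrite hdx in dx.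
have depy (k : nat) : (k < n + n)%N -> k != x -> (minn k n + a <= D k + below (val al) k)%N.
  move=> hk kx; rewrite -(dep_below al a (ltnW hk)) leq_add2r.
  rewrite -[k]/(nat_of_ord (Ordinal hk)); rewrite -(Dy (Ordinal hk)); last by rewrite -val_eqE.
  exact: hA.
have xal : x \in val al.
  have bS := belowS (val al) x; apply: contraT => xal; rewrite (negPf xal) addn0 in bS.
  case: (ltnP x.+1 (n + n)) => hx1.
    have xx : x.+1 != x by rewrite neq_ltn ltnSn orbT.
    by have := depy x.+1 hx1 xx; rewrite bS; lia.
  have ex : x.+1 = (n + n)%N by lia.
  rewrite ex below_full card_val in bS; rewrite ex hD in h2.
  have x0 : 0%N != x by rewrite neq_ltn; apply/orP; left; lia.
  by have := depy 0%N (leq_ltn_trans (leq0n _) hx) x0; rewrite below0 min0n; lia.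
apply/and3P; split=> //.
  apply/negP => lal; have bS := belowS (val al) (prv n_gt0 x).
  rewrite lal addn1 val_prv in bS; have [x0|x0] := posnP x.
    rewrite x0 eqxx prednK ?addn_gt0 ?n_gt0 // below_full card_val in bS.
    have xx : (n + n).-1 != x by rewrite x0; lia.
    have hl : ((n + n).-1 < n + n)%N by lia.
    have := depy _ hl xx; rewrite x0 below0 in dx; have := h0 x0.
    by lia.
  rewrite gtn_eqF // prednK // in bS; have xx : x.-1 != x by lia.
  have hl : (x.-1 < n + n)%N by lia.
  by have := depy _ hl xx; have := h1 x0; lia.
by apply/implyP => /eqP x0; move: dx; rewrite x0 below0; lia.
Qed.

(* Coordinates below the old state keep their leading term, since the new
   parameter has smaller degree than the earlier ones used at x; the others
   below the new state get it from the coordinate with x moved back. *)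
Lemma degree_inv_step M D D' x c : degree_inv M D -> addable D x -> c != 0 ->
  D' x = (D x).+1 -> (forall y, y != x -> D' y = D y) ->
  (forall j, (j < D x)%N -> (w x (D x) < w x j)%N) ->
  degree_inv (colmove M (prv n_gt0 x) x (step_coef x (w x (D x)) c)) D'.
Proof.
move=> hM hx c0 Dx Dy hw al a; set e := w x (D x).
have attD : attained D al a -> attained D' al a.
  move=> /forallP h; apply/forallP => y; apply: leq_trans (h y) _.
  by have [->|/Dy->//] := eqVneq y x; rewrite Dx.
have hmin : (movable n_gt0 al a x /\ exists k,
     (minor (colmove M (prv n_gt0 x) x (step_coef x e c)) al)`_a = (minor M al)`_a
      + (-1) ^+ k * ((c *: 'X^e) * (minor M (mv al x))`_(a - (nat_of_ord x == 0%N))))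
   \/ (~~ movable n_gt0 al a x /\
     (minor (colmove M (prv n_gt0 x) x (step_coef x e c)) al)`_a = (minor M al)`_a).
  have := minor_colmove n_gt0 M (step_coef x e c) al (prv_neq n_gt0 x).
  rewrite /movable; case: (boolP (x \in val al)) => xal /=; last first.
    by move=> ->; right.
  case: (boolP (prv n_gt0 x \in val al)) => lal /=; first by move=> ->; right.
  move=> [k ->]; rewrite coefD coef_signM coef_step_coef lt0n.
  case: (boolP (nat_of_ord x == 0%N)) => /= x0; last by left; split=> //; exists k.
  case: (boolP (a == 0%N)) => /= a0; last by left; split=> //; exists k.
  by right; rewrite mulr0 addr0.
have sgn k (q : L) : size ((-1) ^+ k * q) = size q.
  by rewrite -signr_odd; case: odd; rewrite ?expr1 ?mulN1r ?size_polyN // expr0 mul1r.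
have [att|natt] := boolP (attained D al a).
  rewrite (attD att); have := hM al a; rewrite att => s0.
  case: hmin => [[hm [k ->]]|[_ ->]]; last exact: s0.
  rewrite size_polyDl s0 // sgn ltnS.
  have dm := dep_move x hm; rewrite eqxx addn1 in dm.
  have dD := forallP att x; rewrite -dm in dD.
  have attm : attained D (mv al x) (a - (nat_of_ord x == 0%N)).
    apply/forallP => y; apply: leq_trans (forallP att y).
    by rewrite -(dep_move y hm) leq_addr.
  have := hM (mv al x) (a - (nat_of_ord x == 0%N))%N; rewrite attm => sm.
  rewrite size_scaleXnM // ?sm -?size_poly_gt0 ?sm // (weight_move hm) addSn -addnS leq_add2l.
  exact: hw.
have z0 : (minor M al)`_a = 0 by have := hM al a; rewrite (negPf natt).
have [att'|natt'] := boolP (attained D' al a).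
  have [hm hd] := attained_movable hx Dx Dy att' natt.
  case: hmin => [[_ [k ->]]|[/negP//]]; rewrite z0 add0r sgn.
  have dm := dep_move x hm; rewrite eqxx addn1 hd in dm; case: dm => dm.
  have attm : attained D (mv al x) (a - (nat_of_ord x == 0%N)).
    apply/forallP => y; have [->|yx] := eqVneq y x; first by rewrite dm.
    by rewrite -Dy //; apply: leq_trans (forallP att' y); rewrite -(dep_move y hm) leq_addr.
  have := hM (mv al x) (a - (nat_of_ord x == 0%N))%N; rewrite attm => sm.
  by rewrite size_scaleXnM // ?sm -?size_poly_gt0 ?sm // (weight_move hm) dm addSn.
case: hmin => [[hm [k ->]]|[_ ->]] //.
rewrite z0 add0r.
have nattm : ~~ attained D (mv al x) (a - (nat_of_ord x == 0%N)).
  have [y hy] := forallPn natt'; apply/forallPn; exists y; move: hy.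
  rewrite -!ltnNge -(dep_move y hm); have [->|yx] := eqVneq y x.
    by rewrite Dx addn1 ltnS.
  by rewrite Dy // addn0.
have := hM (mv al x) (a - (nat_of_ord x == 0%N))%N; rewrite (negPf nattm) => ->.
by rewrite !mulr0.
Qed.

End DegreeInvariant.

(** * Symplectic column operations and the sweeps *)

Section OmegaMoves.
Variables (R : comNzRingType) (n : nat).
Implicit Types (x y l : 'I_(n + n)).

Definition osg x : R := if (x < n)%N then 1 else -1.

Lemma OmegaE x y : Omega R n x y = osg x * (y == rev_ord x)%:R.
Proof.
rewrite mxE -val_eqE /= /osg; have hx := ltn_ord x; have hy := ltn_ord y.
have -> : (x + y == (n + n).-1)%N = (val y == n + n - x.+1)%N by apply/eqP/eqP => /=; lia.
by case: eqP; rewrite ?mulr1 ?mulr0.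
Qed.

Lemma osg_rev x : osg (rev_ord x) = - osg x.
Proof.
rewrite /osg /=; have hx := ltn_ord x.
case: (ltnP x n) => h; first by rewrite ifF //; apply/negbTE; rewrite -leqNgt; lia.
by rewrite ifT ?opprK //; lia.
Qed.

Lemma tr_Omega : (Omega R n)^T = - Omega R n.
Proof.
apply/matrixP => x y; rewrite mxE [RHS]mxE !OmegaE.
rewrite [x == _]eq_sym (can2_eq (@rev_ordK _) (@rev_ordK _)).
by case: eqP => [->|_]; rewrite ?osg_rev ?mulNr // !mulr0 oppr0.
Qed.

Lemma delta_Omega l x : delta_mx l x *m Omega R n = osg x *: delta_mx l (rev_ord x).
Proof.
apply/matrixP => i j; rewrite !mxE (bigD1 x) //= big1 ?addr0; last first.
  by move=> k kx; rewrite !mxE (negPf kx) andbF mul0r.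
rewrite [delta_mx _ _ _ _]mxE eqxx andbT OmegaE.
by case: eqP; case: eqP; rewrite ?mulr0 ?mul0r ?mulr1 ?mul1r.
Qed.

(* With S := N Omega, (1 + N) Omega (1 + N)^T = Omega + S - S^T + S N^T. *)
Lemma preserves_Omega (N : 'M[R]_(n + n)) :
  (N *m Omega R n)^T = N *m Omega R n -> N *m Omega R n *m N^T = 0 ->
  (1%:M + N) *m Omega R n *m (1%:M + N)^T = Omega R n.
Proof.
move=> hS hN; rewrite mulmxDl mul1mx linearD /= trmx1 mulmxDl !mulmxDr !mulmx1 hN addr0.
suff -> : Omega R n *m N^T = - (N *m Omega R n) by rewrite -addrA ?subrr ?addNr addr0.
by rewrite -hS trmx_mul tr_Omega mulNmx opprK.
Qed.

Lemma colmoveE (M : 'M[R]_(n, n + n)) l x t :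
  colmove M l x t = M *m (1%:M + t *: delta_mx l x).
Proof.
rewrite mulmxDr mulmx1; apply/matrixP => i j; rewrite !mxE; congr (_ + _).
rewrite (bigD1 l) //= big1 ?addr0; last first.
  by move=> k kl; rewrite !mxE (negPf kl) /= mulr0 mulr0.
rewrite !mxE eqxx /=; case: eqP; rewrite ?mulr1 ?mulr0 ?mul1r ?mul0r ?mulr0 //.
by rewrite mulrC.
Qed.

(** A long root element: [delta_mx (rev_ord x) x] lies in the symplectic Lie algebra and squares to
    zero. *)
Lemma isotropic_long (M : 'M[R]_(n, n + n)) x t :
  M *m Omega R n *m M^T = 0 ->
  colmove M (rev_ord x) x t *m Omega R n *m (colmove M (rev_ord x) x t)^T = 0.
Proof.
move=> hM; have rx : rev_ord x != x.
  by rewrite -val_eqE /=; have := ltn_ord x; lia.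
rewrite colmoveE; set G := 1%:M + _.
have hG : G *m Omega R n *m G^T = Omega R n.
  apply: preserves_Omega; rewrite -scalemxAl delta_Omega scalerA.
    by rewrite linearZ /= trmx_delta.
  by rewrite -scalemxAl linearZ /= trmx_delta -scalemxAr mul_delta_mx_0 ?scaler0 // .
by rewrite trmx_mul mulmxA -(mulmxA M) -(mulmxA M) hG.
Qed.

(** A short root element: the elementary matrix must be accompanied by its mirror image with
    opposite sign. With l = x - 1 this ties position x to position 2n - x. *)
Lemma isotropic_short (M : 'M[R]_(n, n + n)) x l t : l != x -> (x < n)%N -> (l < n)%N ->
  M *m Omega R n *m M^T = 0 ->
  let M' := colmove (colmove M l x t) (rev_ord x) (rev_ord l) (- t) in
  M' *m Omega R n *m M'^T = 0.
Proof.
move=> lx xn ln hM M'.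
have nr (y z : 'I_(n + n)) : (y < n)%N -> (z < n)%N -> rev_ord y != z.
  by move=> yn zn; rewrite -val_eqE /=; lia.
have -> : M' = M *m (1%:M + (t *: delta_mx l x - t *: delta_mx (rev_ord x) (rev_ord l))).
  rewrite /M' !colmoveE -mulmxA; congr (_ *m _).
  rewrite mulmxDl mul1mx mulmxDr mulmx1 -scalemxAl -scalemxAr mul_delta_mx_0; last first.
    by rewrite eq_sym nr.
  by rewrite !scaler0 addr0 scaleNr addrA addrAC.
set N := _ - _; set G := 1%:M + N.
have SE : N *m Omega R n = t *: (delta_mx l (rev_ord x) + delta_mx (rev_ord x) l).
  rewrite mulmxBl -!scalemxAl !delta_Omega rev_ordK osg_rev /osg xn ln.
  by rewrite scale1r scaleNr scale1r scalerN opprK scalerDr.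
have hG : G *m Omega R n *m G^T = Omega R n.
  apply: preserves_Omega; rewrite SE.
    by rewrite linearZ linearD /= !trmx_delta addrC.
  have -> : N^T = t *: delta_mx x l - t *: delta_mx (rev_ord l) (rev_ord x).
    by rewrite /N linearB /= !linearZ /= !trmx_delta.
  rewrite -scalemxAl mulmxBr -!scalemxAr !mulmxDl.
  have rxl : rev_ord x != rev_ord l by rewrite (inj_eq rev_ord_inj) eq_sym.
  have lr : l != rev_ord l by rewrite eq_sym nr.
  have rxx : rev_ord x != x by rewrite nr.
  by rewrite !mul_delta_mx_0 // !addr0 !scaler0 subr0 scaler0.
by rewrite trmx_mul mulmxA -(mulmxA M) -(mulmxA M) hG.
Qed.

Lemma right_inv_colmove (M : 'M[R]_(n, n + n)) l x t : l != x ->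
  (exists B, M *m B = 1%:M) -> exists B, colmove M l x t *m B = 1%:M.
Proof.
move=> lx [B hB]; exists ((1%:M - t *: delta_mx l x) *m B).
rewrite colmoveE -mulmxA (mulmxA (1%:M + _)) mulmxDl mul1mx mulmxBr mulmx1.
rewrite -scalemxAl -scalemxAr mul_delta_mx_0 1?eq_sym // !scaler0 subr0.
by rewrite subrK mul1mx.
Qed.

End OmegaMoves.

Section InitialFrame.
Variables (K : fieldType) (n : nat).
Hypothesis n_gt0 : (0 < n)%N.
Variable w : nat -> nat -> nat.
Local Notation L := {poly K}.
Implicit Types (D : nat -> nat) (x y : 'I_(n + n)).

(** The right inverse survives specialization, so the minors of a specialized frame have no common
    zero on the affine line. *)
Definition good D := exists M : 'M[{poly L}]_(n, n + n),
  [/\ M *m Omega _ n *m M^T = 0, exists B, M *m B = 1%:M & degree_inv w M D].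

Lemma good_ext D D' : (forall y, D y = D' y) -> good D -> good D'.
Proof.
move=> e [M [h1 h2 h3]]; exists M; split=> // al a; have := h3 al a.
by rewrite (_ : attained D' al a = attained D al a) //; apply: eq_forallb => y; rewrite e.
Qed.

(** Depth 0 at position 0 forces level 0, and depth 0 at position n forces al to be the first n
    labels, the only nonzero minor of (1 | 0). *)
Lemma good0 : good (fun=> 0%N).
Proof.
exists (row_mx 1%:M 0); split.
- rewrite tr_row_mx trmx1 trmx0 -[Omega _ n]submxK mul_row_block !mul1mx !mul0mx !addr0.
  rewrite mul_row_col mulmx1 mulmx0 addr0; apply/matrixP => i j; rewrite !mxE ifF //=.
  by have := ltn_ord i; have := ltn_ord j; lia.
- by exists (col_mx 1%:M 0); rewrite mul_row_col mulmx1 mul0mx addr0.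
move=> al a; have [e|e] := eqVneq (val al) [set y : 'I_(n + n) | (y < n)%N].
  have [k m1] : exists k, minor (row_mx 1%:M 0 : 'M[{poly L}]_(n, n + n)) al = (-1) ^+ k * 1.
    set M := row_mx _ _; have c1 : cdet M (fseq (@lshift n n)) = 1.
      rewrite cdet_fseq -[RHS](det1 _ n); congr (\det _); apply/matrixP => i j.
      by rewrite mxE row_mxEl.
    have [|[ga [eg]]] := altextP (minor M) (fseq (@lshift n n)).
      by rewrite altext_minor ?size_fseq // c1 => /eqP; rewrite oner_eq0.
    rewrite altext_minor ?size_fseq // c1 => eM _.
    have -> : al = ga.
      apply: val_inj; rewrite e eg; apply/setP => y; rewrite !inE.
      apply/idP/mapP => [hy|[i _ ->]]; last exact: (ltn_ord i).
      by exists (Ordinal hy); rewrite ?mem_enum //; apply: val_inj.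
    exists (inversions (fseq (@lshift n n))).
    by rewrite -[LHS](signrMK (inversions (fseq (@lshift n n)))) -eM.
  have hd (y : nat) : (y <= n + n)%N -> dep al a y = a.
    move=> hy; have := dep_below al a hy.
    suff -> : below (val al) y = minn y n by rewrite addnC => /addnI.
    rewrite e /below; case: (leqP y n) => hyn.
      rewrite (_ : [set _ in _ | _] = [set y0 : 'I_(n + n) | (y0 < y)%N]).
        elim: y hy hyn => [|y IH] hy hyn; first by apply/eqP; rewrite cards_eq0; apply/eqP/setP => z; rewrite !inE.
        have := belowS setT (Ordinal hy); rewrite /below inE /= addn1.
        have ss i : [set z in [set: 'I_(n + n)] | (z < i)%N] = [set z : 'I_(n + n) | (z < i)%N].
          by apply/setP => z; rewrite !inE.
        by rewrite !ss => ->; rewrite IH // ltnW.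
      by apply/setP => z; rewrite !inE; apply: andb_idl => h; exact: leq_trans h hyn.
    rewrite -[RHS](card_val al) e; congr #|pred_of_set _|; apply/setP => z; rewrite !inE.
    by apply: andb_idr => h; exact: ltn_trans h hyn.
  case: ifP => [/forallP/(_ (Ordinal (leq_trans n_gt0 (leq_addr n n))))|].
    rewrite hd // leqn0 => /eqP a0; rewrite m1 a0 coef_signM coef1 mulr1 /weight big1 => [|y _].
      by rewrite -signr_odd; case: odd; rewrite ?expr1 ?size_polyN ?expr0 size_poly1.
    by rewrite -a0 hd ?a0 ?big_ord0 // ltnW.
  move/negbT/forallPn => [y]; rewrite -ltnNge hd; last by rewrite ltnW.
  by rewrite m1 coef_signM coef1; case: a {hd} => [|a] //= _; rewrite mulr0.
have m0 : minor (row_mx 1%:M 0 : 'M[{poly L}]_(n, n + n)) al = 0.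
  have [y yal yn] : exists2 y, y \in val al & ~~ (y < n)%N.
    have : ~~ (val al \subset [set y : 'I_(n + n) | (y < n)%N]).
      apply: contra e => sub; rewrite eqEcard sub card_val /=.
      rewrite -[X in (_ <= X)%N]card_ord -(card_imset _ (@lshift_inj n n)).
      apply/subset_leq_card/subsetP => z; rewrite inE => hz.
      by apply/imsetP; exists (Ordinal hz) => //; apply: val_inj.
    by move=> /subsetPn[y h1 h2]; exists y => //; move: h2; rewrite inE.
  have [r er] : exists r, y = sel al r.
    by move: yal; rewrite -mem_enum -fseq_sel => /mapP[r _ ->]; exists r.
  rewrite minor_sel (expand_det_col _ r) big1 // => i _; rewrite !mxE -er.
  case: splitP => k ek; last by rewrite mxE mul0r.
  by rewrite ek ltn_ord in yn.
rewrite m0 coef0; case: ifP => // /forallP hA; case/eqP: e.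
have hn : (n < n + n)%N by lia.
have h0 : (0 < n + n)%N by lia.
have a0 : a = 0%N.
  have := dep_below al a (ltnW h0); rewrite below0 min0n !add0n addn0 => <-.
  by have := hA (Ordinal h0); rewrite leqn0 => /eqP.
have bn : below (val al) n = n.
  have := dep_below al a (ltnW hn); rewrite a0 minnn.
  by have := hA (Ordinal hn); rewrite leqn0 a0 => /eqP /= ->; rewrite add0n addn0.
apply/eqP; rewrite eqEcard; apply/andP; split.
  have /eqP sub : [set z in val al | (z < n)%N] == val al.
    rewrite eqEcard card_val -[X in (X <= _)%N]bn leqnn andbT.
    by apply/subsetP => z; rewrite inE => /andP[].
  by rewrite -sub; apply/subsetP => z; rewrite !inE => /andP[].
rewrite card_val -[X in (_ <= X)%N]card_ord -(card_imset _ (@lshift_inj n n)).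
apply/subset_leq_card/subsetP => z; rewrite inE => hz.
by apply/imsetP; exists (Ordinal hz) => //; apply: val_inj.
Qed.

End InitialFrame.

Section SweepSteps.
Variables (K : fieldType) (n d : nat).
Hypothesis n_gt0 : (0 < n)%N.
Variable w : nat -> nat -> nat.
Hypothesis w_decr : forall x i j, (i < j < d + n)%N -> (w x j < w x i)%N.
Hypothesis w_sym : forall x j, (x <= n)%N -> w (n + n - x) j = w x j.
Local Notation L := {poly K}.
Local Notation good := (@good K n w).
Implicit Types (D : nat -> nat) (x y l : 'I_(n + n)).

Lemma good_move_long x D D' : rev_ord x = prv n_gt0 x -> addable D x -> (D x < d + n)%N ->
  D' x = (D x).+1 -> (forall y, y != x -> D' y = D y) -> good D -> good D'.
Proof.
move=> rx hx Dx_lt Dx Dy [M [h1 h2 h3]].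
exists (colmove M (prv n_gt0 x) x (step_coef x (w x (D x)) 1)); split.
- by rewrite -rx; exact: isotropic_long.
- by apply: right_inv_colmove => //; exact: prv_neq.
apply: (degree_inv_step n_gt0 h3 hx (oner_neq0 _) Dx Dy) => j hj.
by apply: w_decr; rewrite hj.
Qed.

(** [D1] is the state between the two column moves of a short root element. Isotropy is established
    after the second move only, so just the degree invariant is followed through [D1]. *)
Lemma good_move_short x D D1 D' : (0 < x < n)%N -> addable D x ->
  addable D1 (rev_ord (prv n_gt0 x)) ->
  (D x < d + n)%N -> D (rev_ord (prv n_gt0 x)) = D x ->
  D1 x = (D x).+1 -> (forall y, y != x -> D1 y = D y) ->
  D' (rev_ord (prv n_gt0 x)) = (D x).+1 ->
  (forall y, y != rev_ord (prv n_gt0 x) -> D' y = D1 y) -> good D -> good D'.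
Proof.
move=> /andP[x0 xn]; set l := prv n_gt0 x; set x' := rev_ord l.
move=> hx hx' Dx_lt Dxx' D1x D1y D'x D'y [M [h1 h2 h3]].
have vl : nat_of_ord l = x.-1 by rewrite val_prv gtn_eqF.
have lx : l != x by exact: prv_neq.
have vrev (y : 'I_(n + n)) : nat_of_ord (rev_ord y) = (n + n - y.+1)%N by [].
have vx' : nat_of_ord x' = (n + n - x)%N by rewrite /x' vrev vl; lia.
have x'x : x' != x.
  by apply/eqP => /(congr1 (@nat_of_ord _)); rewrite vx'; lia.
have px' : prv n_gt0 x' = rev_ord x.
  by apply: ord_inj; rewrite val_prv vx' vrev ifF; [lia | apply/negbTE; lia].
set e := w x (D x); set t := step_coef x e 1 : {poly L}.
have ee : e = w x' (D1 x') by rewrite D1y // Dxx' vx' w_sym // ltnW.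
(* This sign is the reason for the scalar c in [step_coef]. *)
have tt : step_coef x' e (-1) = - t.
  by rewrite /t /step_coef vx' !gtn_eqF ?subn_gt0 1?ltn_addr // !mulr1 scaleN1r scale1r polyCN.
exists (colmove (colmove M l x t) (rev_ord x) x' (- t)); split.
- by apply: isotropic_short => //; rewrite vl; lia.
- apply: right_inv_colmove; first by rewrite -px' prv_neq.
  exact: right_inv_colmove.
have h4 : degree_inv w (colmove M l x t) D1.
  by apply: (degree_inv_step n_gt0 h3 hx (oner_neq0 _) D1x D1y) => j hj; apply: w_decr; rewrite hj.
rewrite -px' -tt ee; apply: (degree_inv_step n_gt0 h4 hx') => //.
- by rewrite oppr_eq0 oner_neq0.
- by rewrite D'x D1y // Dxx'.
- by rewrite D1y // Dxx' => j hj; apply: w_decr; rewrite hj.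
Qed.

(* The j-th sweep moves once at the positions v and 2n - v for v = n, ..., 1, 0
   in this order, skipping positions already at their final depth d + v; this is
   the state once v = y is done. *)
Definition sweep_state (j y k : nat) : nat :=
  let v := minn k (n + n - k) in if (y <= v)%N then minn j (d + v) else minn j.-1 (d + v).

(** If j exceeds d + y the position is already full. Otherwise y = 0 and y = n are their own mirror
    images modulo 2n and take long roots, while the other positions move in pairs by short roots. *)
Lemma good_sweep_step (j y : nat) : (0 < j <= d + n)%N -> (y <= n)%N ->
  good (sweep_state j y.+1) -> good (sweep_state j y).
Proof.
move=> /andP[j0 jn] yn; have [jy|jy] := ltnP (d + y) j.
  apply: good_ext => k; rewrite /sweep_state.
  case: ifP => h1; case: ifP => h2 //; lia.
have Dy (k : nat) : minn k (n + n - k) != y -> sweep_state j y k = sweep_state j y.+1 k.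
  by move=> h; rewrite /sweep_state; case: ifP => h1; case: ifP => h2 //; lia.
have yn2 : (y < n + n)%N by lia.
pose x : 'I_(n + n) := Ordinal yn2.
have Sx : sweep_state j y.+1 y = j.-1.
  by rewrite /sweep_state ifF; [lia | apply/negbTE; lia].
have hx : addable (sweep_state j y.+1) x.
  split; rewrite /sweep_state /=.
  - by do 2!case: ifP; lia.
  - by do 2!case: ifP; lia.
  - by do 2!case: ifP; lia.
  - by move=> y0; do 2!case: ifP; lia.
have D'x : sweep_state j y y = j.
  by rewrite /sweep_state ifT; lia.
have [y0|y0] := posnP y.
  apply: (good_move_long (x := x)) => //; rewrite /= ?Sx ?D'x ?prednK //; try lia.
  - by apply: ord_inj; rewrite val_prv /= y0 eqxx; lia.
  - move=> z zx; apply: Dy; have := ltn_ord z; move: zx; rewrite -val_eqE /=; lia.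
case: (eqVneq y n) => [yE|ynE].
  apply: (good_move_long (x := x)) => //; rewrite /= ?Sx ?D'x ?prednK //; try lia.
  - by apply: ord_inj; rewrite val_prv /= gtn_eqF //; lia.
  - move=> z zx; apply: Dy; have := ltn_ord z; move: zx; rewrite -val_eqE /=; lia.
have vx' : nat_of_ord (rev_ord (prv n_gt0 x)) = (n + n - y)%N.
  have vrev (z : 'I_(n + n)) : nat_of_ord (rev_ord z) = (n + n - z.+1)%N by [].
  by rewrite vrev val_prv gtn_eqF //=; lia.
have Sx' : sweep_state j y.+1 (n + n - y) = j.-1.
  by rewrite /sweep_state ifF; [lia | apply/negbTE; lia].
have D'x' : sweep_state j y (n + n - y) = j.
  by rewrite /sweep_state ifT; lia.
pose D1 k := if k == y then j else sweep_state j y.+1 k.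
apply: (@good_move_short x _ D1) => //.
- by rewrite /= y0; lia.
- split; rewrite ?vx' /D1.
  + by rewrite !ifF; [case: hx | apply/negbTE; lia | apply/negbTE; lia].
  + by move=> _; rewrite !ifF; [|apply/negbTE; lia..]; rewrite /sweep_state; do 2!case: ifP; lia.
  + by rewrite !ifF; [|apply/negbTE; lia..]; rewrite /sweep_state; do 2!case: ifP; lia.
  + lia.
- by rewrite /= Sx; lia.
- by rewrite vx' Sx' /= Sx.
- by rewrite /D1 /= eqxx Sx prednK.
- by move=> z; rewrite /D1 -val_eqE /= => /negPf->.
- by rewrite vx' D'x' /= Sx prednK.
move=> z zx'; rewrite /D1; case: eqP => [->//|/eqP zx]; apply: Dy.
have := ltn_ord z; move: zx'; rewrite -val_eqE [val (rev_ord _)]vx' /=; lia.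
Qed.

(** The depth vector of the last n labels at level d, the largest one by [pdep_le]. *)
Definition final_state (k : nat) : nat := (d + minn k (n + n - k))%N.

Lemma good_final : good final_state.
Proof.
have sw (j y : nat) : (0 < j <= d + n)%N -> (y <= n)%N -> good (sweep_state j n.+1) ->
    good (sweep_state j (n - y)).
  move=> hj; elim: y => [|y IH] hy hg.
    by rewrite subn0; exact: good_sweep_step.
  apply: good_sweep_step => //; first exact: leq_subr.
  by rewrite -subSn // subSS; apply: IH => //; exact: ltnW.
have fin j : (j <= d + n)%N -> good (sweep_state j 0).
  elim: j => [|j IH] hj.
    apply: good_ext (good0 K n_gt0 w) => k.
    by rewrite /sweep_state /= min0n.
  rewrite -(subnn n); apply: sw => //.
  apply: good_ext (IH (ltnW hj)) => k; rewrite /sweep_state /=.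
  by rewrite ifF //; apply/negbTE; lia.
apply: good_ext (fin _ (leqnn _)) => k; rewrite /sweep_state /final_state /=.
lia.
Qed.

End SweepSteps.

(** * Independence of standard monomials *)

Section StandardDepths.
Variables (n d : nat).
Hypothesis n_gt0 : (0 < n)%N.
Implicit Types (al : nsubset n) (A B : pidx n d) (s t : seq (pidx n d)).

Definition pdep A (k : nat) : nat := dep A.1 A.2 k.

(** A label belongs to tau al exactly when its mirror image is missing from al; hence tau reverses
    depth vectors. *)
Lemma below_tau al k : (k <= n + n)%N ->
  (below (val (tau al)) k + n = k + below (val al) (n + n - k))%N.
Proof.
move=> kn; have cT : below [set: 'I_(n + n)] k = k.
  apply/eqP; rewrite eqn_leq below_le //=.
  by have := below_ge n_gt0 setT kn; rewrite cardsT card_ord addnC leq_add2r.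
suff : (below (val (tau al)) k + #|val al| =
    below [set: 'I_(n + n)] k + below (val al) (n + n - k))%N by rewrite card_val cT.
rewrite card_idx !below_idx -!big_split /=.
apply: eq_bigr => i _; have hi := ltn_ord i.
have -> : (barI i \in val (tau al)) = (posI i \notin val al).
  by rewrite val_tau !inE idx_barI; do 2!case: (_ \in val al).
have -> : (posI i \in val (tau al)) = (barI i \notin val al).
  by rewrite val_tau !inE idx_posI; do 2!case: (_ \in val al).
have -> : (n - i.+1 < n + n - k)%N = ~~ (n + i < k)%N by lia.
have -> : (n + i < n + n - k)%N = ~~ (n - i.+1 < k)%N by lia.
rewrite !inE; do 2!case: (_ \in val al); do 2!case: (_ < k)%N => //.
Qed.

Lemma pdep_tau A k : (k <= n + n)%N -> pdep (tau A.1, A.2) k = pdep A (n + n - k).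
Proof.
move=> kn; rewrite /pdep /=; have := below_tau A.1 kn.
have := dep_below (tau A.1) A.2 kn; have := dep_below A.1 A.2 (leq_subr k (n + n)).
lia.
Qed.

Lemma dleP A B k : (k <= n + n)%N -> dle A B -> (pdep A k <= pdep B k)%N.
Proof.
move=> kn /forallP h; rewrite /pdep.
have {h} : (below (val B.1) k + A.2 <= below (val A.1) k + B.2)%N.
  exact: (h (Ordinal (kn : (k < (n + n).+1)%N))).
have := dep_below A.1 A.2 kn; have := dep_below B.1 B.2 kn; lia.
Qed.

Lemma stdrelP A B k : (k <= n + n)%N -> stdrel A B ->
  (pdep A k <= pdep B k)%N /\ (pdep A (n + n - k) <= pdep B k)%N.
Proof.
by move=> kn /andP[h1 h2]; rewrite -(pdep_tau A kn); split; exact: dleP.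
Qed.

(** The labels from k up to 2n - k form the pairs of index below n - k, so the two depths differ by
    the excess of empty over full pairs among these. *)
Lemma dyck_pdep A k : (k <= n)%N -> dyck A.1 -> (pdep A k <= pdep A (n + n - k))%N.
Proof.
move=> kn /forallP/(_ (inord (n - k))); rewrite inordK ?ltnS ?leq_subr //.
have kn2 : (k <= n + n)%N by lia.
have := dep_below A.1 A.2 kn2; have := dep_below A.1 A.2 (leq_subr k (n + n)).
have : (below (val A.1) (n + n - k) + #|[set i in free (val A.1) | (i < n - k)%N]|
  = below (val A.1) k + (n - k) + #|[set i in Pset (val A.1) | (i < n - k)%N]|)%N.
  have cnt : (\sum_(i < n) (i < n - k) = n - k)%N.
    transitivity (\sum_(i < n | (i < n - k)%N) 1)%N.
      by rewrite [RHS]big_mkcond; apply: eq_bigr => i _; case: ifP.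
    by rewrite (big_ord_narrow (leq_subr k n)) sum1_card card_ord.
  rewrite -[in (_ + (n - k))%N]cnt.
  rewrite !card_sum_mem !below_idx -!big_split /=; apply: eq_bigr => i _.
  have hi := ltn_ord i; rewrite !inE.
  have -> : (n - i.+1 < n + n - k)%N by lia.
  have -> : (n + i < n + n - k)%N = (i < n - k)%N by lia.
  have -> : (n + i < k)%N = false by apply/negbTE; lia.
  have -> : (n - i.+1 < k)%N = ~~ (i < n - k)%N by lia.
  by do 2!case: (_ \in val A.1); case: (i < n - k)%N.
by rewrite /pdep; lia.
Qed.

Lemma pdep_inj A B : (forall k, (k < n + n)%N -> pdep A k = pdep B k) -> A = B.
Proof.
case: A B => [al a] [be b] h; rewrite /pdep /= in h.
have ab : a = b.
  have h0 : (0 < n + n)%N by lia.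
  have := h 0%N h0; have := dep_below al a (ltnW h0); have := dep_below be b (ltnW h0).
  by rewrite !below0 min0n !addn0 !add0n => -> -> /val_inj.
have bl k : (k <= n + n)%N -> below (val al) k = below (val be) k.
  rewrite leq_eqVlt => /orP[/eqP->|hk]; first by rewrite !below_full !card_val.
  have := h k hk; have := dep_below al a (ltnW hk); have := dep_below be b (ltnW hk).
  by rewrite ab => e1 e2 e3; move: e1 e2; rewrite e3; lia.
congr pair => //; apply: val_inj; apply/setP => y; apply/idP/idP => hy.
  have := bl y.+1 (ltn_ord y); rewrite !belowS hy bl ?(ltnW (ltn_ord y)) //.
  by move/addnI; case: (_ \in _).
have := bl y.+1 (ltn_ord y); rewrite !belowS hy bl ?(ltnW (ltn_ord y)) //.
by move/addnI; case: (_ \in _).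
Qed.

Lemma pdep_le A k : (k <= n + n)%N -> (pdep A k <= d + minn k (n + n - k))%N.
Proof.
move=> kn; have := dep_below A.1 A.2 kn; have := below_ge n_gt0 (val A.1) kn.
by rewrite card_val /pdep; have := ltn_ord A.2; lia.
Qed.

Definition depths s k : seq nat := flatten [seq [:: pdep A k; pdep A (n + n - k)] | A <- s].

Lemma sorted_depths s k : (k <= n)%N -> std s -> sorted leq (depths s k).
Proof.
move=> kn /andP[hd hp]; rewrite sorted_pairwise; last exact: leq_trans.
have kn2 : (k <= n + n)%N by lia.
elim: s hd hp => //= A s IH /andP[dA ds] /andP[/allP sA ps].
rewrite IH // andbT (dyck_pdep kn dA) /=.
have hB z : z \in depths s k -> (pdep A k <= z)%N && (pdep A (n + n - k) <= z)%N.
  move/flattenP => [u /mapP[B Bs ->]]; rewrite !inE.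
  have [h1 h2] := stdrelP kn2 (sA B Bs).
  have [h3 h4] := stdrelP (leq_subr k (n + n)) (sA B Bs); rewrite subKn // in h4.
  by move=> /orP[] /eqP->; rewrite ?h1 ?h2 ?h3 ?h4.
by apply/andP; split; apply/allP => z /hB /andP[].
Qed.

Lemma eq_sorted_count (u v : seq nat) : sorted leq u -> sorted leq v -> size u = size v ->
  (forall j, count (fun z => j < z)%N u = count (fun z => j < z)%N v) -> u = v.
Proof.
move=> su sv suv h; apply: (sorted_eq leq_trans anti_leq su sv).
apply/allP => z _ /=; apply/eqP.
have pz (r : seq nat) : (count_mem z r + count (fun y => z < y) r
    = if z is z'.+1 then count (fun y => z' < y) r else size r)%N.
  rewrite -count_predUI [X in (_ + X)%N](eq_count (a2 := pred0)); last first.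
    by move=> y; apply/negbTE/negP => /andP[/eqP->]; rewrite ltnn.
  rewrite count_pred0 addn0; case: z => [|z].
    by rewrite -count_predT; apply: eq_count => y /=; rewrite lt0n orbN.
  by apply: eq_count => y /=; rewrite [(z < y)%N]leq_eqVlt eq_sym.
apply/eqP; rewrite -(eqn_add2r (count (fun y => z < y)%N u)) {2}h !pz.
by case: z {pz} => [|z]; rewrite ?suv ?h.
Qed.

Lemma depths_inj s t : size s = size t ->
  (forall k, (k <= n)%N -> depths s k = depths t k) -> s = t.
Proof.
move=> st h; have hk k : (k < n + n)%N -> [seq pdep A k | A <- s] = [seq pdep A k | A <- t].
  have split2 (k' : nat) (r r' : seq (pidx n d)) : size r = size r' -> depths r k' = depths r' k' ->
     [seq pdep A k' | A <- r] = [seq pdep A k' | A <- r'] /\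
     [seq pdep A (n + n - k') | A <- r] = [seq pdep A (n + n - k') | A <- r'].
    elim: r r' => [|A r IH] [|B r'] //= [rr'] [-> ->] /(IH _ rr')[-> ->]; by [].
  move=> kn; case: (leqP k n) => kn'; first by have [] := split2 k s t st (h k kn').
  have h' : (n + n - k <= n)%N by lia.
  have [_] := split2 _ s t st (h _ h'); rewrite subKn //; exact: ltnW.
case: s t st h hk => [|A0 s] t st h hk; first by rewrite (size0nil (esym st)).
apply: (@eq_from_nth _ A0) => // i hi; apply: pdep_inj => k kn.
have := congr1 (fun r => nth 0%N r i) (hk k kn).
by rewrite (nth_map A0) // (nth_map A0) // -st.
Qed.

End StandardDepths.

(** * I + L vanishes on Lagrangian maps *)

Section IsotropicRelation.
Variables (K : numFieldType) (n : nat).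

Lemma isotropic_sum (A : 'M[K]_(n, n + n)) u v : A *m Omega _ n *m A^T = 0 ->
  \sum_i A u (barI i) * A v (posI i) = \sum_i A v (barI i) * A u (posI i).
Proof.
move=> /matrixP/(_ u v); rewrite !mxE.
have -> : \sum_j (A *m Omega K n) u j * A^T j v
    = \sum_x osg K x * A u x * A v (rev_ord x).
  under eq_bigr => j _ do rewrite !mxE big_distrl /=.
  rewrite exchange_big /=; apply: eq_bigr => x _.
  rewrite (bigD1 (rev_ord x)) //= big1 ?addr0; last first.
    by move=> j jx; rewrite OmegaE (negPf jx) mulr0 mulr0 mul0r.
  by rewrite OmegaE eqxx mulr1 [osg _ _ * _]mulrC.
rewrite sum_idx => e; apply/eqP; rewrite -subr_eq0 -sumrB -[X in _ == X]e; apply/eqP.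
apply: eq_bigr => i _; have hi := ltn_ord i.
have rb : rev_ord (barI i) = posI i by apply: ord_inj => /=; lia.
have rp : rev_ord (posI i) = barI i by rewrite -rb rev_ordK.
rewrite rb rp /osg /=; have -> : (n - i.+1 < n)%N by lia.
have -> : (n + i < n)%N = false by apply/negbTE; lia.
by rewrite mul1r mulN1r mulNr [A v _ * _]mulrC.
Qed.

(* Exchanging the first two columns preserves the summed Leibniz terms, by
   [isotropic_sum], but changes the sign of the permutation. *)
Lemma sum_cdet_isotropic (A : 'M[K]_(n, n + n)) (t : seq 'I_(n + n)) :
  (size t + 2)%N = n -> A *m Omega _ n *m A^T = 0 ->
  \sum_i cdet A [:: barI i, posI i & t] = 0.
Proof.
move=> ht hA; have h0 : (0 < n)%N by lia.
have h1 : (1 < n)%N by lia.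
pose j0 := Ordinal h0; pose j1 := Ordinal h1.
have j01 : j1 != j0 by [].
pose rest (s : 'S_n) := \prod_(j | (j != j0) && (j != j1)) A (s j) (nth (lshift n j) t (j - 2)).
pose B u v := \sum_i A u (barI i) * A v (posI i).
have e : \sum_i cdet A [:: barI i, posI i & t] =
    \sum_(s : 'S_n) (-1) ^+ s * (B (s j0) (s j1) * rest s).
  rewrite /cdet; under eq_bigr => i _ do rewrite -det_tr /determinant.
  rewrite exchange_big /=; apply: eq_bigr => s _; rewrite big_distrl big_distrr /=.
  apply: eq_bigr => i _; rewrite (bigD1 j0) //= (bigD1 j1) //= !mxE /= mulrA.
  congr (_ * (_ * _)); apply: eq_bigr => j /andP[jj0 jj1]; rewrite !mxE.
  move: jj0 jj1; rewrite -!val_eqE /=.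
  by case: (nat_of_ord j) => [|[|k]] // _ _; rewrite /= subn2.
set S := \sum_i _ in e *.
have : S = - S.
  rewrite {1}e (reindex_inj (mulgI (tperm j0 j1))) e -sumrN; apply: eq_bigr => s _ /=.
  rewrite odd_mul_tperm eq_sym j01 signr_addb expr1 mulN1r mulNr !permM tpermL tpermR.
  rewrite /B isotropic_sum //; congr (- (_ * (_ * _))).
  apply: eq_bigr => j /andP[jj0 jj1]; rewrite permM tpermD // eq_sym //.
move/eqP; rewrite -subr_eq0 opprK -mulr2n mulrn_eq0 /= => /eqP; exact.
Qed.

End IsotropicRelation.

Section EasyInclusion.
Variables (R : realType) (n d : nat).
Local Notation K := (Cplx R).
Implicit Types (c : pidx n d -> K) (f : polyring R n d).

Lemma LGMap_GrMap c : LGMap c -> GrMap c.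
Proof. by move=> [h1 h2]; split=> // s t /h2[A [hA _]]; exists A. Qed.

Lemma evalp_pvar A c : evalp (pvar R A) c = c A.
Proof. by rewrite /evalp /pvar mevalXU enum_rankK. Qed.

(** Isotropy gives the relation at each point (z, 1), and comparing coefficients in z gives it level
    by level. Indices i meeting be may be added to the sum, their determinants having a repeated
    column. *)
Lemma Lgen_vanishes a (be : {set 'I_(n + n)}) c l : (#|be| + 2 == n)%N -> LGMap c ->
  evalp (Lgen R a be) (fun x => l * c x) = 0.
Proof.
move=> /eqP hbe [_ hc]; have h2 : #|be|.+2 = n by rewrite -addn2.
pose ok (i : 'I_n) := (barI i \notin be) && (posI i \notin be).
pose g i : {set 'I_(n + n)} := be :|: [set barI i; posI i].
have cg i : ok i -> #|g i| == n.
  move=> /andP[bi pi]; rewrite /g setUC -setUA !cardsU1 !inE pi.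
  have -> : (barI i == posI i) = false by apply/negbTE; rewrite -val_eqE /=; have := ltn_ord i; lia.
  by rewrite (negPf bi) /= !add1n h2.
pose sg (i : 'I_n) : K := (-1) ^+ inversions [:: barI i, posI i & enum be].
pose cc (i : 'I_n) (b : 'I_d.+1) : K := if insub (g i) is Some al then c (al, b) else 0.
have cs i (s t : K) (A : 'M[K]_(n, n + n)) :
    (forall al, Defs.form c al s t = minor A al) -> ok i ->
    sg i * (\sum_(b < d.+1) cc i b * s ^+ b * t ^+ (d - b)) = cdet A [:: barI i, posI i & enum be].
  move=> hA oki; have sz : size [:: barI i, posI i & enum be] = n by rewrite /= -cardE h2.
  have bp : barI i != posI i by rewrite -val_eqE /=; have := ltn_ord i; lia.
  have us : uniq [:: barI i, posI i & enum be].
    by case/andP: oki => hb hp; rewrite /= inE (negPf bp) !mem_enum hb hp enum_uniq.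
  rewrite -altext_minor // /altext us.
  have -> : [set y in [:: barI i, posI i & enum be]] = g i.
    by apply/setP => y; rewrite !inE mem_enum orbA orbC.
  rewrite /cc; case: insubP => [al _ e|]; last by rewrite cg.
  by rewrite -hA.
have zero b : \sum_(i | ok i) sg i * cc i b = 0.
  pose q : {poly K} := \poly_(b < d.+1) \sum_(i | ok i) sg i * cc i (inord b).
  suff q0 : q = 0.
    by have := congr1 (fun r : {poly K} => r`_b) q0; rewrite coef_poly ltn_ord inord_val coef0.
  apply: poly_ext => z; rewrite horner0 horner_poly.
  have z1 : (z, 1) != (0, 0) :> K * K by rewrite xpair_eqE oner_eq0 andbF.
  have [A [hA isoA]] := hc z 1 z1.
  transitivity (\sum_(i | ok i) cdet A [:: barI i, posI i & enum be]).
    transitivity (\sum_(i | ok i) sg i * (\sum_(b' < d.+1) cc i b' * z ^+ b' * 1 ^+ (d - b'))).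
      2: by apply: eq_bigr => i; exact: cs.
    under [LHS]eq_bigr => b' _ do rewrite inord_val big_distrl /=.
    rewrite exchange_big /=; apply: eq_bigr => i _; rewrite big_distrr; apply: eq_bigr => b' _.
    by rewrite /= expr1n mulr1 mulrA.
  rewrite -[RHS](sum_cdet_isotropic (t := enum be) _ isoA); last by rewrite -cardE.
  rewrite [RHS](bigID ok) /= [X in _ + X]big1 ?addr0 // => i; rewrite negb_and !negbK => hi.
  rewrite cdet_dup //; first by rewrite /= -cardE h2.
  by rewrite /= !inE !mem_enum; case/orP: hi => ->; rewrite ?orbT ?andbF.
suff -> : evalp (Lgen R a be) (fun x => l * c x) = l * (\sum_(i | ok i) sg i * cc i a).
  by rewrite zero mulr0.
rewrite /evalp /Lgen rmorph_sum mulr_sumr; apply: eq_bigr => i oki; rewrite /= mevalZ /pvarS /cc -/(g i) mulrCA; congr (_ * _).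
case: insubP => [al _ _|]; last by rewrite cg.
exact: (evalp_pvar (al, a) (fun x => l * c x)).
Qed.

Lemma in_I_plus_L_ILQ f : in_I_plus_L f -> ILQ f.
Proof.
move=> [g [hg [q ->]]] c hc l; have := hg c (LGMap_GrMap hc) l; rewrite /evalp mevalD => ->.
rewrite add0r rmorph_sum big1 // => x hx; rewrite /= mevalM.
by have := Lgen_vanishes x.1 l hx hc; rewrite /evalp => ->; rewrite mulr0.
Qed.

End EasyInclusion.

(** * Degree-d maps from polynomial frames *)

Section TopCoefficients.
Variable K : fieldType.

Lemma coefM_top (p q : {poly K}) a b : (size p <= a.+1)%N -> (size q <= b.+1)%N ->
  (p * q)`_(a + b) = p`_a * q`_b.
Proof.
move=> /leq_sizeP hp /leq_sizeP hq; rewrite coefM.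
have ha : (a < (a + b).+1)%N by rewrite ltnS leq_addr.
rewrite (bigD1 (Ordinal ha)) //= addKn big1 ?addr0 // => j; rewrite -val_eqE /= => ja.
case: (ltngtP j a) ja => // h _; last by rewrite hp // mul0r.
by rewrite [q`_ _]hq ?mulr0 //; lia.
Qed.

Lemma coef_prod_top (I : Type) (r : seq I) (F : I -> {poly K}) a :
  (forall i, size (F i) <= a.+1)%N ->
  (size (\prod_(i <- r) F i)%R <= (size r * a).+1)%N /\
  (\prod_(i <- r) F i)`_(size r * a) = \prod_(i <- r) (F i)`_a.
Proof.
move=> hF; elim: r => [|i r [IH1 IH2]]; first by rewrite !big_nil size_poly1 coef1.
rewrite !big_cons /= mulSn coefM_top // IH2; split=> //.
apply: leq_trans (size_polyMleq _ _) _.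
by rewrite -subn1 leq_subLR add1n -addnS -addSn leq_add.
Qed.

Lemma coef_det_top n (A : 'M[{poly K}]_n) a : (forall i j, size (A i j) <= a.+1)%N ->
  (\det A)`_(n * a) = \det (map_mx (coefp a) A).
Proof.
move=> hA; rewrite /determinant coef_sum; apply: eq_bigr => s _; rewrite coef_signM.
have [_] := @coef_prod_top _ (enum 'I_n) (fun i => A i (s i)) a (fun i => hA i (s i)).
rewrite size_enum_ord !big_enum /= => ->; congr (_ * _).
by apply: eq_bigr => i _; rewrite !mxE.
Qed.

Lemma size_det_top n (A : 'M[{poly K}]_n) a : (forall i j, size (A i j) <= a.+1)%N ->
  (size (\det A)%R <= (n * a).+1)%N.
Proof.
move=> hA; rewrite /determinant; apply: (leq_trans (size_sum _ _ _)).
apply/bigmax_leqP => s _.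
have [h _] := @coef_prod_top _ (enum 'I_n) (fun i => A i (s i)) a (fun i => hA i (s i)).
move: h; rewrite size_enum_ord big_enum /= => h.
by rewrite -signr_odd; case: odd; rewrite ?expr1 ?mulN1r ?size_polyN // expr0 mul1r.
Qed.

End TopCoefficients.

Section FrameMaps.
Variables (R : realType) (n d : nat).
Hypothesis n_gt0 : (0 < n)%N.
Local Notation K := (Cplx R).

(** Serves to rescale a frame so that its minors equal the values of the forms instead of being
    proportional to them. *)
Lemma exists_det (c : K) : exists C : 'M[K]_n, \det C = c.
Proof.
exists (diag_mx (\row_j (if j == Ordinal n_gt0 then c else 1))).
rewrite det_diag (bigD1 (Ordinal n_gt0)) //= big1 => [|j /negPf jn]; rewrite mxE ?jn //.
by rewrite eqxx mulr1.
Qed.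

Lemma minor_neq0 (A : 'M[K]_(n, n + n)) B : A *m B = 1%:M -> exists al, minor A al != 0.
Proof.
move=> AB; have fA : row_full A^T.
  by apply/row_fullP; exists B^T; rewrite -trmx_mul AB trmx1.
pose f := fullrankfun fA.
have nz : cdet A (fseq f) != 0.
  rewrite cdet_fseq -det_tr (_ : _^T = rowsub f A^T).
    by have := fullrowsub_unit fA; rewrite unitmxE unitfE.
  by apply/matrixP => i j; rewrite !mxE.
rewrite -altext_minor ?size_fseq // in nz.
have [e|[al [_ e _]]] := altextP (minor A) (fseq f); first by rewrite e eqxx in nz.
by exists al; apply: contraNneq nz => z; rewrite e z mulr0.
Qed.

Lemma isotropic_mull (S : comNzRingType) (C : 'M[S]_n) (A : 'M[S]_(n, n + n)) :
  A *m Omega _ n *m A^T = 0 -> (C *m A) *m Omega _ n *m (C *m A)^T = 0.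
Proof. by move=> hA; rewrite trmx_mul mulmxA -!(mulmxA C) hA mul0mx mulmx0. Qed.

Lemma map_Omega (S T : nzRingType) (f : {rmorphism S -> T}) :
  map_mx f (Omega S n) = Omega T n.
Proof.
apply/matrixP => i j; rewrite !mxE; case: ifP => _; last by rewrite rmorph0.
by case: ifP => _; rewrite ?rmorphN rmorph1.
Qed.

Lemma map_isotropic (S T : comNzRingType) (f : {rmorphism S -> T}) (A : 'M[S]_(n, n + n)) :
  A *m Omega _ n *m A^T = 0 -> map_mx f A *m Omega _ n *m (map_mx f A)^T = 0.
Proof. by move=> hA; rewrite -(map_Omega f) map_trmx -!map_mxM hA map_mx0. Qed.

(* At the point t = 0 the subspace is spanned by the top coefficients of a
   chart matrix around a coordinate of full degree. *)
Lemma LGMap_frame (N : 'M[{poly K}]_(n, n + n)) :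
  N *m Omega _ n *m N^T = 0 -> (exists B, N *m B = 1%:M) ->
  (forall al, size (minor N al) <= d.+1)%N -> (exists al, (minor N al)`_d != 0) ->
  LGMap (fun x : pidx n d => (minor N x.1)`_x.2).
Proof.
move=> isoN [B NB] szN [al0 top0]; set c := fun x : pidx n d => _.
have form0 al s : Defs.form c al s 0 = (minor N al)`_d * s ^+ d.
  rewrite /Defs.form big_ord_recr /= subnn expr0 mulr1 big1 ?add0r // => i _.
  by rewrite expr0n subn_eq0 leqNgt ltn_ord /= mulr0.
have form1 al s t : t != 0 -> Defs.form c al s t = t ^+ d * (minor N al).[s / t].
  move=> t0; rewrite (horner_coef_wide _ (szN al)) /Defs.form big_distrr /=.
  apply: eq_bigr => i _; rewrite /c /= expr_div_n mulrCA -mulrA; congr (_ * _).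
  rewrite mulrCA; congr (_ * _).
  have -> : t ^+ d = t ^+ (d - i) * t ^+ i by rewrite -exprD subnK // -ltnS.
  by rewrite mulfK ?expf_neq0.
have mz al z : minor (map_mx (horner_eval z) N) al = (minor N al).[z].
  by rewrite map_minor.
split=> s t st.
  have [t0|t0] := eqVneq t 0.
    exists al0; rewrite t0 form0 mulf_neq0 // expf_neq0 //.
    by apply: contraNneq st => ->; rewrite t0.
  have NzB : map_mx (horner_eval (s / t)) N *m map_mx (horner_eval (s / t)) B = 1%:M.
    by rewrite -map_mxM NB map_mx1.
  have [al hal] := minor_neq0 NzB.
  by exists al; rewrite form1 // -mz mulf_neq0 ?expf_neq0.
have [t0|t0] := eqVneq t 0; last first.
  have [C hC] := exists_det (t ^+ d).
  exists (C *m map_mx (horner_eval (s / t)) N); split.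
    by move=> al; rewrite form1 // minor_mull hC mz.
  exact/isotropic_mull/map_isotropic.
pose Y := chartmx (minor N) al0; pose Yd := map_mx (coefp d) Y.
have YE : Y = \adj (colsub (sel al0) N) *m N by exact: chartmxE.
have szY i j : (size (Y i j) <= d.+1)%N.
  rewrite mxE; have [->|[ga [_ -> _]]] := altextP (minor N) (repl al0 i j).
    by rewrite size_poly0.
  by rewrite -signr_odd; case: odd; rewrite ?expr1 ?mulN1r ?size_polyN ?expr0 ?mul1r szN.
have isoY : Y *m Omega _ n *m Y^T = 0 by rewrite YE; exact: isotropic_mull.
have isoYd : Yd *m Omega _ n *m Yd^T = 0.
  apply/matrixP => u v; have /matrixP/(_ u v) := isoY.
  move/(congr1 (fun q : {poly K} => q`_(d + d))); rewrite !mxE coef0 => e; rewrite -[RHS]e coef_sum; apply: eq_bigr => j _.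
  rewrite [trmx Yd j v]mxE [Yd v j]mxE [trmx Y j v]mxE.
  have entry : (Y *m Omega _ n) u j = osg K (rev_ord j) *: Y u (rev_ord j).
    rewrite mxE (bigD1 (rev_ord j)) //= big1 ?addr0 => [|k kj].
      rewrite OmegaE rev_ordK eqxx mulr1 mulrC /osg.
      by case: ifP; rewrite ?mul1r ?scale1r // mulN1r scaleN1r.
    rewrite OmegaE [j == _]eq_sym (can2_eq (@rev_ordK _) (@rev_ordK _)) (negPf kj).
    by rewrite !mulr0.
  have entryd : (Yd *m Omega _ n) u j = osg K (rev_ord j) * (Y u (rev_ord j))`_d.
    rewrite mxE (bigD1 (rev_ord j)) //= big1 ?addr0 => [|k kj].
      by rewrite OmegaE rev_ordK eqxx mulr1 mulrC [Yd _ _]mxE.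
    rewrite OmegaE [j == _]eq_sym (can2_eq (@rev_ordK _) (@rev_ordK _)) (negPf kj).
    by rewrite !mulr0.
  rewrite entry entryd -mulrA -coefM_top //.
  by rewrite -(coefZ (osg K (rev_ord j))) scalerAl.
have minYd be : (minor N al0)`_d * minor Yd be = (minor N al0)`_d ^+ n * (minor N be)`_d.
  (* Both sides of this identity have degree at most (n + 1) d; the coefficients of that degree give
     the identity for the leading matrices. *)
  have := cdet_chartmx (P := minor N) al0 (size_enum_nsubset be) (fun _ => erefl).
  rewrite -minor_cdet altext_enum -/Y => /(congr1 (fun q : {poly K} => q`_(d + n * d))).
  have hYd : (minor Y be)`_(n * d) = minor Yd be.
    rewrite minor_sel coef_det_top => [|i j]; last by rewrite mxE.
    by congr (\det _); apply/matrixP => i j; rewrite !mxE.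
  rewrite coefM_top ?szN //; last first.
    by rewrite minor_sel; apply: size_det_top => i j; rewrite mxE.
  rewrite hYd => ->; rewrite addnC.
  have [h1 h2] := @coef_prod_top K _ (enum 'I_n) (fun=> minor N al0) d (fun=> szN al0).
  rewrite size_enum_ord !big_enum !prodr_const card_ord in h1 h2.
  by rewrite coefM_top // h2.
have [C hC] := exists_det (s ^+ d * (minor N al0)`_d / (minor N al0)`_d ^+ n).
exists (C *m Yd); split; last exact: isotropic_mull.
move=> al; rewrite t0 form0 minor_mull hC.
apply: (mulfI (expf_neq0 n top0)); rewrite mulrA -minYd.
by rewrite [RHS]mulrA [X in _ = X * _]mulrC divfK ?expf_neq0 // [LHS]mulrC mulrA.
Qed.

End FrameMaps.

(** * Separation of standard monomials by their degrees *)

Lemma base_digits_inj (W N : nat) (e e' : nat -> nat) :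
  (forall i, e i < W)%N -> (forall i, e' i < W)%N ->
  (\sum_(i < N) e i * W ^ i = \sum_(i < N) e' i * W ^ i)%N ->
  forall i, (i < N)%N -> e i = e' i.
Proof.
elim: N e e' => [//|N IH] e e' he he'; rewrite !big_ord_recl /= !expn0 !muln1.
have W0 : (0 < W)%N by exact: leq_ltn_trans (leq0n _) (he 0%N).
have shift (a : nat -> nat) : (\sum_(i < N) a (bump 0 i) * W ^ bump 0 i
     = W * \sum_(i < N) a i.+1 * W ^ i)%N.
  by rewrite big_distrr; apply: eq_bigr => i _; rewrite /bump add1n expnS /= mulnCA.
rewrite !shift => h.
have h0 : e 0%N = e' 0%N.
  have := congr1 (modn^~ W) h.
  by rewrite -!(mulnC _ W) !(addnC (_ 0%N)) !modnMDl !modn_small.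
have hS : (\sum_(i < N) e i.+1 * W ^ i = \sum_(i < N) e' i.+1 * W ^ i)%N.
  by apply/eqP; rewrite -(eqn_pmul2l W0) -(eqn_add2l (e 0%N)) {2}h0 h.
case=> [//|i hi]; exact: (IH (fun i => e i.+1) (fun i => e' i.+1)).
Qed.

Lemma seq_argmax (T : eqType) (F : T -> nat) (r : seq T) : r != [::] ->
  exists2 x, x \in r & forall y, y \in r -> (F y <= F x)%N.
Proof.
elim: r => // x [|y r] IH _; first by exists x; rewrite ?inE // => z; rewrite inE => /eqP->.
have [//|u ur hu] := IH; case: (leqP (F x) (F u)) => h.
  exists u => [|z]; first by rewrite inE ur orbT.
  by rewrite inE => /orP[/eqP->|/hu].
exists x => [|z]; first by rewrite inE eqxx.
by rewrite inE => /orP[/eqP->//|/hu hz]; exact: leq_trans hz (ltnW h).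
Qed.

Lemma distinct_sizes_free (K : fieldType) (T : eqType) (r : seq T) (c : T -> K) (q : T -> {poly K}) :
  uniq r -> (forall x, x \in r -> q x != 0) ->
  {in r &, injective (fun x => size (q x))} ->
  \sum_(x <- r) c x *: q x = 0 -> forall x, x \in r -> c x = 0.
Proof.
move=> ur nz inj e x xr; apply/eqP; apply: contraT => cx.
have [|y] := @seq_argmax T (fun z => size (q z)) [seq z <- r | c z != 0].
  apply/eqP => r0; have : x \in [seq z <- r | c z != 0] by rewrite mem_filter cx.
  by rewrite r0.
rewrite mem_filter => /andP[cy yr] hy.
have := congr1 (fun p : {poly K} => p`_(size (q y)).-1) e.
rewrite coef0 coef_sum (bigD1_seq y) //= big_seq_cond big1 => [|z /andP[zr zy]].
  by rewrite addr0 coefZ -/(lead_coef _) => /eqP; rewrite mulf_eq0 (negPf cy) lead_coef_eq0 (negPf (nz y yr)).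
rewrite coefZ; have [->|cz] := eqVneq (c z) 0; first by rewrite mul0r.
rewrite nth_default ?mulr0 //.
have le := hy z; rewrite mem_filter cz zr in le; have {}le : (size (q z) <= size (q y))%N by exact: le.
have ne : size (q z) != size (q y) by apply: contraNneq zy => /inj->.
by rewrite -ltnS prednK ?size_poly_gt0 ?nz // ltn_neqAle ne.
Qed.

Section Independence.
Variables (n d : nat).
Hypothesis n_gt0 : (0 < n)%N.
Implicit Types (A : pidx n d) (s t : seq (pidx n d)).

(** There are d + n sweeps through the n + 1 values of v, a mirror pair counting once. *)
Definition steps : nat := ((d + n) * n.+1)%N.

(** The subtracted term is the time of the move from depth j at y, so later moves get smaller
    exponents; mirror positions share theirs. *)
Definition step_exponent (y j : nat) : nat :=
  (steps.-1 - (j * n.+1 + (n - minn y (n + n - y))))%N.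

Lemma step_time_lt (y j : nat) : (j < d + n)%N ->
  (j * n.+1 + (n - minn y (n + n - y)) < steps)%N.
Proof.
move=> hj; apply: (@leq_trans (j.+1 * n.+1)); last by rewrite leq_mul2r hj orbT.
by rewrite mulSn addnC ltn_add2r ltnS leq_subr.
Qed.

Lemma step_exponent_lt (y j : nat) : (step_exponent y j < steps)%N.
Proof.
have s0 : (0 < steps)%N by rewrite muln_gt0 addn_gt0 n_gt0 orbT.
by rewrite -[X in (_ < X)%N](prednK s0) ltnS leq_subr.
Qed.

Lemma step_exponent_inj (y y' j j' : nat) : (j < d + n)%N -> (j' < d + n)%N ->
  (step_exponent y j == step_exponent y' j') =
  (minn y (n + n - y) == minn y' (n + n - y'))%N && (j == j').
Proof.
move=> hj hj'; apply/eqP/andP => [|[/eqP e /eqP->]]; last by rewrite /step_exponent e.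
have := step_time_lt y hj; have := step_time_lt y' hj'; rewrite /step_exponent.
set b := (n - minn y _)%N; set b' := (n - minn y' _)%N => h1 h2 h3.
have e : (j * n.+1 + b = j' * n.+1 + b')%N by lia.
have hb : (b < n.+1)%N by rewrite ltnS leq_subr.
have hb' : (b' < n.+1)%N by rewrite ltnS leq_subr.
have jj : j = j'.
  by have := congr1 (divn^~ n.+1) e; rewrite !divnMDl // !divn_small // !addn0.
by move: e; rewrite jj => /addnI ebb; split=> //; apply/eqP; move: ebb; rewrite /b /b'; lia.
Qed.

Definition kweight (W y j : nat) : nat := (W ^ step_exponent y j)%N.

(** The coefficient of W ^ i in the degree due to one variable. The place [steps], above those of
    all moves, counts the variable itself. *)
Definition digit A (i : nat) : nat :=
  if i == steps then 1%N else (\sum_(y < n + n) \sum_(j < pdep A y) (step_exponent y j == i))%N.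

Definition total_weight (W : nat) s : nat :=
  (\sum_(A <- s) (W ^ steps + weight (kweight W) A.1 A.2))%N.

Lemma pdep_le_dn A k : (k <= n + n)%N -> (pdep A k <= d + n)%N.
Proof. by move=> kn; apply: leq_trans (pdep_le n_gt0 A kn) _; lia. Qed.

Lemma digit_le A i : (digit A i <= 1 + (n + n) * (d + n))%N.
Proof.
rewrite /digit; case: ifP => _ //; apply: leq_trans (leq_addl _ _).
rewrite -[X in (_ <= X * _)%N](card_ord (n + n)) -sum_nat_const; apply: leq_sum => y _.
apply: leq_trans (pdep_le_dn A (ltnW (ltn_ord y))).
rewrite -[leqRHS](card_ord (pdep A y)) -sum1_card; apply: leq_sum => j _; exact: leq_b1.
Qed.

Lemma total_weightE W s :
  total_weight W s = (\sum_(i < steps.+1) (\sum_(A <- s) digit A i) * W ^ i)%N.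
Proof.
rewrite /total_weight; under [RHS]eq_bigr do rewrite big_distrl /=.
rewrite [RHS]exchange_big /=; apply: eq_bigr => A _; rewrite big_ord_recr /= addnC.
congr (_ + _)%N; last by rewrite /digit eqxx mul1n.
rewrite /weight /kweight -/(pdep A _).
transitivity (\sum_(y < n + n) \sum_(j < pdep A y) \sum_(i < steps)
    (step_exponent y j == i) * W ^ i)%N.
  apply: eq_bigr => y _; apply: eq_bigr => j _.
  rewrite (bigD1 (Ordinal (step_exponent_lt y j))) //= eqxx mul1n big1 ?addn0 // => i hi.
  by rewrite eq_sym -[_ == _ :> nat]/(i == Ordinal (step_exponent_lt y j)) (negPf hi).
transitivity (\sum_(y < n + n) \sum_(i < steps) \sum_(j < pdep A y)
    (step_exponent y j == i) * W ^ i)%N.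
  by apply: eq_bigr => y _; rewrite exchange_big.
rewrite exchange_big; apply: eq_bigr => i _; rewrite /digit ltn_eqF // big_distrl /=.
by apply: eq_bigr => y _; rewrite big_distrl.
Qed.

(** For v = 0 and v = n the two entries of [depths] coincide but come from a single position y < 2n,
    hence the factor 2. *)
Lemma count_depths s v j : (v <= n)%N -> (j < d + n)%N ->
  count (fun z => j < z)%N (depths s v) =
  ((if (v == 0) || (v == n) then 2 else 1) * \sum_(A <- s) digit A (step_exponent v j))%N.
Proof.
move=> vn hj; elim: s => [|A s IH]; first by rewrite big_nil muln0.
rewrite big_cons mulnDr -IH /depths /= addnA; congr (_ + _)%N.
rewrite /digit (ltn_eqF (step_exponent_lt v j)).
have -> : (\sum_(y < n + n) \sum_(j0 < pdep A y) (step_exponent y j0 == step_exponent v j)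
   = \sum_(y < n + n | minn y (n + n - y) == v) (j < pdep A y))%N.
  rewrite [RHS]big_mkcond; apply: eq_bigr => y _.
  have hmin : minn v (n + n - v) = v by lia.
  have jlt (j0 : 'I_(pdep A y)) : (j0 < d + n)%N.
    exact: leq_trans (ltn_ord j0) (pdep_le_dn A (ltnW (ltn_ord y))).
  under eq_bigr => j0 _ do rewrite step_exponent_inj // hmin.
  case: eqP => _ /=; last by rewrite big1.
  case: ltnP => hjy.
    rewrite (bigD1 (Ordinal hjy)) //= eqxx big1 // => j0.
    by rewrite -val_eqE /= => /negPf->.
  by rewrite big1 // => j0 _; rewrite ltn_eqF // (leq_trans (ltn_ord j0)).
have vn2 : (v < n + n)%N by lia.
have d0 : pdep A (n + n) = pdep A 0.
  have := dep_below A.1 A.2 (leqnn (n + n)); have := dep_below A.1 A.2 (leq0n (n + n)).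
  by rewrite below_full card_val below0 /pdep; lia.
have [v0|v0] := eqVneq v 0%N; rewrite /=.
  rewrite v0 subn0 d0 (big_pred1 (Ordinal vn2)) /= => [|y]; first by rewrite ?v0 mul2n addnn.
  by rewrite /= -val_eqE /= v0; apply/eqP/eqP; have := ltn_ord y; lia.
have [vE|vE] := eqVneq v n.
  rewrite vE addnK (big_pred1 (Ordinal vn2)) /= => [|y]; first by rewrite ?vE mul2n addnn.
  by rewrite /= -val_eqE /= vE; apply/eqP/eqP; have := ltn_ord y; lia.
have v'n : (n + n - v < n + n)%N by lia.
rewrite mul1n (bigD1 (Ordinal vn2)) /=; last by apply/eqP; lia.
rewrite (bigD1 (Ordinal v'n)) /=; last by apply/andP; split; [apply/eqP | rewrite -val_eqE /=]; lia.
rewrite big1 ?addn0 // => y; rewrite -!val_eqE /=; have := ltn_ord y; lia.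
Qed.

Lemma total_weight_inj W s t : std s -> std t ->
  (size s * (1 + (n + n) * (d + n)) < W)%N -> (size t * (1 + (n + n) * (d + n)) < W)%N ->
  total_weight W s = total_weight W t -> s = t.
Proof.
move=> ss st hs ht; rewrite !total_weightE => e.
have bnd (r : seq (pidx n d)) i : (size r * (1 + (n + n) * (d + n)) < W)%N ->
    (\sum_(A <- r) digit A i < W)%N.
  apply: leq_ltn_trans; elim: r => [|A r IH]; first by rewrite big_nil.
  by rewrite big_cons /= mulSn; apply: leq_add => //; exact: digit_le.
have dig := base_digits_inj (fun i => bnd s i hs) (fun i => bnd t i ht) e.
have szst : size s = size t.
  by have := dig steps (ltnSn _); rewrite /digit eqxx !big_const_seq !count_predT !iter_addn_0 !mul1n.
apply: (depths_inj n_gt0 szst) => v vn.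
apply: eq_sorted_count; [exact: sorted_depths | exact: sorted_depths | |].
  have szd (r : seq (pidx n d)) : size (depths r v) = (size r).*2.
    by elim: r => //= A r; rewrite /depths /= => ->.
  by rewrite !szd szst.
move=> j; case: (ltnP j (d + n)) => hj.
  by rewrite !count_depths // dig // ltnS ltnW // step_exponent_lt.
have cnt0 (r : seq (pidx n d)) : count (fun z => j < z)%N (depths r v) = 0%N.
  elim: r => //= A r; rewrite /depths /= => ->.
  have vn2 : (v <= n + n)%N by exact: leq_trans vn (leq_addr n n).
  by rewrite !ltnNge !(leq_trans (pdep_le_dn A _) hj) // leq_subr.
by rewrite !cnt0.
Qed.

Lemma kweight_decr W x i j : (1 < W)%N -> (i < j < d + n)%N -> (kweight W x j < kweight W x i)%N.
Proof.
move=> hW /andP[ij jd]; rewrite ltn_exp2l // /step_exponent.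
have := step_time_lt x jd.
have : (i.+1 * n.+1 <= j * n.+1)%N by rewrite leq_mul2r ij orbT.
have := leq_subr (minn x (n + n - x)) n; rewrite mulSn; lia.
Qed.

Lemma kweight_sym W x j : (x <= n)%N -> kweight W (n + n - x) j = kweight W x j.
Proof.
move=> xn; rewrite /kweight /step_exponent; congr (_ ^ (_ - (_ + (_ - _))))%N; lia.
Qed.

End Independence.

Section StandardIndependence.
Variables (R : realType) (n d : nat).
Local Notation K := (Cplx R).

Lemma regroup_pmonom (ts : seq (K * seq (pidx n d))) :
  \sum_(u <- ts) u.1 *: pmonom R u.2 =
  \sum_(s <- undup [seq u.2 | u <- ts]) (\sum_(u <- ts | u.2 == s) u.1) *: pmonom R s.
Proof.
under [RHS]eq_bigr => s _ do rewrite scaler_suml.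
rewrite (exchange_big_dep xpredT) //= [LHS]big_seq [RHS]big_seq; apply: eq_bigr => u uts.
rewrite -big_filter; have -> : [seq s <- undup [seq u.2 | u <- ts] | u.2 == s] = [:: u.2].
  rewrite (eq_filter (a2 := pred1 u.2)) => [|s]; last by rewrite /= eq_sym.
  by rewrite filter_pred1_uniq ?undup_uniq // mem_undup map_f.
by rewrite big_seq1.
Qed.

Hypothesis n_gt0 : (0 < n)%N.

Lemma nsubset_inhabited : inhabited (nsubset n).
Proof.
have h : #|[set lshift n i | i : 'I_n]| == n by rewrite card_imset ?card_ord //; exact: lshift_inj.
exact: inhabits (exist (fun A : {set 'I_(n + n)} => #|A| == n) _ h).
Qed.

Lemma attained_final (A : pidx n d) : attained (final_state n d) A.1 A.2.
Proof. by apply/forallP => y; exact: (pdep_le n_gt0 A (ltnW (ltn_ord y))). Qed.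

Lemma std_independent (S : seq (seq (pidx n d))) (c : seq (pidx n d) -> K) :
  uniq S -> (forall s, s \in S -> std s) -> ILQ (\sum_(s <- S) c s *: pmonom R s) ->
  forall s, s \in S -> c s = 0.
Proof.
move=> uS stdS hI.
pose mx := (\sum_(s <- S) size s)%N.
(* Larger than every digit of every monomial of S, and at least 2 so that the powers of W
   increase. *)
pose W := (mx * (1 + (n + n) * (d + n))).+2.
have szW s : s \in S -> (size s * (1 + (n + n) * (d + n)) < W)%N.
  move=> sS; rewrite /W !ltnS; apply: leq_trans (leqnSn _); rewrite leq_mul2r; apply/orP; right.
  by rewrite /mx (bigD1_seq s) //= leq_addr.
have wd x i j : (i < j < d + n)%N -> (kweight n d W x j < kweight n d W x i)%N.
  exact: kweight_decr.
have [M [isoM [B MB] degM]] := good_final K n_gt0 wd (@kweight_sym n d n_gt0 W).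
pose P (A : pidx n d) : {poly K} := (minor M A.1)`_A.2.
have szP A : size (P A) = (weight (kweight n d W) A.1 A.2).+1.
  by have := degM A.1 A.2; rewrite attained_final.
have [al0] := nsubset_inhabited.
(* Where the level-d coordinate [top] is nonzero, the specialized frame meets the degree condition
   of [LGMap_frame]. *)
pose top := P (al0, ord_max).
have top0 : top != 0 by rewrite -size_poly_gt0 szP.
have hLG x : top.[x] != 0 -> LGMap (fun A => (P A).[x]).
  move=> hx; pose N := map_mx (map_poly (horner_eval x)) M.
  have mN al : minor N al = map_poly (horner_eval x) (minor M al) by exact: map_minor.
  have cN al a : (minor N al)`_a = ((minor M al)`_a).[x] by rewrite mN coef_map.
  have : LGMap (fun A : pidx n d => (minor N A.1)`_A.2).
    apply: LGMap_frame => //.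
    - exact: map_isotropic.
    - by exists (map_mx (map_poly (horner_eval x)) B); rewrite -map_mxM MB map_mx1.
    - move=> al; apply/leq_sizeP => a da; rewrite cN.
      have := degM al a; case: ifP => [/forallP h|_ ->]; last by rewrite horner0.
      have h0 : (0 < n + n)%N by rewrite addn_gt0 n_gt0.
      have := h (Ordinal h0); rewrite /final_state /= min0n addn0.
      by have := dep_below al a (leq0n (n + n)); rewrite below0 min0n add0n addn0 => ->; rewrite leqNgt da.
    - by exists al0; rewrite cN.
  move=> [h1 h2]; split=> s t /[dup] st; last move/h2 => [A [hA isoA]].
    by move/h1 => [al hal]; exists al; move: hal; rewrite /Defs.form; under eq_bigr do rewrite cN.
  exists A; split=> // al; rewrite -hA /Defs.form.
  by apply: eq_bigr => b _; rewrite cN.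
pose q (s : seq (pidx n d)) : {poly K} := \prod_(A <- s) ('X^(W ^ steps n d) * P A).
have szq s : size (q s) = (total_weight W s).+1.
  rewrite /q /total_weight; elim: s => [|A s IH]; first by rewrite !big_nil size_poly1.
  have sA : size ('X^(W ^ steps n d) * P A) =
      (W ^ steps n d + weight (kweight n d W) A.1 A.2).+1.
    rewrite mulrC size_Mmonic ?monicXn // ?size_polyXn ?szP; last by rewrite -size_poly_gt0 szP.
    by rewrite addSn addnS /= addnC.
  by rewrite !big_cons size_mul -?size_poly_gt0 ?IH ?sA // addSn addnS.
apply: (distinct_sizes_free (q := q) uS) => [s _|s t sS tS|].
- by rewrite -size_poly_gt0 szq.
- rewrite !szq => -[]; apply: total_weight_inj => //; [exact: stdS | exact: stdS | exact: szW | exact: szW].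
(* The factor [top] makes the identity trivial at parameters where the specialization is not known
   to be a map of degree d. *)
apply/eqP; rewrite -[_ == 0](inj_eq (mulfI top0)) mulr0; apply/eqP.
apply: poly_ext => x; rewrite horner0 hornerM.
have [->|hx] := eqVneq top.[x] 0; first by rewrite mul0r.
have := hI _ (hLG x hx) (x ^+ (W ^ steps n d)); rewrite /evalp rmorph_sum => e.
rewrite horner_sum -[X in _ * X = _](_ : \sum_(s <- S) (c s *: pmonom R s).@[fun k =>
   x ^+ (W ^ steps n d) * (P (enum_val k)).[x]] = _); first by rewrite e mulr0.
apply: eq_bigr => s _; rewrite mevalZ hornerZ; congr (_ * _).
rewrite /pmonom /q rmorph_prod horner_prod; apply: eq_bigr => A _ /=.
by rewrite hornerM hornerXn /pvar mevalXU enum_rankK.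
Qed.

End StandardIndependence.

Theorem theorem5p10 (R : realType) (n d : nat) (hn : (1 <= n)%N)
  (f : {mpoly (complex R)[nvar n d]}) :
  in_I_plus_L f <-> ILQ f.
Proof.
split=> [|fI]; first exact: in_I_plus_L_ILQ.
have [ts hts e] := comb_std hn f; rewrite regroup_pmonom in e.
set S := undup _ in e; set c := (fun s => \sum_(u <- ts | u.2 == s) u.1).
have gI : ILQ (\sum_(s <- S) c s *: pmonom R s).
  move=> p hp l; have := in_I_plus_L_ILQ e hp l; have := fI p hp l.
  by rewrite /evalp mevalB => -> /eqP; rewrite sub0r oppr_eq0 => /eqP.
have c0 s : s \in S -> c s = 0.
  apply: std_independent gI s => //; first exact: undup_uniq.
  by move=> s; rewrite mem_undup => /mapP[u /hts hu ->].
suff g0 : \sum_(s <- S) c s *: pmonom R s = 0 by rewrite -[f]subr0 -g0.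
by rewrite big_seq big1 // => s /c0->; rewrite scale0r.
Qed.
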